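(* Let $d\ge 2$ be an integer and let $P_d(x)=\sum_{k=2}^d a_k x^k$ be a real polynomial of degree $d$. Suppose $C_n$ is the $n\times n$ random circulant matrix with input sequence $\{X_i/\sqrt n\}_{i\ge 0}$ such that the $X_i$'s are independent symmetric $\sigma$-subgaussian random variables and $X_i\in\mathcal{L}(c_1,c_2)$ for some finite $c_1$ and $c_2$. Then, as $n\to\infty$, $$\frac{\mathrm{Tr}(P_d(C_n))-\mathbf{E}(\mathrm{Tr}(P_d(C_n)))}{\sqrt{\mathrm{Var}(\mathrm{Tr}(P_d(C_n)))}}\quad\text{converges in total variation to } N(0,1).$$
   Context: The circulant matrix with input sequence $\{x_i\}_{i\ge 0}$ is the $n\times n$ matrix $C_n$ whose $(i,j)$-th entry, $1\le i,j\le n$, is $x_{(j-i) \bmod n}$, where the residue is taken in $\{0,1,\dots,n-1\}$. Here $x_i=X_i/\sqrt n$, so the $(i,j)$ entry is $X_{(j-i)\bmod n}/\sqrt n$. $\mathrm{Tr}$ denotes the (unnormalized) trace, and $\mathbf{E}$, $\mathrm{Var}$ denote expectation and variance. For each $c_1,c_2>0$, $\mathcal{L}(c_1,c_2)$ is the class of probability measures on $\mathbb{R}$ that arise as laws of random variables $u(Z)$, where $Z$ is a standard Gaussian random variable and $u$ is a twice continuously differentiable function such that $|u'(x)|\le c_1$ and $|u''(x)|\le c_2$ for all $x\in\mathbb{R}$. Writing $X\in\mathcal{L}(c_1,c_2)$ means that the law of $X$ belongs to $\mathcal{L}(c_1,c_2)$. A random variable $X$ is $\sigma$-subgaussian (subgaussian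 with parameter $\sigma$, $\sigma>0$) if $\mathbf{E}[e^{tX}]\le e^{\sigma^2t^2/2}$ for every $t\in\mathbb{R}$. A random variable $X$ is symmetric if $X$ and $-X$ have the same law. Convergence in total variation of random variables $W_n$ to $N(0,1)$ means that the total variation distance $\sup_{B}|\mathbf{P}(W_n\in B)-\mathbf{P}(Z\in B)|$, with supremum over Borel sets $B\subseteq\mathbb{R}$ and $Z$ standard normal, tends to $0$.
   Formalization: Adds the assumption that the variances of the X_i are bounded below by a common v > 0; without nondegeneracy the claim fails, e.g. X_0 = Z, X_i = 0 for i ≥ 1 and P(x) = x^2 give the non-Gaussian (Z^2-1)/√2 for every n. *)

(* Defs.v *)
From HB Require Import structures.
From mathcomp Require Import all_boot all_order all_algebra.
From mathcomp Require Import all_classical all_reals all_analysis.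

Set Implicit Arguments.
Unset Strict Implicit.
Unset Printing Implicit Defensive.

Import Order.TTheory GRing.Theory Num.Theory.
Import numFieldNormedType.Exports.

Local Open Scope classical_set_scope.
Local Open Scope ring_scope.

(* The index is (j - i) mod n; adding n first keeps the truncated subtraction
   on nat faithful, since i < n. *)
Definition circulant (R : realType) (n : nat) (x : nat -> R) : 'M[R]_n :=
  \matrix_(i < n, j < n) x ((j + n - i) %% n)%N.

Definition mutually_independent (d : measure_display) (T : measurableType d)
    (R : realType) (P : probability T R) (I : eqType)
    (X : I -> {RV P >-> R}) : Prop :=
  forall (s : seq I) (B : I -> set R), uniq s -> (forall i, measurable (B i)) ->
    P (\big[setI/setT]_(i <- s) (X i @^-1` B i)) =
    (\prod_(i <- s) P (X i @^-1` B i))%E.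

Definition symmetric_rv (d : measure_display) (T : measurableType d)
    (R : realType) (P : probability T R) (X : {RV P >-> R}) : Prop :=
  forall B : set R, measurable B ->
    pushforward P X B = pushforward P (\- X) B.

Definition subgaussian (d : measure_display) (T : measurableType d)
    (R : realType) (P : probability T R) (sigma : R)
    (X : {RV P >-> R}) : Prop :=
  forall t : R, ('M_P X t <= (expR (sigma ^+ 2 * t ^+ 2 / 2))%:E)%E.

Definition twice_continuously_differentiable (R : realType)
    (u : R -> R) : Prop :=
  [/\ forall x, derivable u x 1,
      forall x, derivable (derive1 u) x 1 &
      continuous (derive1n 2 u)].

(* mu is the law of u(Z) with Z standard Gaussian: the image of N(0,1) by u.
   Laws are compared on Borel sets only. *)
Definition class_L (R : realType) (c1 c2 : R) (mu : probability R R) : Prop :=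
  exists u : R -> R,
    [/\ twice_continuously_differentiable u,
        forall x, `|derive1 u x| <= c1,
        forall x, `|derive1n 2 u x| <= c2 &
        forall B : set R, measurable B ->
          mu B = pushforward (normal_prob 0 1) u B].

Definition tv_distance (R : realType) (mu nu : set R -> \bar R) : \bar R :=
  ereal_sup [set `|mu B - nu B|%E | B in [set B : set R | measurable B]].

(* Tr(P(C_n)) for C_n with input sequence X_i / sqrt n.  The dimension is a
   successor because evaluation of a polynomial at a matrix needs 'M_n to be a
   nontrivial ring. *)
Definition circulant_trace (T : Type) (R : realType) (X : nat -> T -> R)
    (p : {poly R}) (n : nat) (w : T) : R :=
  \tr (horner_mx
         (circulant n.+1 (fun i => X i w / Num.sqrt n.+1%:R)) p).

Definition standardized (d : measure_display) (T : measurableType d)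
    (R : realType) (P : probability T R) (Y : T -> R) (w : T) : R :=
  (Y w - fine 'E_P[Y]) / Num.sqrt (fine 'V_P[Y]).

(* Main.v *)
Require Import Defs.
From HB Require Import structures.
From mathcomp Require Import all_boot all_order all_algebra.
From mathcomp Require Import all_classical all_reals all_analysis.
From mathcomp Require Import measurable_realfun zify ring lra.

Set Implicit Arguments.
Unset Strict Implicit.
Unset Printing Implicit Defensive.

Import Order.TTheory GRing.Theory Num.Theory.
Import numFieldNormedType.Exports.

Local Open Scope classical_set_scope.
Local Open Scope ring_scope.

(** The proof is Stein's method, with the chain rule of Gaussian calculus
    replaced by one-dimensional integration by parts in each coordinate.

    Reduction to a Stein estimate.  For a Borel set B, the Stein equation
    f' - x f = 1_B - P(Z in B) is solved with f and f' bounded once the indicator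
    is replaced by a continuous function, which is possible up to a small error
    in measure for the two laws at hand; hence the total variation distance of W
    to N(0,1) is at most a constant times the supremum of |E f'(W) - E W f(W)|
    over C^1 functions with |f|, |f'| <= 1 ([stein_tv]).

    Stein kernels.  A law p that is the image of N(0,1) by a function u with
    bounded derivative has a bounded Stein kernel: a function tau with
    E[X psi(X)] = E[tau(X) psi'(X)] when X has law p.  One integrates by parts
    against the Gaussian density and conditions on u(Z), the conditional
    expectation being a Radon-Nikodym derivative; symmetry of p makes tau even
    ([class_L_stein_kernel]).  By independence the identity holds in each
    coordinate separately ([EX_stein]), for a test function of X_j composed with
    the trace, which is a polynomial in X_j.

    Algebra.  Put N = n+1 and r = sqrt N.  The trace is the sum over k of
    a_k r^(2-k) times the sum of X_(i_1) ... X_(i_k) over the tuples of indices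
    with i_1 + ... + i_k = 0 mod N ([circulant_trace_poly]).  Tuples with distinct
    entries form the multilinear part M = sum_S c_S X_S; the other tuples
    contribute a rest R ([trace_poly_split]).  With A_j the sum over the sets S
    containing j of c_S / |S| X_(S - j), one has M = sum_j X_j A_j, and A_j does
    not depend on X_j.  Hence, with D_j the derivative of the trace in X_j,
    E[M f(W)] is, up to normalization, E[T f'(W)] for T = sum_j tau_j A_j D_j
    ([stein_identity]).

    Sizes.  It remains to see that Var M is at least c N - C r, that E R^2 = O(1),
    and that T is within O(r) of its mean, so that the Stein estimate is O(1/r).
    All bounds come from two facts.  First, products of the X_i whose sets of
    indices with odd exponent differ are orthogonal, by symmetry ([EX_orth]), so
    that second moments are sums over such sets.  Secondly, each linear condition
    on a tuple of indices costs a factor N in a count: the condition of zero sum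
    ([sum_setD_le]), and the repetition of an index ([cnt_le]); the normalization
    r^(2-k) is exactly compensated by the first one, and repetitions are
    therefore negligible ([EX_rest_le], [EX_rest_grad_le]).  For T, whose
    derivatives D_j may be replaced by those of M, the products X_(S-j) X_(S'-j)
    are grouped by the symmetric difference D of S and S'.  The groups with D
    nonempty are orthogonal and have total size O(N) ([EX_odd_classes_le]); the
    group with D empty is a sum of terms that are independent for disjoint S
    ([EX_even_class_le]), so its variance is O(N) as well.

    The lower bound on Var M is obtained from the sets with d elements: there are
    about N^(d-1) / d! of them with sum 0 ([nset_ge]), each contributing at least
    v^d (a_d d!)^2 r^(4-2d) ([EX_main_part_sqr_ge]). *)

(** * Integrable real functions and Gaussian tails *)

Section RealIntegrable.
Context d (T : measurableType d) (R : realType).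
Variables (m : {measure set T -> \bar R}) (D : set T).
Hypothesis mD : measurable D.
Implicit Types f g : T -> R.

Lemma integrable_eqR f g : {in D, f =1 g} ->
  m.-integrable D (EFin \o f) -> m.-integrable D (EFin \o g).
Proof. by move=> fg; apply: eq_integrable => // x xD /=; rewrite fg. Qed.

Lemma integrableDR f g : m.-integrable D (EFin \o f) ->
  m.-integrable D (EFin \o g) -> m.-integrable D (EFin \o (fun x => f x + g x)).
Proof.
move=> If Ig; apply: (eq_integrable mD ((EFin \o f) \+ (EFin \o g))%E) => //.
exact: integrableD.
Qed.

Lemma integrableZR k f : m.-integrable D (EFin \o f) ->
  m.-integrable D (EFin \o (fun x => k * f x)).
Proof. by move=> If; apply: (integrableZl mD k If). Qed.

Lemma integrableNR f : m.-integrable D (EFin \o f) ->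
  m.-integrable D (EFin \o (fun x => - f x)).
Proof.
by move=> /(integrableZR (-1)); apply: integrable_eqR => x _; rewrite mulN1r.
Qed.

Lemma integrableBR f g : m.-integrable D (EFin \o f) ->
  m.-integrable D (EFin \o g) -> m.-integrable D (EFin \o (fun x => f x - g x)).
Proof. by move=> If Ig; apply: integrableDR => //; exact: integrableNR. Qed.

Lemma le_integrableR f g : measurable_fun D f ->
  (forall x, D x -> `|f x| <= g x) -> m.-integrable D (EFin \o g) ->
  m.-integrable D (EFin \o f).
Proof.
move=> mf fg; apply: le_integrable => //; first exact/measurable_EFinP.
by move=> x Dx /=; rewrite lee_fin (le_trans (fg x Dx))// ler_norm.
Qed.

Lemma integrable_mulb f g k : measurable_fun D g ->
  (forall x, D x -> `|g x| <= k) -> m.-integrable D (EFin \o f) ->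
  m.-integrable D (EFin \o (fun x => f x * g x)).
Proof.
move=> mg gk If; have /integrableP[/measurable_EFinP mf _] := If.
apply: (le_integrableR _ _ (integrableZR k (integrable_norm If))).
  exact: measurable_funM.
by move=> x Dx; rewrite normrM mulrC ler_wpM2r//; exact: gk.
Qed.

End RealIntegrable.

Section GaussianDensity.
Context {R : realType}.
Notation mu := (@lebesgue_measure R).
Notation phi := (@normal_pdf R 0 1).
Implicit Types x : R.

Lemma gauss_densityE x : phi x = normal_peak 1 * expR (- x ^+ 2 / 2).
Proof.
by rewrite normal_pdfE ?oner_neq0//= /normal_fun subr0 expr1n.
Qed.

Lemma gauss_density_gt0 x : 0 < phi x.
Proof. by rewrite gauss_densityE mulr_gt0 ?expR_gt0// normal_peak_gt0// oner_neq0. Qed.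

Lemma continuous_gauss_density : continuous phi.
Proof. exact: continuous_normal_pdf (oner_neq0 _). Qed.

Lemma gauss_density_even x : phi (- x) = phi x.
Proof. by rewrite !gauss_densityE sqrrN. Qed.

Lemma gauss_density_anti x y : 0 <= x -> x <= y -> phi y <= phi x.
Proof.
move=> x0 xy; rewrite !gauss_densityE ler_pM2l ?normal_peak_gt0 ?oner_neq0//.
rewrite ler_expR ler_pM2r ?invr_gt0// lerN2 ler_sqr ?nnegrE//.
exact: le_trans xy.
Qed.

Lemma is_derive_gauss_density x : is_derive x 1 phi (- (x * phi x)).
Proof.
have -> : phi = fun y => normal_peak 1 * expR (- y ^+ 2 / 2).
  by apply/funext => y; rewrite gauss_densityE.
apply: is_derive_eq.
rewrite /GRing.scale/= mulr0 mulr0 add0r !mulr1.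
by move: (expR _) (normal_peak _) => e c; field.
Qed.

(** From 1 + y <= expR y at y = x^2 / 2. *)
Lemma gauss_density_decay x : x ^+ 2 * phi x <= 2 * normal_peak 1.
Proof.
rewrite gauss_densityE mulrCA [leRHS]mulrC ler_pM2l ?normal_peak_gt0 ?oner_neq0//.
rewrite mulNr expRN ler_pdivrMr ?expR_gt0//.
have := expR_ge1Dx (x ^+ 2 / 2); lra.
Qed.

Lemma gauss_density_cvgy : phi x @[x --> +oo] --> 0.
Proof.
apply/cvgrPdist_le => e e0; near=> x.
rewrite sub0r normrN ger0_norm ?normal_pdf_ge0//.
have x0 : 0 < x by near: x; exact: nbhs_pinfty_gt.
suff: x ^+ 2 * phi x <= x ^+ 2 * e by rewrite ler_pM2l ?exprn_gt0.
apply: le_trans (gauss_density_decay x) _.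
have x1 : 1 <= x by near: x; apply: nbhs_pinfty_ge; rewrite num_real.
rewrite -ler_pdivrMr//.
have xx : 2 * normal_peak 1 / e <= x.
  by near: x; apply: nbhs_pinfty_ge; rewrite num_real.
by apply: le_trans xx _; rewrite expr2 ler_peMr// ltW.
Unshelve. all: by end_near. Qed.

Lemma integral_id_gauss_density x : 0 <= x ->
  (\int[mu]_(t in `[x, +oo[) (t * phi t)%:E = (phi x)%:E)%E.
Proof.
move=> x0.
have D (y : R) : is_derive y 1 (- phi) (y * phi y).
  by rewrite -[y * _]opprK; apply: is_deriveN; exact: is_derive_gauss_density.
rewrite (@ge0_continuous_FTC2y _ (fun t => t * phi t) (- phi) x 0).
- by rewrite sub0e /= opprK.
- by move=> t xt; rewrite mulr_ge0 ?(le_trans x0 xt)// normal_pdf_ge0.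
- apply: continuous_subspaceT => y; apply: cvgM; first exact: cvg_id.
  exact: continuous_gauss_density.
- have := @cvgN _ _ _ _ _ _ _ gauss_density_cvgy. by rewrite oppr0; apply.
- by move=> y _; apply: (@ex_derive _ _ _ _ _ _ _ (D y)).
- apply: cvgN; apply: cvg_at_right_filter; exact: continuous_gauss_density.
- by move=> y _; rewrite derive1E; apply: (@derive_val _ _ _ _ _ _ _ (D y)).
Qed.

Lemma integrable_gauss_density : mu.-integrable setT (EFin \o phi).
Proof. exact: integrable_normal_pdf. Qed.

Lemma integrable_abs_gauss_density :
  mu.-integrable setT (EFin \o (fun t => `|t| * phi t)).
Proof.
have c : continuous (fun t : R => `|t| * phi t).
  move=> y; apply: cvgM; first exact: norm_continuous.
  exact: continuous_gauss_density.
have p (t : R) : 0 <= `|t| * phi t by rewrite mulr_ge0// normal_pdf_ge0.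
apply/integrableP; split.
  by apply/measurable_EFinP; exact: continuous_measurable_fun.
under eq_integral do rewrite /= ger0_norm//.
rewrite ge0_symfun_integralT//; last by move=> t /=; rewrite normrN gauss_density_even.
rewrite -set_itvcy.
suff -> : (\int[mu]_(t in `[0%R, +oo[) (`|t| * phi t)%:E = (phi 0)%:E)%E.
  by rewrite -EFinM ltry.
rewrite -integral_id_gauss_density//; apply: eq_integral => t.
by rewrite inE/= in_itv/= andbT => t0; rewrite ger0_norm.
Qed.

Lemma integrable_growth (a b : R) :
  mu.-integrable setT (EFin \o (fun t => (a + b * `|t|) * phi t)).
Proof.
have I1 := integrableZR measurableT a integrable_gauss_density.
have I2 := integrableZR measurableT b integrable_abs_gauss_density.
apply: integrable_eqR (integrableDR measurableT I1 I2) => // t _.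
by rewrite mulrDl -mulrA.
Qed.

Lemma integrable_growth_mul (u : R -> R) (a b : R) : continuous u ->
  (forall t, `|u t| <= a + b * `|t|) ->
  mu.-integrable setT (EFin \o (fun t => u t * phi t)).
Proof.
move=> cu ub; apply: (le_integrableR measurableT _ _ (integrable_growth a b)).
  apply: continuous_measurable_fun => y.
  by apply: cvgM; [exact: cu | exact: continuous_gauss_density].
move=> t _; rewrite normrM (ger0_norm (normal_pdf_ge0 _ _ _)).
by rewrite ler_pM2r ?gauss_density_gt0.
Qed.

Definition growth_tail (a b x : R) :=
  \int[mu]_(t in `[x, +oo[) ((a + b * `|t|) * phi t).

Lemma growth_tailN (a b x : R) : 0 <= a -> 0 <= b ->
  \int[mu]_(t in `]-oo, - x]) ((a + b * `|t|) * phi t) = growth_tail a b x.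
Proof.
move=> a0 b0; rewrite /growth_tail /Rintegral ge0_integration_by_substitutionNy.
- congr fine; apply: eq_integral => t _ /=.
  by rewrite normrN gauss_density_even.
- apply: continuous_subspaceT => y; apply: cvgM; last exact: continuous_gauss_density.
  apply: cvgD; first exact: cvg_cst.
  by apply: cvgM; [exact: cvg_cst | exact: norm_continuous].
- by move=> t _; rewrite mulr_ge0 ?normal_pdf_ge0// addr_ge0// mulr_ge0.
Qed.

Lemma Rintegral_id_gauss_density (a x : R) : 0 <= x ->
  \int[mu]_(t in `[x, +oo[) (a * (t * phi t)) = a * phi x.
Proof.
move=> x0; rewrite RintegralZl//; last first.
  have I : mu.-integrable `[x, +oo[ (EFin \o (fun t => `|t| * phi t)).
    by apply: integrableS integrable_abs_gauss_density.
  apply: integrable_eqR I => // t; rewrite inE/= in_itv/= andbT => xt.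
  by rewrite ger0_norm// (le_trans x0).
by rewrite /Rintegral integral_id_gauss_density.
Qed.

Definition gauss_tail (x : R) := \int[mu]_(t in `[x, +oo[) phi t.

Lemma integrable_gauss_densityS (x : R) : mu.-integrable `[x, +oo[ (EFin \o phi).
Proof. by apply: integrableS integrable_gauss_density. Qed.

Lemma gauss_tail_ge0 x : 0 <= gauss_tail x.
Proof. by apply: Rintegral_ge0 => t _; exact: normal_pdf_ge0. Qed.

Lemma gauss_tail_le1 x : gauss_tail x <= 1.
Proof.
rewrite /gauss_tail /Rintegral -lee_fin fineK; last first.
  by apply: integrable_fin_num => //; exact: integrable_gauss_densityS.
rewrite -(integral_normal_pdf 0 1); apply: ge0_subset_integral => //.
  by apply/measurable_EFinP; exact: measurable_normal_pdf.
by move=> t _; rewrite lee_fin normal_pdf_ge0.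
Qed.

(** Mills' inequality: on [x, +oo[ one has x <= t, and t * phi t has the
    antiderivative - phi. *)
Lemma gauss_tail_mul_le x : 0 <= x -> x * gauss_tail x <= phi x.
Proof.
move=> x0; rewrite -[leRHS]mul1r -Rintegral_id_gauss_density//.
rewrite -RintegralZl//; last exact: integrable_gauss_densityS.
apply: le_Rintegral => //.
- exact: (integrableZR _ _ (integrable_gauss_densityS _)).
- have I : mu.-integrable `[x, +oo[ (EFin \o (fun t => `|t| * phi t)).
    by apply: integrableS integrable_abs_gauss_density.
  apply: integrable_eqR I => // t; rewrite inE/= in_itv/= andbT => xt.
  by rewrite ger0_norm ?mul1r// (le_trans x0).
- move=> t; rewrite /= in_itv/= andbT => xt.
  by rewrite mul1r ler_wpM2r// normal_pdf_ge0.
Qed.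

(** Bound on the Mills ratio of the half-line: by 1 beyond 1, and by the inverse
    of the smallest value of the density before. *)
Definition growth_cst : R := 1 + (phi 1)^-1.

Lemma growth_cst_ge1 : 1 <= growth_cst.
Proof. by rewrite lerDl invr_ge0 normal_pdf_ge0. Qed.

Lemma gauss_tail_le x : 0 <= x -> gauss_tail x <= growth_cst * phi x.
Proof.
move=> x0; have [x1|x1] := leP 1 x.
  apply: (@le_trans _ _ (phi x)); last first.
    by rewrite ler_peMl ?normal_pdf_ge0// growth_cst_ge1.
  apply: le_trans (gauss_tail_mul_le x0).
  by rewrite ler_peMl// gauss_tail_ge0.
apply: (le_trans (gauss_tail_le1 x)).
rewrite mulrDl mul1r -[leLHS]add0r lerD ?normal_pdf_ge0//.
by rewrite mulrC ler_pdivlMr ?gauss_density_gt0// mul1r gauss_density_anti// ltW.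
Qed.

Lemma growth_tailE (a b x : R) : 0 <= x ->
  growth_tail a b x = a * gauss_tail x + b * phi x.
Proof.
move=> x0; rewrite -(Rintegral_id_gauss_density b x0).
have I : mu.-integrable `[x, +oo[ (EFin \o (fun t => b * (t * phi t))).
  have I : mu.-integrable `[x, +oo[ (EFin \o (fun t => `|t| * phi t)).
    by apply: integrableS integrable_abs_gauss_density.
  apply: integrable_eqR (integrableZR _ b I) => // t.
  by rewrite inE/= in_itv/= andbT => xt; rewrite ger0_norm// (le_trans x0).
rewrite -RintegralZl//; last exact: integrable_gauss_densityS.
rewrite -RintegralD//; last exact: (integrableZR _ _ (integrable_gauss_densityS _)).
apply: eq_Rintegral => t; rewrite inE/= in_itv/= andbT => xt.
by rewrite ger0_norm ?mulrDl ?mulrA// (le_trans x0).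
Qed.

(** The antiderivative from -oo of u against the Gaussian density.  Divided
    by the density it is the Stein kernel of u(Z) up to the factor - u', and
    also the solution of the Stein equation with right-hand side u. *)
Definition gauss_prim (u : R -> R) (x : R) :=
  \int[mu]_(t in `]-oo, x]) (u t * phi t).

Section GaussPrim.
Variables (u : R -> R) (a b : R).
Hypotheses (cu : continuous u) (a0 : 0 <= a) (b0 : 0 <= b).
Hypothesis ub : forall t, `|u t| <= a + b * `|t|.
Hypothesis u0 : \int[mu]_t (u t * phi t) = 0.

Let intu : mu.-integrable setT (EFin \o (fun t => u t * phi t)).
Proof. exact: integrable_growth_mul ub. Qed.

Lemma is_derive_gauss_prim (x : R) : is_derive x 1 (gauss_prim u) (u x * phi x).
Proof.
have xx : x < x + 1 by rewrite ltrDl.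
have I : mu.-integrable `]-oo, x + 1] (EFin \o (fun t => u t * phi t)).
  by apply: integrableS intu.
have c : {for x, continuous (fun t => u t * phi t)}.
  by apply: cvgM; [exact: cu | exact: continuous_gauss_density].
have [D E] := continuous_FTC1 xx I (ltNyr x) c.
by rewrite derive1E in E; exact: (DeriveDef D E).
Qed.

(** As u has Gaussian mean 0, the integral of u over ]-oo, x] is minus the one over
    [x, +oo[; the tail on the side of x away from 0 is used. *)
Lemma gauss_prim_le_tail (x : R) : `|gauss_prim u x| <= growth_tail a b `|x|.
Proof.
have bnd (D : set R) : measurable D ->
    `|\int[mu]_(t in D) (u t * phi t)| <=
    \int[mu]_(t in D) ((a + b * `|t|) * phi t).
  move=> mD; have Iu : mu.-integrable D (EFin \o (fun t => u t * phi t)).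
    by apply: integrableS intu.
  have Ig : mu.-integrable D (EFin \o (fun t => (a + b * `|t|) * phi t)).
    by apply: integrableS (integrable_growth a b).
  apply: (@le_trans _ _ (\int[mu]_(t in D) `|u t * phi t|)).
    exact: le_normr_Rintegral.
  apply: le_Rintegral => //; first by apply: integrable_norm.
  move=> t _; rewrite normrM (ger0_norm (normal_pdf_ge0 _ _ _)).
  by rewrite ler_pM2r ?gauss_density_gt0.
have [x0|x0] := leP 0 x; last first.
  rewrite (ltr0_norm x0) -growth_tailN// opprK; exact: bnd.
suff -> : gauss_prim u x = - \int[mu]_(t in `[x, +oo[) (u t * phi t).
  by rewrite normrN (ger0_norm x0); exact: bnd.
have := @Rintegral_itvB R (fun t => u t * phi t) -oo%O +oo%O x.
rewrite set_itvNyy u0 sub0r => /(_ intu isT isT) /(congr1 -%R).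
rewrite opprK /gauss_prim => ->; rewrite Rintegral_itv_obnd_cbnd//.
by apply: integrableS intu.
Qed.

Lemma gauss_prim_le (x : R) :
  `|gauss_prim u x| <= growth_cst * (a + b) * phi x.
Proof.
apply: (le_trans (gauss_prim_le_tail x)); rewrite growth_tailE//.
have -> : phi x = phi `|x| by case: (ler0P x); rewrite ?gauss_density_even.
rewrite mulrAC mulrDr lerD//; first by rewrite mulrC ler_wpM2r// gauss_tail_le.
rewrite mulrC ler_wpM2r// ler_peMl ?normal_pdf_ge0//; exact: growth_cst_ge1.
Qed.

End GaussPrim.
End GaussianDensity.

(** * Continuous approximation of Borel sets *)

Section ContinuousApproximation.
Context {R : realType}.
Variable m : {finite_measure set R -> \bar R}.

Definition cont01 (h : R -> R) := continuous h /\ forall x, 0 <= h x <= 1.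

Definition cont_approx (B : set R) := forall e : R, 0 < e ->
  exists2 h : R -> R, cont01 h & (\int[m]_x (`|\1_B x - h x|)%:E <= e%:E)%E.

Lemma measurable_indic_dist (h : R -> R) (B : set R) :
  measurable B -> measurable_fun setT h ->
  measurable_fun setT (fun x : R => `|\1_B x - h x|).
Proof.
by move=> mB mh; apply: measurableT_comp => //; apply: measurable_funB.
Qed.

Lemma ge0_le_integral2 (f g1 g2 : R -> R) (e1 e2 : R) :
  measurable_fun setT f -> measurable_fun setT g1 -> measurable_fun setT g2 ->
  (forall x, 0 <= f x) -> (forall x, 0 <= g1 x) -> (forall x, 0 <= g2 x) ->
  (forall x, f x <= g1 x + g2 x) ->
  (\int[m]_x (g1 x)%:E <= e1%:E)%E -> (\int[m]_x (g2 x)%:E <= e2%:E)%E ->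
  (\int[m]_x (f x)%:E <= (e1 + e2)%:E)%E.
Proof.
move=> mf m1 m2 f0 p1 p2 fg i1 i2.
apply: (@le_trans _ _ (\int[m]_x ((g1 x)%:E + (g2 x)%:E))%E).
  apply: ge0_le_integral => //.
  - by move=> x _; rewrite lee_fin.
  - exact/measurable_EFinP.
  - by apply: emeasurable_funD; exact/measurable_EFinP.
  - by move=> x _; rewrite -EFinD lee_fin.
rewrite ge0_integralD//; [|by move=> x _; rewrite lee_fin|exact/measurable_EFinP
  |by move=> x _; rewrite lee_fin|exact/measurable_EFinP].
by rewrite EFinD; exact: leeD.
Qed.

(** Piecewise linear functions of growing slope converge to the indicator. *)
Lemma cont_approx_ray (a : R) : cont_approx `]-oo, a[.
Proof.
pose h (k : nat) (x : R) : R := Num.max 0 (Num.min 1 (k%:R * (a - x))).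
have ch k : cont01 (h k).
  split => x.
    apply: (@continuous_max _ _ (fun=> 0) (fun y => Num.min 1 (k%:R * (a - y)))).
      exact: cvg_cst.
    apply: (@continuous_min _ _ (fun=> 1) (fun y => k%:R * (a - y))).
      exact: cvg_cst.
    apply: cvgM; first exact: cvg_cst.
    by apply: cvgB; [exact: cvg_cst|exact: cvg_id].
  by rewrite /h le_max lexx/= ge_max ler01 ge_min lexx.
have mh k : measurable_fun setT (h k).
  by apply: continuous_measurable_fun; exact: (ch k).1.
have ma : measurable (`]-oo, a[%classic : set R) by [].
have lim x : `|\1_(`]-oo, a[) x - h k x| @[k --> \oo] --> 0.
  apply: cvg_near_cst; case: (ltP x a) => xa; last first.
    near=> k; rewrite indicE memNset/=; last by rewrite /= in_itv/=; apply/negP; rewrite -leNgt.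
    rewrite /h (_ : Num.max _ _ = 0) ?subrr ?normr0//; apply/max_idPl.
    by rewrite ge_min; apply/orP; right; rewrite mulr_ge0_le0// subr_le0.
  near=> k; rewrite indicE mem_set/=; last by rewrite /= in_itv.
  rewrite /h (_ : Num.max _ _ = 1) ?subrr ?normr0//.
  rewrite (_ : Num.min _ _ = 1); first by apply/max_idPr.
  apply/min_idPl; rewrite -ler_pdivrMr ?subr_gt0// div1r.
  near: k; exact: nbhs_infty_ger.
have [|||||_ _ cv] := @dominated_convergence _ _ _ m setT measurableT
  (fun k x => (`|\1_(`]-oo, a[) x - h k x|)%:E) (cst 0%E) (cst 1%E).
- by move=> k; apply/measurable_EFinP; exact: measurable_indic_dist.
- exact: measurable_cst.
- by apply: aeW => x _; apply: cvg_EFin (lim x); near=> k.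
- by apply: finite_measure_integrable_cst.
- apply: aeW => x k _; rewrite /= lee_fin normr_id.
  have /andP[h0 h1] := (ch k).2 x.
  by rewrite indicE; case: (_ \in _); rewrite /= ler_norml; apply/andP; split; lra.
rewrite integral0 in cv.
move=> e e0; have /fine_cvgP[_ /cvgrPdist_le /(_ _ e0)] := cv.
move=> [k _ /(_ k (leqnn k))] /=; rewrite sub0r normrN => hk.
exists (h k); first exact: ch.
rewrite -[leLHS]fineK; last first.
  rewrite ge0_fin_numE; last by apply: integral_ge0 => x _; rewrite lee_fin.
  apply: (@le_lt_trans _ _ (\int[m]_x (cst 1 x))%E); last first.
    by rewrite integral_cst//= mul1e -ge0_fin_numE// fin_num_measure.
  apply: ge0_le_integral => //.
  - by apply/measurable_EFinP; exact: measurable_indic_dist.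
  - move=> x _; have /andP[h0 h1] := (ch k).2 x; rewrite lee_fin.
    by rewrite indicE; case: (_ \in _); rewrite /= ler_norml; apply/andP; split; lra.
by rewrite lee_fin; apply: le_trans hk; rewrite ler_norm.
Unshelve. all: by end_near. Qed.

Lemma cont_approxC (B : set R) : cont_approx B -> cont_approx (~` B).
Proof.
move=> hB e e0; have [h [ch h01] hle] := hB e e0.
exists (fun x => 1 - h x).
  split; first by move=> x; apply: cvgB; [exact: cvg_cst | exact: ch].
  by move=> x; have /andP[? ?] := h01 x; apply/andP; split; lra.
apply: le_trans hle; rewrite le_eqVlt; apply/orP; left; apply/eqP.
apply: eq_integral => x _; congr (_ %:E); rewrite -normrN.
by congr (`| _ |); rewrite !indicE in_setC; case: (x \in B) => /=; lra.
Qed.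

Lemma cont_approxU (A B : set R) : measurable A -> measurable B ->
  cont_approx A -> cont_approx B -> cont_approx (A `|` B).
Proof.
move=> mA mB hA hB e e0; have e20 : 0 < e / 2 by lra.
have [h ch hle] := hA _ e20; have [g cg gle] := hB _ e20.
have mh : measurable_fun setT h by apply: continuous_measurable_fun; exact: ch.1.
have mg : measurable_fun setT g by apply: continuous_measurable_fun; exact: cg.1.
exists (fun x => Num.max (h x) (g x)).
  split; first by move=> x; apply: continuous_max; [exact: ch.1 | exact: cg.1].
  move=> x; have /andP[? ?] := ch.2 x; have /andP[? ?] := cg.2 x.
  by rewrite le_max ge_max; apply/andP; split; [apply/orP; left|apply/andP].
rewrite (splitr e); apply: ge0_le_integral2 hle gle => //.
- by apply: measurable_indic_dist; [exact: measurableU | exact: measurable_maxr].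
- exact: measurable_indic_dist.
- exact: measurable_indic_dist.
move=> x; have /andP[h0 h1] := ch.2 x; have /andP[g0 g1] := cg.2 x.
have n1 (t : R) : t <= 1 -> `|1 - t| = 1 - t by move=> ?; rewrite ger0_norm; lra.
have n0 (t : R) : 0 <= t -> `|0 - t| = t by move=> ?; rewrite sub0r normrN ger0_norm.
rewrite !indicE in_setU; case: (x \in A); case: (x \in B) => /=;
  rewrite /Num.max; case: ifP => /= hg; rewrite ?n1 ?n0 //; lra.
Qed.

(** Approximability is not stable under countable disjoint unions term by term,
    but it passes to limits from inside in measure. *)
Lemma cont_approx_close (B : set R) : measurable B ->
  (forall e : R, 0 < e -> exists2 A, measurable A /\ cont_approx A &
     A `<=` B /\ (m (B `\` A) <= e%:E)%E) -> cont_approx B.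
Proof.
move=> mB hB e e0; have e20 : 0 < e / 2 by lra.
have [A [mA hA] [AB mBA]] := hB _ e20; have [h ch hle] := hA _ e20.
have mh : measurable_fun setT h by apply: continuous_measurable_fun; exact: ch.1.
exists h => //; rewrite (splitr e).
apply: (@ge0_le_integral2 _ (\1_(B `\` A)) (fun x => `|\1_A x - h x|)) => //.
- exact: measurable_indic_dist.
- by apply: measurable_indic; exact: measurableD.
- exact: measurable_indic_dist.
- move=> x; rewrite !indicE in_setD; case: (boolP (x \in A)) => xA.
    by rewrite (mem_set (AB _ (set_mem xA))) /= add0r.
  by rewrite andbT; apply: le_trans (ler_normD _ _) _; rewrite sub0r ger0_norm.
- by rewrite integral_indic ?setIT//; exact: measurableD.
Qed.

(** The approximable sets contain the rays and form a Dynkin system. *)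
Lemma cont_approx_measurable (B : set R) : measurable B -> cont_approx B.
Proof.
rewrite [X in X B](_ : _ = <<s (@RGenInftyO.G R) >>); last exact: RGenInftyO.measurableE.
apply: (@dynkin_induction _ R (@RGenInftyO.G R)).
- exact: RGenInftyO.measurableE.
- move=> _ _ [x ->] [y ->]; exists (Num.min x y).
  by apply/seteqP; split => z /=; rewrite !in_itv/= lt_min => /andP.
- move=> e e0; exists (cst 1).
    by split => x; [exact: cvg_cst | rewrite ler01 lexx].
  under eq_integral do rewrite indicT subrr normr0.
  by rewrite integral0 lee_fin ltW.
- by move=> _ [x ->]; exact: cont_approx_ray.
- by move=> S _; exact: cont_approxC.
move=> F mF tF hF.
have mB : measurable (\bigcup_k F k) by apply: bigcup_measurable => k _; exact: mF.
apply: cont_approx_close => //.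
pose U n := \big[setU/set0]_(i < n) F i.
have mU n : measurable (U n) by apply: bigsetU_measurable.
have hU n : cont_approx (U n).
  elim: n => [|n IHn]; last first.
    by rewrite /U big_ord_recr/=; apply: cont_approxU; [exact: mU|exact: mF|exact: IHn|exact: hF].
  rewrite /U big_ord0 => e e0; exists (cst 0).
    by split => x; [exact: cvg_cst | rewrite ler01 lexx].
  under eq_integral do rewrite indic0 subrr normr0.
  by rewrite integral0 lee_fin ltW.
have UF n : U n `<=` \bigcup_k F k.
  by rewrite /U -bigcup_mkord; apply: bigcup_subset.
have cv : m \o (fun n => (\bigcup_k F k) `\` U n) @ \oo --> m set0.
  rewrite [X in _ --> m X](_ : _ = \bigcap_n ((\bigcup_k F k) `\` U n)).
    apply: nonincreasing_cvg_mu.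
    - by rewrite -ge0_fin_numE// fin_num_measure//; apply: measurableD.
    - by move=> i; apply: measurableD.
    - by apply: bigcapT_measurable => i; apply: measurableD.
    - move=> i j ij; apply/subsetPset; apply: setDS.
      by rewrite /U; apply: subset_bigsetU.
  apply/esym; rewrite -subset0 => x /= hx.
  have [[k _ Fx] _] := hx 0%N I; have [_] := hx k.+1 I; apply.
  by rewrite /U -bigcup_mkord; exists k => //=.
move=> e e0; rewrite measure0 in cv.
have /fine_cvgP[_ /cvgrPdist_le /(_ _ e0)] := cv.
move=> [k _ /(_ k (leqnn k))] /=; rewrite sub0r normrN => hk.
exists (U k); first by split; [exact: mU | exact: hU].
split; first exact: UF.
rewrite -[leLHS]fineK; last first.
  by apply: fin_num_measure; apply: measurableD.
by rewrite lee_fin; apply: le_trans hk; rewrite ler_norm.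
Qed.

End ContinuousApproximation.

(** * Stein's equation and total variation *)

Section SumMeasure.
Context d (T : measurableType d) (R : realType).
Variables m1 m2 : {finite_measure set T -> \bar R}.

(** A single continuous function approximates an indicator for two laws at once
    when it does so for their sum. *)
Definition sum_measure := measure_add m1 m2.

HB.instance Definition _ := Measure.on sum_measure.

Let sum_measure_fin : fin_num_fun sum_measure.
Proof. by move=> A mA; rewrite /sum_measure measure_addE fin_numD !fin_num_measure. Qed.

HB.instance Definition _ :=
  @Measure_isFinite.Build _ _ _ sum_measure sum_measure_fin.

End SumMeasure.

Section GaussianLaw.
Context {R : realType}.
Notation mu := (@lebesgue_measure R).
Notation phi := (@normal_pdf R 0 1).

Let idR : measurableTypeR R -> R := idfun.

Let measurable_idR : measurable_fun setT idR.
Proof. by move=> _ A mA; rewrite setTI; exact: mA. Qed.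

#[local] HB.instance Definition _ := @isMeasurableFun.Build _ _
  (measurableTypeR R) R idR measurable_idR.

(** [normal_prob] lives on [measurableTypeR R]; its image by the identity lives on
    the Borel structure that real random variables use. *)
Definition gaussR : probability R R := distribution (normal_prob (0 : R) 1) idR.

Lemma gaussRE B : gaussR B = normal_prob 0 1 B.
Proof. by []. Qed.

Let ae_density : ae_eq mu setT (fun x : R => (phi x)%:E)
  (Radon_Nikodym_SigmaFinite.f (normal_prob (0 : R) 1) mu).
Proof.
apply: integral_ae_eq => //.
- exact: integrable_gauss_density.
- exact/measurable_int/Radon_Nikodym_SigmaFinite.f_integrable/normal_prob_dominates.
- move=> E _ mE.
  rewrite -Radon_Nikodym_SigmaFinite.f_integral//; exact: normal_prob_dominates.
Qed.

Lemma ge0_integral_gaussR (f : R -> R) : measurable_fun setT f ->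
  (forall x, 0 <= f x) ->
  (\int[gaussR]_x (f x)%:E = \int[mu]_x (f x * phi x)%:E)%E.
Proof.
move=> mf f0; rewrite ge0_integral_distribution//; last exact/measurable_EFinP.
have f0E x : (0 <= (f x)%:E)%E by rewrite lee_fin.
have mfE : measurable_fun setT (fun x => (f x)%:E) by exact/measurable_EFinP.
have <- := Radon_Nikodym_SigmaFinite.change_of_variables
  (normal_prob_dominates (0 : R) 1) f0E measurableT mfE.
apply: ae_eq_integral => //.
- apply: emeasurable_funM; first exact: mfE.
  exact/measurable_int/Radon_Nikodym_SigmaFinite.f_integrable/normal_prob_dominates.
- apply/measurable_EFinP; apply: measurable_funM => //.
  exact: measurable_normal_pdf.
by apply: filterS ae_density => x /= /(_ I) E _; rewrite EFinM E.
Qed.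

Lemma integrable_gaussR (f : R -> R) : measurable_fun setT f ->
  gaussR.-integrable setT (EFin \o f) <->
  mu.-integrable setT (EFin \o (fun x => f x * phi x)).
Proof.
move=> mf; have E : (\int[gaussR]_x `|(f x)%:E| =
    \int[mu]_x `|(f x * phi x)%:E|)%E.
  have := @ge0_integral_gaussR (fun x => `|f x|) (measurableT_comp (@normr_measurable _ _) mf) (fun x => normr_ge0 _).
  move=> ->; apply: eq_integral => x _.
  by rewrite abse_EFin normrM (ger0_norm (normal_pdf_ge0 _ _ _)).
split=> /integrableP[m i]; apply/integrableP; split.
- apply/measurable_EFinP; apply: measurable_funM => //.
  exact: measurable_normal_pdf.
- by rewrite -E.
- exact/measurable_EFinP.
- by rewrite E.
Qed.

Lemma Rintegral_gaussR (f : R -> R) : measurable_fun setT f ->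
  \int[gaussR]_x f x = \int[mu]_x (f x * phi x).
Proof.
move=> mf; rewrite /Rintegral; congr fine.
rewrite integralE [RHS]integralE; congr (_ - _)%E.
- have := @ge0_integral_gaussR (fun x => Num.max (f x) 0)
    (measurable_maxr mf (measurable_cst _)) (fun x => ltac:(by rewrite le_max lexx orbT)).
  move=> E; transitivity (\int[gaussR]_x (Num.max (f x) 0)%:E)%E.
    by apply: eq_integral => x _; rewrite funeposE EFin_max.
  rewrite E; apply: eq_integral => x _; rewrite funeposE -EFin_max.
  by rewrite maxr_pMl ?mul0r// normal_pdf_ge0.
- have := @ge0_integral_gaussR (fun x => Num.max (- f x) 0)
    (measurable_maxr (measurableT_comp (@oppr_measurable _ _) mf) (measurable_cst _)) (fun x => ltac:(by rewrite le_max lexx orbT)).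
  move=> E; transitivity (\int[gaussR]_x (Num.max (- f x) 0)%:E)%E.
    by apply: eq_integral => x _; rewrite funenegE EFin_max.
  rewrite E; apply: eq_integral => x _; rewrite funenegE -EFinN -EFin_max.
  by rewrite -mulNr maxr_pMl ?mul0r// normal_pdf_ge0.
Qed.

End GaussianLaw.

Section SteinEquation.
Context {R : realType}.
Notation mu := (@lebesgue_measure R).
Notation phi := (@normal_pdf R 0 1).

Definition stein_test (f df : R -> R) : Prop :=
  [/\ forall x : R, is_derive x 1 f (df x), continuous df,
      forall x, `|f x| <= 1 & forall x, `|df x| <= 1].

Definition stein_cst : R := @growth_cst R + 2.

Lemma stein_cst_gt0 : 0 < stein_cst.
Proof. by rewrite addr_gt0// (lt_le_trans ltr01)// growth_cst_ge1. Qed.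

Definition gauss_mean (h : R -> R) := \int[mu]_t (h t * phi t).

Lemma gauss_mean_cst (a : R) : gauss_mean (fun=> a) = a.
Proof.
rewrite /gauss_mean RintegralZl//; last exact: integrable_gauss_density.
by rewrite /Rintegral integral_normal_pdf mulr1.
Qed.

Lemma integrable_cont01 (h : R -> R) : cont01 h ->
  mu.-integrable setT (EFin \o (fun t => h t * phi t)).
Proof.
move=> [ch h01]; apply: (@integrable_growth_mul _ _ 1 0) => // t.
by rewrite mul0r addr0 ger0_norm; have /andP[] := h01 t.
Qed.

Lemma gauss_mean01 (h : R -> R) : cont01 h -> 0 <= gauss_mean h <= 1.
Proof.
move=> hh; apply/andP; split.
  apply: Rintegral_ge0 => t _; rewrite mulr_ge0 ?normal_pdf_ge0//.
  by have /andP[] := hh.2 t.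
rewrite -[leRHS](gauss_mean_cst 1); apply: le_Rintegral => //.
- exact: integrable_cont01.
- by apply: integrable_cont01; split => // x; [exact: cvg_cst|rewrite ler01 lexx].
- by move=> t _; rewrite ler_wpM2r ?normal_pdf_ge0//; have /andP[] := hh.2 t.
Qed.

Lemma is_derive_continuous (f : R -> R) (x l : R) :
  is_derive x 1 f l -> {for x, continuous f}.
Proof.
move=> D; apply: differentiable_continuous; apply/derivable1_diffP.
exact: (@ex_derive _ _ _ _ _ _ _ D).
Qed.

Lemma is_derive_div_gauss (g : R -> R) (x dg : R) : is_derive x 1 g dg ->
  is_derive x 1 (fun y => g y / phi y) (dg / phi x + x * (g x / phi x)).
Proof.
move=> Dg; have p0 : phi x != 0 by rewrite gt_eqF// gauss_density_gt0.
have Dp := is_derive_gauss_density x.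
have Di : is_derive x 1 (fun y => (phi y)^-1) (- (phi x) ^- 2 *: - (x * phi x)).
  exact: is_deriveV.
apply: (is_derive_eq (is_deriveM Dg Di)); rewrite /GRing.scale/=.
by move: p0; move: (phi x) => p p0; field.
Qed.

(** The solution is the antiderivative of (h - mean) times the density, divided
    by the density; Mills' inequality bounds it, and bounds x times it, which
    controls the derivative through the equation itself. *)
Lemma stein_solution (h : R -> R) : cont01 h ->
  exists f df : R -> R, stein_test f df /\
    forall x, stein_cst * (df x - x * f x) = h x - gauss_mean h.
Proof.
move=> hh; have [ch h01] := hh.
pose u x := h x - gauss_mean h.
have /andP[m0 m1] := gauss_mean01 hh.
have cu : continuous u by move=> x; apply: cvgB; [exact: ch|exact: cvg_cst].
have u1 t : `|u t| <= 1.
  by have /andP[? ?] := h01 t; rewrite /u ler_norml; apply/andP; split; lra.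
have ub t : `|u t| <= 1 + 0 * `|t| by rewrite mul0r addr0.
have u0 : \int[mu]_t (u t * phi t) = 0.
  under eq_Rintegral do rewrite mulrBl.
  rewrite RintegralB//; [|exact: integrable_cont01|].
    by rewrite -/(gauss_mean _) -/(gauss_mean (fun=> _)) gauss_mean_cst subrr.
  by apply: integrableZR => //; exact: integrable_gauss_density.
pose f0 x := gauss_prim u x / phi x.
pose df0 x := u x + x * f0 x.
have pg x : 0 < phi x := gauss_density_gt0 x.
have D (x : R) : is_derive x 1 f0 (df0 x).
  have := is_derive_div_gauss (is_derive_gauss_prim cu ub x).
  by rewrite mulfK// gt_eqF.
have b1 x : `|f0 x| <= growth_cst.
  rewrite normrM normfV (gtr0_norm (pg x)) ler_pdivrMr//.
  have := gauss_prim_le cu ler01 (lexx 0) ub u0 x.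
  by rewrite addr0 mulr1.
have b2 x : `|x * f0 x| <= 1.
  rewrite mulrA normrM normfV (gtr0_norm (pg x)) ler_pdivrMr// mul1r normrM.
  have -> : phi x = phi `|x| by case: (ler0P x); rewrite ?gauss_density_even.
  apply: le_trans (gauss_tail_mul_le (normr_ge0 x)).
  rewrite ler_wpM2l//.
  have := gauss_prim_le_tail cu ler01 (lexx 0) ub u0 x.
  by rewrite growth_tailE// mul1r mul0r addr0.
have c0 := stein_cst_gt0.
exists (fun x => f0 x / stein_cst), (fun x => df0 x / stein_cst); split.
  split.
  - move=> x; have -> : (fun y => f0 y / stein_cst) = stein_cst^-1 *: f0.
      by apply/funext => y; rewrite mulrC.
    by apply: is_derive_eq; rewrite /GRing.scale/= mulrC.
  - move=> x; apply: cvgM; last exact: cvg_cst.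
    apply: cvgD; first exact: cu.
    by apply: cvgM; [exact: cvg_id|exact: (is_derive_continuous (D x))].
  - move=> x; rewrite normrM normfV (gtr0_norm c0) ler_pdivrMr// mul1r.
    by apply: le_trans (b1 x) _; rewrite /stein_cst; lra.
  - move=> x; rewrite normrM normfV (gtr0_norm c0) ler_pdivrMr// mul1r.
    apply: le_trans (ler_normD _ _) _.
    have := u1 x; have := b2 x; have := @growth_cst_ge1 R.
    by rewrite /stein_cst; lra.
by move=> x; rewrite /df0 -/(u x); field; rewrite gt_eqF.
Qed.

End SteinEquation.

Lemma Rintegral_prob_cst d (T : measurableType d) (R : realType)
  (P : probability T R) (a : R) : \int[P]_w a = a.
Proof.
rewrite Rintegral_cst//; have -> : fine (P [set: T]) = 1 by rewrite probability_setT.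
by rewrite mulr1.
Qed.

Section SteinTotalVariation.
Context d (T : measurableType d) (R : realType) (P : probability T R).
Notation phi := (@normal_pdf R 0 1).
Variables (W : {RV P >-> R}) (delta : R).
Hypothesis iW : P.-integrable setT (EFin \o W).
Hypothesis stein_le : forall f df : R -> R, stein_test f df ->
  `|\int[P]_w (df (W w)) - \int[P]_w (W w * f (W w))| <= delta.

Lemma stein_cont01 (h : R -> R) : cont01 h ->
  `|\int[P]_w (h (W w)) - gauss_mean h| <= stein_cst * delta.
Proof.
move=> hh; have [f [df [fdf E]]] := stein_solution hh.
have := stein_le fdf; have [D cdf f1 df1] := fdf.
have mf : measurable_fun setT f.
  by apply: continuous_measurable_fun => x; exact: (is_derive_continuous (D x)).
have mdf : measurable_fun setT df by exact: continuous_measurable_fun.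
have i1 : P.-integrable setT (EFin \o (fun w => df (W w))).
  apply: (le_integrableR measurableT _ _ (finite_measure_integrable_cst P 1 measurableT)).
    exact: measurableT_comp.
  by move=> w _; exact: df1.
have i2 : P.-integrable setT (EFin \o (fun w => W w * f (W w))).
  have iN : P.-integrable setT (EFin \o (fun w => `|W w|)) by exact: integrable_norm.
  apply: (le_integrableR measurableT _ _ iN).
    by apply: measurable_funM => //; exact: measurableT_comp.
  by move=> w _; rewrite normrM ler_piMr.
rewrite -RintegralB// => bnd.
have -> : \int[P]_w h (W w) - gauss_mean h =
    stein_cst * \int[P]_w (df (W w) - W w * f (W w)).
  rewrite -RintegralZl//; last exact: integrableBR.
  under [RHS]eq_Rintegral do rewrite E.
  rewrite RintegralB//.
  - by rewrite Rintegral_prob_cst.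
  - apply: (le_integrableR measurableT _ _ (finite_measure_integrable_cst P 1 measurableT)).
      by apply: measurableT_comp => //; apply: continuous_measurable_fun; exact: hh.1.
    by move=> w _; have /andP[? ?] := hh.2 (W w); rewrite ger0_norm.
  - exact: finite_measure_integrable_cst.
by rewrite normrM (gtr0_norm stein_cst_gt0) ler_pM2l// stein_cst_gt0.
Qed.

Lemma Rintegral_distribution (f : R -> R) : measurable_fun setT f ->
  P.-integrable setT (EFin \o (f \o W)) ->
  \int[distribution P W]_x f x = \int[P]_w f (W w).
Proof.
move=> mf If; rewrite /Rintegral; congr fine.
by rewrite integral_distribution//; exact/measurable_EFinP.
Qed.

Lemma prob_cont01_dist (p : probability R R) (B : set R) (h : R -> R) (e : R) :
  measurable B -> cont01 h -> (\int[p]_x (`|\1_B x - h x|)%:E <= e%:E)%E ->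
  `|fine (p B) - \int[p]_x h x| <= e.
Proof.
move=> mB [ch h01] le_e.
have mh : measurable_fun setT h by exact: continuous_measurable_fun.
have i1 : p.-integrable setT (EFin \o h).
  apply: (le_integrableR measurableT _ _ (finite_measure_integrable_cst p 1 measurableT)) => //.
  by move=> w _; have /andP[? ?] := h01 w; rewrite ger0_norm.
have i2 : p.-integrable setT (EFin \o \1_B).
  apply: (le_integrableR measurableT _ _ (finite_measure_integrable_cst p 1 measurableT)) => //.
  by move=> w _; rewrite indicE; case: (_ \in _); rewrite ?normr1 ?normr0.
have -> : fine (p B) = \int[p]_x \1_B x.
  by rewrite /Rintegral integral_indic// setIT.
rewrite -RintegralB//.
apply: (@le_trans _ _ (\int[p]_x `|\1_B x - h x|)).
  by apply: le_normr_Rintegral => //; exact: integrableBR.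
rewrite /Rintegral -lee_fin fineK//.
by apply: integrable_fin_num => //; apply: integrable_norm; exact: integrableBR.
Qed.

(** The indicator of B is not continuous, and the solution of its Stein equation
    not C^1; it is replaced by a continuous function close to it in mean for the
    law of W and for the Gaussian law. *)
Lemma stein_tv : (tv_distance (pushforward P W) (normal_prob 0 1) <=
  (stein_cst * delta)%:E)%E.
Proof.
apply: ge_ereal_sup => _ [B mB <-].
rewrite -(gaussRE B) -[pushforward P W B]/(distribution P W B).
rewrite -(fineK (fin_num_measure (distribution P W) _ mB)).
rewrite -(fineK (fin_num_measure gaussR _ mB)) -EFinB abse_EFin lee_fin.
apply/ler_addgt0Pr => e e0; have e20 : 0 < e / 2 by lra.
have [h hh hle] := cont_approx_measurable (sum_measure (distribution P W) gaussR) mB e20.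
have mh : measurable_fun setT h by apply: continuous_measurable_fun; exact: hh.1.
have p0 (x : R) : (0 <= (`|\1_B x - h x|)%:E)%E by rewrite lee_fin.
have mp : measurable_fun setT (fun x : R => (`|\1_B x - h x|)%:E).
  by apply/measurable_EFinP; exact: measurable_indic_dist.
rewrite /sum_measure ge0_integral_measure_add// in hle.
have d1 : `|fine (distribution P W B) - \int[distribution P W]_x h x| <= e / 2.
  apply: prob_cont01_dist => //; apply: le_trans hle.
  by rewrite leeDl// integral_ge0.
have d2 : `|fine (gaussR B) - \int[gaussR]_x h x| <= e / 2.
  apply: prob_cont01_dist => //; apply: le_trans hle.
  by rewrite leeDr// integral_ge0.
have ihW : P.-integrable setT (EFin \o (h \o W)).
  apply: (le_integrableR measurableT _ _ (finite_measure_integrable_cst P 1 measurableT)) => //.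
    exact: measurableT_comp.
  by move=> w _; have /andP[? ?] := hh.2 (W w); rewrite ger0_norm.
have d3 := stein_cont01 hh.
rewrite Rintegral_distribution// in d1; rewrite Rintegral_gaussR// in d2.
move: d1 d2 d3; rewrite /gauss_mean.
move: (fine _) (fine _) (\int[_]__ _) (\int[_]__ _) => a b i j.
rewrite !ler_norml => /andP[? ?] /andP[? ?] /andP[? ?].
by apply/andP; split; lra.
Qed.

End SteinTotalVariation.

(** * Conditional expectation as a density *)

Section FiniteImage.
Context d d' (T : measurableType d) (T' : measurableType d') (R : realType).
Variables (k : {finite_measure set T -> \bar R}) (u : {mfun T >-> T'}).

Definition image_measure := pushforward k u.

Let image_measure0 : image_measure set0 = 0%E.
Proof. exact: measure0. Qed.

Let image_measure_ge0 A : (0 <= image_measure A)%E.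
Proof. exact: measure_ge0. Qed.

Let image_measure_sigma_additive : semi_sigma_additive image_measure.
Proof. exact: measure_semi_sigma_additive. Qed.

HB.instance Definition _ := isMeasure.Build _ _ _ image_measure
  image_measure0 image_measure_ge0 image_measure_sigma_additive.

Let image_measure_fin : fin_num_fun image_measure.
Proof.
move=> A mA; apply: fin_num_measure.
by rewrite -[X in measurable X]setTI; exact: measurable_funPT.
Qed.

HB.instance Definition _ :=
  @Measure_isFinite.Build _ _ _ image_measure image_measure_fin.

End FiniteImage.

Section DensityMeasure.
Context d (T : measurableType d) (R : realType) (m : probability T R).
Variables (t : T -> R) (c : R).
Hypotheses (mt : measurable_fun setT t) (t0 : forall x, 0 <= t x <= c).

(** The proofs are arguments of the definition so that canonical structures can
    recover the bounds that make the measure finite. *)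
Definition density_measure of measurable_fun setT t & (forall x, 0 <= t x <= c) :
  set T -> \bar R := fun A => (\int[m]_(x in A) (t x)%:E)%E.

Local Notation kappa := (density_measure mt t0).

Let integrable_t : m.-integrable setT (EFin \o t).
Proof.
apply: (le_integrableR measurableT _ _ (finite_measure_integrable_cst m c measurableT)) => //.
by move=> x _; have /andP[? ?] := t0 x; rewrite ger0_norm.
Qed.

Let kappa0 : kappa set0 = 0%E.
Proof. by rewrite /density_measure integral_set0. Qed.

Let kappa_ge0 A : (0 <= kappa A)%E.
Proof.
by apply: integral_ge0 => x _; rewrite lee_fin; have /andP[] := t0 x.
Qed.

Let kappa_sigma_additive : semi_sigma_additive kappa.
Proof.
move=> F mF tF mUF; rewrite /density_measure integral_bigcup//=; last first.
  by apply: (integrableS _ _ (subsetT _)) => //; exact: integrable_t.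
apply: is_cvg_ereal_nneg_natsum_cond => n _ _.
by apply: integral_ge0 => x _; rewrite lee_fin; have /andP[] := t0 x.
Qed.

HB.instance Definition _ := isMeasure.Build _ _ _ kappa kappa0 kappa_ge0
  kappa_sigma_additive.

Let kappa_le A : measurable A -> (kappa A <= c%:E * m A)%E.
Proof.
move=> mA; rewrite -integral_cst//; apply: ge0_le_integral => //.
- by move=> x _; rewrite lee_fin; have /andP[] := t0 x.
- by apply/measurable_EFinP; exact: measurable_funS mt.
- by move=> x _; rewrite lee_fin; have /andP[] := t0 x.
Qed.

Let kappa_fin : fin_num_fun kappa.
Proof.
move=> A mA; rewrite ge0_fin_numE//; apply: (le_lt_trans (kappa_le mA)).
by rewrite -ge0_fin_numE ?fin_numM ?fin_num_measure// mule_ge0// lee_fin;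
  have /andP[c0 c1] := t0 point; exact: le_trans c0 c1.
Qed.

HB.instance Definition _ := @Measure_isFinite.Build _ _ _ kappa kappa_fin.

End DensityMeasure.

Section DensityIntegral.
Context d (T : measurableType d) (R : realType) (m : probability T R).
Variables (t : T -> R) (c : R).
Hypotheses (mt : measurable_fun setT t) (t0 : forall x, 0 <= t x <= c).
Local Notation kappa := (density_measure m mt t0).

Lemma density_measure_le A : measurable A -> (kappa A <= c%:E * m A)%E.
Proof.
move=> mA; rewrite -integral_cst//; apply: ge0_le_integral => //.
- by move=> x _; rewrite lee_fin; have /andP[] := t0 x.
- by apply/measurable_EFinP; exact: measurable_funS mt.
- by move=> x _; rewrite lee_fin; have /andP[] := t0 x.
Qed.

Let dom : kappa `<< m.
Proof.
apply/null_content_dominatesP => A mA mA0; apply/eqP; rewrite -measure_le0.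
by apply: (le_trans (density_measure_le mA)); rewrite [m A]mA0 mule0.
Qed.

Let integrable_t : m.-integrable setT (EFin \o t).
Proof.
apply: (le_integrableR measurableT _ _ (finite_measure_integrable_cst m c measurableT)) => //.
by move=> x _; have /andP[? ?] := t0 x; rewrite ger0_norm.
Qed.

Let ae_density : ae_eq m setT (fun x => (t x)%:E)
  (Radon_Nikodym_SigmaFinite.f kappa m).
Proof.
apply: integral_ae_eq => //.
  exact/measurable_int/Radon_Nikodym_SigmaFinite.f_integrable.
by move=> E _ mE; rewrite -Radon_Nikodym_SigmaFinite.f_integral.
Qed.

Let ge0_integral_density (g : T -> R) : measurable_fun setT g ->
  (forall x, 0 <= g x) ->
  (\int[kappa]_x (g x)%:E = \int[m]_x (g x * t x)%:E)%E.
Proof.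
move=> mg g0; have g0E x : (0 <= (g x)%:E)%E by rewrite lee_fin.
have mgE : measurable_fun setT (fun x => (g x)%:E) by exact/measurable_EFinP.
have <- := Radon_Nikodym_SigmaFinite.change_of_variables dom g0E measurableT mgE.
apply: ae_eq_integral => //.
- apply: emeasurable_funM; first exact: mgE.
  exact/measurable_int/Radon_Nikodym_SigmaFinite.f_integrable.
- by apply/measurable_EFinP; apply: measurable_funM.
by apply: filterS ae_density => x /= /(_ I) E _; rewrite EFinM E.
Qed.

Lemma integrable_density (g : T -> R) : m.-integrable setT (EFin \o g) ->
  kappa.-integrable setT (EFin \o g).
Proof.
move=> Ig; have /integrableP[/measurable_EFinP mg ig] := Ig.
apply/integrableP; split; first exact/measurable_EFinP.
have mn : measurable_fun setT (fun x => `|g x|) by exact: measurableT_comp.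
rewrite (ge0_integral_density mn)//.
have In : m.-integrable setT (EFin \o (fun x => c * `|g x|)).
  by apply: integrableZR => //; exact: integrable_norm.
have /integrableP[_] : m.-integrable setT (EFin \o (fun x => `|g x| * t x)).
  apply: (le_integrableR measurableT _ _ In); first exact: measurable_funM.
  move=> x _; have /andP[? ?] := t0 x.
  by rewrite normrM normr_id ger0_norm// mulrC ler_wpM2r.
apply: le_lt_trans; rewrite le_eqVlt; apply/orP; left; apply/eqP.
apply: eq_integral => x _ /=; congr (_ %:E); apply/esym/ger0_norm.
by rewrite mulr_ge0//; have /andP[] := t0 x.
Qed.

Lemma Rintegral_density (g : T -> R) : m.-integrable setT (EFin \o g) ->
  \int[kappa]_x g x = \int[m]_x (g x * t x).
Proof.
move=> Ig; have /integrableP[/measurable_EFinP mg _] := Ig.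
rewrite /Rintegral; congr fine.
rewrite -(Radon_Nikodym_change_of_variables dom measurableT (integrable_density Ig)).
apply: ae_eq_integral => //.
- apply: emeasurable_funM; first exact/measurable_EFinP.
  exact/measurable_int/Radon_Nikodym_integrable.
- by apply/measurable_EFinP; apply: measurable_funM.
have := ae_eq_Radon_Nikodym_SigmaFinite dom measurableT.
by apply: filterS2 ae_density => x /= /(_ I) E1 /(_ I) E2 _; rewrite EFinM E1 E2.
Qed.

End DensityIntegral.

(** The conditional expectation of t given u, as a function of the value of u:
    the Radon-Nikodym derivative, with respect to the law of u, of the image by u
    of the measure with density t.  Adding c to t first makes it nonnegative. *)
Lemma conditional_density d (T : measurableType d) (R : realType)
  (m : probability T R) (u : {RV m >-> R}) (t : T -> R) (c : R) :
  measurable_fun setT t -> (forall x, `|t x| <= c) ->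
  exists tau : R -> R, [/\ measurable_fun setT tau, forall x, `|tau x| <= c &
    forall g : R -> R, measurable_fun setT g ->
      m.-integrable setT (EFin \o (g \o u)) ->
      \int[distribution m u]_x (g x * tau x) = \int[m]_x (g (u x) * t x)].
Proof.
move=> mt tc.
have c0 : 0 <= c by apply: le_trans (tc point).
pose s x := t x + c.
have ms : measurable_fun setT s by exact: measurable_funD.
have s0 x : 0 <= s x <= c + c.
  by have := tc x; rewrite ler_norml /s => /andP[? ?]; apply/andP; split; lra.
pose kappa := density_measure m ms s0.
pose nu := image_measure kappa u.
pose p := distribution m u.
have nu_le A : measurable A -> (nu A <= (c + c)%:E * p A)%E.
  move=> mA; apply: density_measure_le.
  by rewrite -[X in measurable X]setTI; exact: measurable_funPT.
have dom : nu `<< p.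
  apply/null_content_dominatesP => A mA mA0; apply/eqP; rewrite -measure_le0.
  by apply: (le_trans (nu_le _ mA)); rewrite [p A]mA0 mule0.
pose f := Radon_Nikodym_SigmaFinite.f nu p.
have f0 : forall x, (0 <= f x)%E by exact: Radon_Nikodym_SigmaFinite.f_ge0.
have ff : forall x, f x \is a fin_num by exact: Radon_Nikodym_SigmaFinite.f_fin_num.
have fi : p.-integrable setT f by exact: Radon_Nikodym_SigmaFinite.f_integrable.
have fE A : measurable A -> nu A = (\int[p]_(x in A) f x)%E.
  by move=> mA; exact: Radon_Nikodym_SigmaFinite.f_integral.
have mf : measurable_fun setT f by exact: measurable_int fi.
pose A := [set x | ((c + c)%:E < f x)%E].
have mA : measurable A.
  by rewrite -[A]setTI; apply: emeasurable_fun_o_infty.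
have Ale B : measurable B -> B `<=` A ->
    (\int[p]_(x in B) f x = \int[p]_(x in B) (c + c)%:E)%E.
  move=> mB BA; apply/eqP; rewrite eq_le; apply/andP; split.
    by rewrite -fE// integral_cst//; exact: nu_le.
  apply: ge0_le_integral => //.
  - by move=> x _; rewrite lee_fin addr_ge0.
  - exact: measurable_funS mf.
  - by move=> x /BA /ltW.
have aeA : ae_eq p A f (fun=> (c + c)%:E).
  apply: integral_ae_eq => //.
  - exact: integrableS fi.
  - by move=> E EA mE; exact: Ale.
pose tau x := Num.min (fine (f x)) (c + c) - c.
have tauE : ae_eq p setT f (fun x => (tau x + c)%:E).
  apply: filterS aeA => x /= h _; rewrite /tau subrK.
  rewrite -[in LHS](fineK (ff x)); congr (_ %:E).
  apply/esym/min_idPl; rewrite -lee_fin fineK// leNgt; apply/negP => fA.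
  by have := h fA => fE'; rewrite fE' ltxx in fA.
have mtau : measurable_fun setT tau.
  apply: measurable_funB => //; apply: measurable_minr => //.
  exact: measurableT_comp.
exists tau; split => //.
- move=> x; rewrite /tau ler_norml; apply/andP; split.
    by rewrite lerBrDr addNr le_min fine_ge0//= addr_ge0.
  by rewrite lerBlDr ge_min lexx orbT.
move=> g mg Ig.
have Igp : p.-integrable setT (EFin \o g).
  have /integrableP[_ ig] := Ig; apply/integrableP; split.
    exact/measurable_EFinP.
  rewrite ge0_integral_distribution//.
  by apply/measurable_EFinP; exact: measurableT_comp.
have Ignu : nu.-integrable setT (EFin \o g).
  have /integrableP[_ ig] := integrable_density ms s0 Ig.
  apply/integrableP; split; first exact/measurable_EFinP.
  rewrite ge0_integral_pushforward//.
  by apply/measurable_EFinP; exact: measurableT_comp.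
have E1 : \int[nu]_x g x = \int[m]_x (g (u x) * s x).
  rewrite -(Rintegral_density ms s0 Ig) /Rintegral; congr fine.
  rewrite integral_pushforward//; first exact/measurable_EFinP.
  exact: integrable_density.
have E2 : \int[nu]_x g x = \int[p]_x (g x * (tau x + c)).
  rewrite /Rintegral; congr fine.
  rewrite -(Radon_Nikodym_change_of_variables dom measurableT Ignu).
  apply: ae_eq_integral => //.
  - apply: emeasurable_funM; first exact/measurable_EFinP.
    exact/measurable_int/Radon_Nikodym_integrable.
  - by apply/measurable_EFinP; apply: measurable_funM => //; exact: measurable_funD.
  have := ae_eq_Radon_Nikodym_SigmaFinite dom measurableT.
  by apply: filterS2 tauE => x /= /(_ I) F1 /(_ I) F2 _; rewrite EFinM -F1 -F2.
have I1 := integrable_mulb measurableT mt (fun x _ => tc x) Ig.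
have taub x : `|tau x| <= c.
  rewrite /tau ler_norml; apply/andP; split.
    by rewrite lerBrDr addNr le_min fine_ge0//= addr_ge0.
  by rewrite lerBlDr ge_min lexx orbT.
have I2 := integrable_mulb measurableT mtau (fun x _ => taub x) Igp.
have : \int[m]_x (g (u x) * s x) = \int[p]_x (g x * (tau x + c)) by rewrite -E1.
under eq_Rintegral do rewrite mulrDr.
under [RHS]eq_Rintegral do rewrite mulrDr.
rewrite RintegralD//; last first.
  by apply: integrable_mulb Ig => // x _; rewrite ger0_norm.
rewrite RintegralD//; last first.
  by apply: integrable_mulb Igp => // x _; rewrite ger0_norm.
rewrite !RintegralZr// => /esym; rewrite (Rintegral_distribution mg Ig).
exact: addIr.
Qed.

(** * Gaussian integration by parts *)

Section GaussianByParts.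
Context {R : realType}.
Notation mu := (@lebesgue_measure R).
Notation phi := (@normal_pdf R 0 1).

(** The fundamental theorem of calculus on [-n, n], with n going to infinity. *)
Lemma Rintegral_derive_eq0 (H dH : R -> R) (k : R) :
  (forall x : R, is_derive x 1 H (dH x)) -> continuous dH ->
  mu.-integrable setT (EFin \o dH) ->
  (forall n : nat, `|H n.+1%:R - H (- n.+1%:R)| <= k / n.+1%:R) ->
  \int[mu]_x dH x = 0.
Proof.
move=> D cdH iH Hk.
pose f n (x : R) : \bar R := ((dH x)%:E * (\1_`[- n.+1%:R, n.+1%:R] x)%:E)%E.
have mdH : measurable_fun setT dH by exact: continuous_measurable_fun.
have mf n : measurable_fun setT (f n).
  by apply: emeasurable_funM; apply/measurable_EFinP => //; exact: measurable_indic.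
have fE n : (\int[mu]_x f n x = (H n.+1%:R - H (- n.+1%:R))%:E)%E.
  have nn : - n.+1%:R < n.+1%:R :> R by rewrite gtrN.
  have cH : continuous H by move=> x; exact: is_derive_continuous (D x).
  rewrite EFinB -(@continuous_FTC2 _ dH H _ _ nn).
  - rewrite [RHS]integral_mkcond; apply: eq_integral => x _.
    by rewrite /f epatch_indic.
  - exact: continuous_subspaceT.
  - split.
    + by move=> x _; exact: (@ex_derive _ _ _ _ _ _ _ (D x)).
    + by apply: cvg_at_right_filter; exact: cH.
    + by apply: cvg_at_left_filter; exact: cH.
  - by move=> x _; rewrite derive1E; exact: (@derive_val _ _ _ _ _ _ _ (D x)).
have lim x : f n x @[n --> \oo] --> (dH x)%:E.
  apply: cvg_near_cst; near=> n; rewrite /f indicE mem_set ?mule1//=.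
  rewrite in_itv/= -ler_norml; near: n; exists (Num.truncn `|x|) => // n /= xn.
  by rewrite (le_trans (ltW (truncnS_gt _)))// ler_nat.
have [|||||_ _] := @dominated_convergence _ _ _ mu setT measurableT f
  (EFin \o dH) (fun x => `|(dH x)%:E|%E).
- exact: mf.
- exact/measurable_EFinP.
- by apply: aeW => x _; exact: lim.
- by move/integrable_abse: iH.
- apply: aeW => x n _; rewrite /f abseM -[leRHS]mule1 lee_wpmul2l//.
  by rewrite indicE; case: (_ \in _); rewrite /= ?normr1 ?normr0 lee_fin.
under eq_fun do rewrite fE.
move=> cv; rewrite /Rintegral.
suff -> : (\int[mu]_x (dH x)%:E = 0)%E by [].
apply: (@cvg_unique _ _ _ _ _ _ cv); first exact: ereal_hausdorff.
apply: cvg_EFin; first by near=> n.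
apply/cvgr0Pnorm_le => e e0; near=> n => /=.
apply: (le_trans (Hk n)); apply: (@le_trans _ _ (`|k| / n.+1%:R)).
  by rewrite ler_wpM2r ?invr_ge0// ler_norm.
rewrite ler_pdivrMr// mulrC -ler_pdivrMr//.
near: n; exists (Num.truncn (`|k| / e)) => // n /= xn.
by rewrite (le_trans (ltW (truncnS_gt _)))// ler_nat.
Unshelve. all: by end_near. Qed.

Lemma gauss_density_linear (n : nat) :
  phi n.+1%:R * (1 + n.+1%:R) <= 4 * normal_peak 1 / n.+1%:R.
Proof.
have n1 : 1 <= n.+1%:R :> R by rewrite ler1n.
rewrite ler_pdivlMr// -mulrA.
have := gauss_density_decay (n.+1%:R : R).
have := gauss_density_gt0 (n.+1%:R : R).
move: n1; move: (n.+1%:R : R) (phi _) (normal_peak 1) => z p c z1 p0 zp.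
have : p * z <= p * z ^+ 2 by rewrite ler_pM2l// expr2 ler_peMl// (le_trans ler01).
by rewrite mulrDl mul1r mulrDr -expr2; move: zp; rewrite (mulrC _ p); lra.
Qed.

Section ByParts.
Variables (u du : R -> R) (a b : R).
Hypotheses (Du : forall x : R, is_derive x 1 u (du x)) (cdu : continuous du).
Hypotheses (a0 : 0 <= a) (b0 : 0 <= b).
Hypothesis dub : forall x, `|du x| <= b.
Hypothesis ub : forall t, `|u t| <= a + b * `|t|.
Hypothesis u0 : gauss_mean u = 0.
Variables (psi dpsi : R -> R) (k : R).
Hypotheses (Dpsi : forall x : R, is_derive x 1 psi (dpsi x)) (cdpsi : continuous dpsi).
Hypothesis psik : forall x, `|psi x| <= k * (1 + `|x|).
Hypothesis i1 : gaussR.-integrable setT (EFin \o (fun z => u z * psi (u z))).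
Hypothesis i2 : gaussR.-integrable setT (EFin \o (fun z => dpsi (u z))).

(** As gauss_prim u is an antiderivative of u phi, this is the weight obtained when
    u phi is integrated by parts against psi o u. *)
Definition gauss_kernel (z : R) := - du z * (gauss_prim u z / phi z).

Let cu : continuous u.
Proof. by move=> x; exact: is_derive_continuous (Du x). Qed.

Let cpsi : continuous psi.
Proof. by move=> x; exact: is_derive_continuous (Dpsi x). Qed.

Let cprim : continuous (gauss_prim u).
Proof. by move=> x; exact: is_derive_continuous (is_derive_gauss_prim cu ub x). Qed.

Let pg x : 0 < phi x := gauss_density_gt0 x.

Lemma continuous_gauss_kernel : continuous gauss_kernel.
Proof.
move=> x; apply: cvgM; first by apply: cvgN; exact: cdu.
apply: cvgM; first exact: cprim.
apply: cvgV; last exact: continuous_gauss_density.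
by rewrite gt_eqF.
Qed.

Lemma gauss_kernel_le z : `|gauss_kernel z| <= b * (growth_cst * (a + b)).
Proof.
rewrite /gauss_kernel normrM normrN ler_pM//.
rewrite normrM normfV (gtr0_norm (pg z)) ler_pdivrMr//.
exact: gauss_prim_le.
Qed.

(** The total derivative psi (u z) * gauss_prim u z integrates to 0, since
    gauss_prim u decays like the Gaussian density. *)
Lemma gauss_by_parts :
  \int[gaussR]_z (u z * psi (u z)) = \int[gaussR]_z (dpsi (u z) * gauss_kernel z).
Proof.
have cpu : continuous (fun z => psi (u z)).
  by move=> x; apply: continuous_comp; [exact: cu|exact: cpsi].
have cdpu : continuous (fun z => dpsi (u z)).
  by move=> x; apply: continuous_comp; [exact: cu|exact: cdpsi].
have m1 : measurable_fun setT (fun z => u z * psi (u z)).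
  by apply: continuous_measurable_fun => x; apply: cvgM; [exact: cu|exact: cpu].
have m2 : measurable_fun setT (fun z => dpsi (u z) * gauss_kernel z).
  apply: continuous_measurable_fun => x.
  by apply: cvgM; [exact: cdpu|exact: continuous_gauss_kernel].
rewrite !Rintegral_gaussR//; apply/eqP; rewrite -subr_eq0; apply/eqP.
pose H z := gauss_prim u z * psi (u z).
pose dH z := u z * psi (u z) * phi z - dpsi (u z) * gauss_kernel z * phi z.
have I1 : mu.-integrable setT (EFin \o (fun z => u z * psi (u z) * phi z)).
  exact/integrable_gaussR.
have I2 : mu.-integrable setT (EFin \o (fun z => dpsi (u z) * gauss_kernel z * phi z)).
  apply/integrable_gaussR => //.
  apply: integrable_mulb i2 => //.
    by apply: continuous_measurable_fun; exact: continuous_gauss_kernel.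
  by move=> z _; exact: gauss_kernel_le.
rewrite -RintegralB//.
apply: (@Rintegral_derive_eq0 H dH
  (2 * (growth_cst * (a + b) * (k * (1 + a + b)) * (4 * normal_peak 1)))).
- move=> x; have := is_derive_gauss_prim cu ub x => Dg.
  have Dc : is_derive x 1 (psi \o u) (dpsi (u x) * du x).
    have := Dpsi (u x) => Dp; have := Du x => Dux.
    exact: is_derive1_comp Dp Dux.
  apply: (is_derive_eq (is_deriveM Dg Dc)); rewrite /GRing.scale/= /dH /gauss_kernel.
  have p0 : phi x != 0 by rewrite gt_eqF.
  have alg (p B C D E g : R) : p != 0 ->
      g * (C * E) + B * (D * p) = D * B * p - C * (- E * (g / p)) * p.
    by move=> ?; field.
  exact: alg.
- move=> x; apply: cvgB; apply: cvgM; try exact: continuous_gauss_density.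
    by apply: cvgM; [exact: cu|exact: cpu].
  by apply: cvgM; [exact: cdpu|exact: continuous_gauss_kernel].
- exact: (integrableBR measurableT I1 I2).
- move=> n; rewrite -[X in _ <= X]mulrA mulr_natl mulr2n.
  have Hb (z : R) : `|z| = n.+1%:R -> `|H z| <=
      growth_cst * (a + b) * (k * (1 + a + b)) * (4 * normal_peak 1) / n.+1%:R.
    move=> zn; have k0 : 0 <= k.
      have := psik 0; rewrite normr0 addr0 mulr1; exact: le_trans.
    have zpsi : `|psi (u z)| <= k * (1 + a + b) * (1 + `|z|).
      apply: (le_trans (psik _)); rewrite -mulrA ler_wpM2l//.
      have := ub z; have := normr_ge0 z; move: a0 b0; nra.
    have phz : phi z = phi n.+1%:R.
      by rewrite -zn; case: (ler0P z); rewrite ?gauss_density_even.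
    have C0 : 0 <= growth_cst * (a + b) :> R.
      by apply: mulr_ge0; [exact: le_trans ler01 growth_cst_ge1 | exact: addr_ge0].
    have K0 : 0 <= k * (1 + a + b) by rewrite mulr_ge0// !addr_ge0.
    rewrite /H normrM.
    apply: (@le_trans _ _ (growth_cst * (a + b) * phi z * (k * (1 + a + b) * (1 + `|z|)))).
      by rewrite ler_pM//; exact: gauss_prim_le.
    rewrite zn phz mulrACA -[X in _ <= X]mulrA ler_wpM2l//; last exact: gauss_density_linear.
    exact: mulr_ge0 C0 K0.
  apply: le_trans (ler_normB _ _) _.
  by apply: lerD; apply: Hb; rewrite ?normrN ger0_norm.
Qed.

End ByParts.
End GaussianByParts.

(** * Stein kernels of images of the Gaussian law *)

Section LawTransfer.
Context d d' (T : measurableType d) (T' : measurableType d') (R : realType).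
Variables (m : probability T R) (U : T -> T') (p : probability T' R).
Hypothesis mU : measurable_fun setT U.
Hypothesis pE : forall B, measurable B -> p B = m (U @^-1` B).

Let U' : {mfun T >-> T'} := mfun_Sub (mem_set mU).

Let eq_law (f : T' -> \bar R) :
  (\int[p]_x f x = \int[distribution m U']_x f x)%E.
Proof. by apply: eq_measure_integral => A mA _; exact: pE. Qed.

Lemma law_transfer_integrable (f : T' -> R) : measurable_fun setT f ->
  p.-integrable setT (EFin \o f) <-> m.-integrable setT (EFin \o (f \o U)).
Proof.
move=> mf; have E : (\int[p]_x `|(EFin \o f) x| = \int[m]_x `|(EFin \o (f \o U)) x|)%E.
  rewrite eq_law ge0_integral_distribution//.
  by apply/measurable_EFinP; exact: measurableT_comp.
split=> /integrableP[_ i]; apply/integrableP; split.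
- by apply/measurable_EFinP; exact: measurableT_comp.
- by rewrite -E.
- exact/measurable_EFinP.
- by rewrite E.
Qed.

Lemma law_transfer_EFin (f : T' -> R) : measurable_fun setT f ->
  m.-integrable setT (EFin \o (f \o U)) ->
  (\int[p]_x (f x)%:E = \int[m]_x (f (U x))%:E)%E.
Proof.
move=> mf If; rewrite eq_law integral_distribution//.
exact/measurable_EFinP.
Qed.

Lemma law_transfer (f : T' -> R) : measurable_fun setT f ->
  m.-integrable setT (EFin \o (f \o U)) ->
  \int[p]_x f x = \int[m]_x f (U x).
Proof. by move=> mf If; rewrite /Rintegral law_transfer_EFin. Qed.

End LawTransfer.

Section SteinKernel.
Context {R : realType}.
Implicit Types p : probability R R.

(** Linear growth of psi is allowed so that psi = id is covered, which identifies
    the mean of the kernel. *)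
Definition is_stein_kernel p (tau : R -> R) := forall (psi dpsi : R -> R) (k : R),
  (forall x : R, is_derive x 1 psi (dpsi x)) -> continuous dpsi ->
  (forall x, `|psi x| <= k * (1 + `|x|)) ->
  p.-integrable setT (EFin \o dpsi) ->
  \int[p]_x (x * psi x) = \int[p]_x (tau x * dpsi x).

Definition symmetric_law p :=
  forall B : set R, measurable B -> p B = p (-%R @^-1` B).

Lemma Rintegral_sym p (f : R -> R) : symmetric_law p -> measurable_fun setT f ->
  p.-integrable setT (EFin \o f) ->
  p.-integrable setT (EFin \o (fun x => f (- x))) /\
  \int[p]_x f (- x) = \int[p]_x f x.
Proof.
move=> ps mf If.
have If' : p.-integrable setT (EFin \o (f \o -%R)).
  exact/(law_transfer_integrable (@oppr_measurable R setT) ps mf).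
split=> //; apply/esym.
exact: (law_transfer (@oppr_measurable R setT) ps mf).
Qed.

Lemma integrable_psi p (psi : R -> R) (k : R) : measurable_fun setT psi ->
  (forall x, `|psi x| <= k * (1 + `|x|)) ->
  p.-integrable setT (EFin \o (fun x => x ^+ 2)) ->
  p.-integrable setT (EFin \o (fun x => x * psi x)).
Proof.
move=> mpsi hk I2.
have k0 : 0 <= k by have := hk 0; rewrite normr0 addr0 mulr1; exact: le_trans.
have I1 := finite_measure_integrable_cst p 1 measurableT.
apply: (le_integrableR measurableT _ _
  (integrableZR measurableT (2 * k) (integrableDR measurableT I1 I2))).
  exact: measurable_funM.
move=> x _; rewrite normrM; apply: (@le_trans _ _ (`|x| * (k * (1 + `|x|)))).
  by rewrite ler_wpM2l.
rewrite /cst/= -(real_normK (num_real x)).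
have := normr_ge0 x; move: k0; move: (`|x|) => y k00 y0.
have := sqr_ge0 (y - 1); have := mulr_ge0 k00 (sqr_ge0 (y - 1)).
have := mulr_ge0 k00 y0; have := mulr_ge0 k00 (sqr_ge0 y).
rewrite !expr2; nra.
Qed.

Lemma symmetric_mean0 p : symmetric_law p ->
  p.-integrable setT (EFin \o (fun x => x ^+ 2)) -> \int[p]_x x = 0.
Proof.
move=> ps I2.
have I1 := finite_measure_integrable_cst p 1 measurableT.
have I : p.-integrable setT (EFin \o (fun x : R => x)).
  apply: (le_integrableR measurableT _ _ (integrableDR measurableT I1 I2)) => //.
  move=> x _ /=; have := normr_ge0 x; rewrite -(real_normK (num_real x)).
  by move: (`|x|) => y y0; nra.
have [_] := Rintegral_sym ps (@measurable_id _ _ _) I.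
have -> : \int[p]_x - x = - \int[p]_x x.
  rewrite -mulN1r -RintegralZl//; apply: eq_Rintegral => x _; by rewrite mulN1r.
move: (\int[p]_x x) => z; lra.
Qed.

(** The bound for a Lipschitz function of constant c and Gaussian mean 0: its
    value at 0 is at most c E|Z|. *)
Definition kernel_cst (c : R) : R :=
  c * (growth_cst * (c * gauss_mean (fun t => `|t|) + c)).

Lemma lipschitz_bound (u du : R -> R) (c : R) :
  (forall x : R, is_derive x 1 u (du x)) -> (forall x, `|du x| <= c) ->
  forall x y, `|u x - u y| <= c * `|x - y|.
Proof.
move=> D dc x y; wlog xy : x y / y <= x.
  by move=> H; have [/H//|/ltW/H] := leP y x; rewrite distrC (distrC y).
have [|z _ ->] := @MVT_segment R u du y x xy (fun x _ => D x).
  by apply: continuous_subspaceT => z; exact: is_derive_continuous (D z).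
by rewrite normrM ler_wpM2r.
Qed.

Lemma mean0_growth (u du : R -> R) (c : R) :
  (forall x : R, is_derive x 1 u (du x)) -> (forall x, `|du x| <= c) ->
  gauss_mean u = 0 ->
  forall t, `|u t| <= c * gauss_mean (fun t => `|t|) + c * `|t|.
Proof.
move=> D dc u0 t.
have L := lipschitz_bound D dc.
have c0 : 0 <= c by apply: le_trans (dc 0).
have cu : continuous u by move=> x; exact: is_derive_continuous (D x).
have I1 : lebesgue_measure.-integrable setT (EFin \o (fun t => u t * normal_pdf 0 1 t)).
  apply: (@integrable_growth_mul _ _ `|u 0| c) => // x.
  have := L x 0; rewrite subr0; have := ler_normD (u x - u 0) (u 0); rewrite subrK.
  lra.
have I2 : lebesgue_measure.-integrable setT (EFin \o (fun t => u 0 * normal_pdf 0 1 t)).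
  apply: integrableZR => //; exact: integrable_gauss_density.
have uu0 : `|u 0| <= c * gauss_mean (fun t => `|t|).
  have -> : u 0 = - \int[lebesgue_measure]_t (u t * normal_pdf 0 1 t - u 0 * normal_pdf 0 1 t).
    rewrite RintegralB// -/(gauss_mean u) -/(gauss_mean (fun=> u 0)).
    by rewrite u0 gauss_mean_cst sub0r opprK.
  rewrite normrN; apply: (@le_trans _ _ (\int[lebesgue_measure]_t `|u t * normal_pdf 0 1 t - u 0 * normal_pdf 0 1 t|)).
    apply: le_normr_Rintegral => //; exact: (integrableBR measurableT I1 I2).
  rewrite /gauss_mean -RintegralZl//; last exact: integrable_abs_gauss_density.
  apply: le_Rintegral => //.
  - exact: (integrable_norm (integrableBR measurableT I1 I2)).
  - exact: (integrableZR measurableT c integrable_abs_gauss_density).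
  - move=> x _; rewrite -mulrBl normrM (ger0_norm (normal_pdf_ge0 _ _ _)) mulrA.
    by rewrite ler_wpM2r ?normal_pdf_ge0//; have := L x 0; rewrite subr0.
have := L t 0; rewrite subr0; have := ler_normD (u t - u 0) (u 0); rewrite subrK.
lra.
Qed.

(** Reflecting the law shows that tau (- x) is a Stein kernel too; the average of
    the two is even. *)
Lemma is_stein_kernel_even p (tau : R -> R) (c : R) : symmetric_law p ->
  p.-integrable setT (EFin \o (fun x => x ^+ 2)) ->
  measurable_fun setT tau -> (forall x, `|tau x| <= c) ->
  is_stein_kernel p tau ->
  is_stein_kernel p (fun x => (tau x + tau (- x)) / 2).
Proof.
move=> ps I2 mtau tc K psi dpsi k D cd hk Id.
have mopp : measurable_fun setT (-%R : R -> R) by exact: oppr_measurable.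
have mtau' : measurable_fun setT (fun x : R => tau (- x)) by exact: measurableT_comp.
have cpsi : continuous psi by move=> x; exact: is_derive_continuous (D x).
have mpsi : measurable_fun setT psi by exact: continuous_measurable_fun.
have mdpsi : measurable_fun setT dpsi by exact: continuous_measurable_fun.
have J1 := integrable_mulb measurableT mtau (fun x _ => tc x) Id.
have J2 := integrable_mulb measurableT mtau' (fun x _ => tc (- x)) Id.
have Id' := (Rintegral_sym ps mdpsi Id).1.
have E1 := K _ _ _ D cd hk Id.
have D' (x : R) : is_derive x 1 (fun y => - psi (- y)) (dpsi (- x)).
  have Dn : is_derive x 1 (-%R : R -> R) (-1) by exact: is_deriveNid.
  have := is_deriveN (is_derive1_comp (D (- x)) Dn).
  by rewrite mulrN1 opprK.
have cd' : continuous (fun x => dpsi (- x)).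
  by move=> x; apply: continuous_comp; [exact: opp_continuous | exact: cd].
have E2 := K _ _ k D' cd' (fun x => ltac:(rewrite normrN -(normrN x); exact: hk)) Id'.
have E3 : \int[p]_x (x * - psi (- x)) = \int[p]_x (x * psi x).
  have [_ <-] := Rintegral_sym ps (measurable_funM (@measurable_id _ _ _) mpsi) (integrable_psi mpsi hk I2).
  by apply: eq_Rintegral => x _; rewrite /= mulrN mulNr.
have E4 : \int[p]_x (tau x * dpsi (- x)) = \int[p]_x (tau (- x) * dpsi x).
  have J3 : p.-integrable setT (EFin \o (fun x => tau (- x) * dpsi x)).
    by apply: integrable_eqR J2 => // x _; rewrite mulrC.
  have [_ <-] := Rintegral_sym ps (measurable_funM mtau' mdpsi) J3.
  by apply: eq_Rintegral => x _; rewrite /= opprK.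
have -> : \int[p]_x ((tau x + tau (- x)) / 2 * dpsi x) =
    2^-1 * (\int[p]_x (dpsi x * tau x) + \int[p]_x (dpsi x * tau (- x))).
  rewrite -RintegralD// -RintegralZl//; last exact: (integrableDR measurableT J1 J2).
  by apply: eq_Rintegral => x _; rewrite mulrAC mulrC mulrDl (mulrC (tau x)) (mulrC (tau (- x))).
rewrite E3 E4 in E2.
have -> : \int[p]_x (dpsi x * tau x) = \int[p]_x (x * psi x).
  by rewrite E1; apply: eq_Rintegral => x _; rewrite mulrC.
have -> : \int[p]_x (dpsi x * tau (- x)) = \int[p]_x (x * psi x).
  by rewrite E2; apply: eq_Rintegral => x _; rewrite mulrC.
move: (\int[p]_x (x * psi x)) => z; lra.
Qed.

(** With p the law of u(Z), the Gaussian kernel of u satisfies the identity as a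
    function of Z; its conditional expectation given u(Z) is a function of u(Z). *)
Lemma class_L_stein_kernel p (c1 c2 : R) : class_L c1 c2 p -> symmetric_law p ->
  p.-integrable setT (EFin \o (fun x => x ^+ 2)) ->
  exists tau : R -> R, [/\ measurable_fun setT tau,
    forall x, `|tau x| <= kernel_cst c1, forall x, tau (- x) = tau x &
    is_stein_kernel p tau].
Proof.
move=> [u [[d1 d2 _] du1 _ law]] ps I2.
have D (x : R) : is_derive x 1 u (derive1 u x).
  by rewrite derive1E; apply: DeriveDef; [exact: d1|].
have cdu : continuous (derive1 u).
  by move=> x; apply: differentiable_continuous; apply/derivable1_diffP; exact: d2.
have cu : continuous u by move=> x; exact: is_derive_continuous (D x).
have mu : measurable_fun setT u by exact: continuous_measurable_fun.
pose U : {RV (@gaussR R) >-> R} := mfun_Sub (mem_set mu).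
have pE B : measurable B -> p B = gaussR (u @^-1` B) by exact: law.
have tI (f : R -> R) : measurable_fun setT f -> p.-integrable setT (EFin \o f) ->
    gaussR.-integrable setT (EFin \o (f \o u)).
  by move=> mf If; apply/(law_transfer_integrable mu pE mf).
have tE (f : R -> R) : measurable_fun setT f -> p.-integrable setT (EFin \o f) ->
    \int[p]_x f x = \int[gaussR]_x f (u x).
  by move=> mf If; apply: (law_transfer mu pE mf); exact: tI.
have Iid : p.-integrable setT (EFin \o (fun x : R => x)).
  have := integrable_psi (psi := fun=> 1) (k := 1) (measurable_cst _) _ I2.
  move=> /(_ _)/(integrable_eqR measurableT) H; apply: H.
    by move=> x _; rewrite mulr1.
  by move=> x; rewrite normr1 mul1r lerDl.
have u0 : gauss_mean u = 0.
  rewrite /gauss_mean -Rintegral_gaussR// -(symmetric_mean0 ps I2).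
  by rewrite (tE (fun x => x)).
have c0 : 0 <= c1 by apply: le_trans (du1 0).
have a0 : 0 <= c1 * gauss_mean (fun t : R => `|t|).
  by rewrite mulr_ge0//; apply: Rintegral_ge0 => t _; rewrite mulr_ge0// normal_pdf_ge0.
have ub := mean0_growth D du1 u0.
have mk : measurable_fun setT (gauss_kernel u (derive1 u)).
  by apply: continuous_measurable_fun; exact: continuous_gauss_kernel D cdu ub.
have kb := gauss_kernel_le D a0 c0 du1 ub u0.
have [tau0 [mt0 t0 t0E]] := conditional_density U mk kb.
have K0 : is_stein_kernel p tau0.
  move=> psi dpsi k Dp cdp hk Id.
  have mpsi : measurable_fun setT psi.
    by apply: continuous_measurable_fun => x; exact: is_derive_continuous (Dp x).
  have mdpsi : measurable_fun setT dpsi by exact: continuous_measurable_fun.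
  have I1 := integrable_psi mpsi hk I2.
  have mx : measurable_fun setT (fun x : R => x * psi x) by exact: measurable_funM.
  rewrite (tE _ mx I1).
  rewrite (gauss_by_parts D cdu a0 c0 du1 ub u0 Dp cdp hk (tI _ mx I1) (tI _ mdpsi Id)).
  rewrite -(t0E dpsi mdpsi (tI _ mdpsi Id)).
  under [RHS]eq_Rintegral do rewrite mulrC.
  rewrite /Rintegral; congr fine; apply/esym.
  by apply: eq_measure_integral => A mA _; exact: pE.
exists (fun x => (tau0 x + tau0 (- x)) / 2); split.
- apply: measurable_funM => //; apply: measurable_funD => //.
  by apply: measurableT_comp => //; exact: oppr_measurable.
- move=> x; have := t0 x; have := t0 (- x); rewrite -/(kernel_cst c1).
  rewrite !ler_norml => /andP[? ?] /andP[? ?]; apply/andP; split; lra.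
- by move=> x; rewrite opprK addrC.
- exact: is_stein_kernel_even t0 K0.
Qed.

End SteinKernel.

(** * Resampling and reflecting one coordinate *)

Section BoxLaw.
Context {R : realType} (n : nat).
Notation V := (n.-tuple R).

Definition box (B : 'I_n -> set R) : set V := [set t | forall i, B i (tnth t i)].

Lemma measurable_box (B : 'I_n -> set R) :
  (forall i, measurable (B i)) -> measurable (box B).
Proof.
move=> mB; have -> : box B = \bigcap_i ((fun t : V => tnth t i) @^-1` B i).
  by apply/seteqP; split => [t tB i _|t tB i]; exact: tB.
apply: fin_bigcap_measurable => // i _; rewrite -[X in measurable X]setTI.
exact: measurable_tnth.
Qed.

Lemma measurable_boxE : @measurable _ V =
  <<s [set A | exists2 B : 'I_n -> set R, (forall i, measurable (B i)) & A = box B] >>.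
Proof.
apply/seteqP; split.
  apply: smallest_sub; first exact: smallest_sigma_algebra.
  move=> A; rewrite -bigcup_seq => -[i /= _ [B mB <-]].
  apply: sub_sigma_algebra; exists (fun j => if j == i then B else setT).
    by move=> j; case: eqP.
  apply/seteqP; split => [t [_ tB] j|t tB]; first by case: eqP => // ->.
  by split => //; have := tB i; rewrite eqxx.
apply: smallest_sub; first exact: sigma_algebra_measurable.
by move=> _ [B mB ->]; exact: measurable_box.
Qed.

(** Boxes are stable under intersection and generate the Borel sets. *)
Lemma box_unique (m1 m2 : probability V R) :
  (forall B : 'I_n -> set R, (forall i, measurable (B i)) ->
     m1 (box B) = m2 (box B)) ->
  forall A, measurable A -> m1 A = m2 A.
Proof.
move=> h; apply: (measure_unique
  [set A | exists2 B : 'I_n -> set R, (forall i, measurable (B i)) & A = box B]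
  (fun=> setT)).
- exact: measurable_boxE.
- move=> _ _ [B mB ->] [C mC ->]; exists (fun i => B i `&` C i).
    by move=> i; exact: measurableI.
  by apply/seteqP; split => t /= => [[hB hC] i|hBC]; [split|split=> i; have [] := hBC i].
- by move=> _; exists (fun=> setT) => //; apply/seteqP.
- by apply/seteqP; split => // x _; exists 0%N.
- by move=> _ [B mB ->]; exact: h.
- by move=> k; rewrite -ge0_fin_numE ?fin_num_measure.
Qed.

End BoxLaw.

Definition upd (n : nat) (A : Type) (x : 'I_n -> A) (j : 'I_n) (t : A) : 'I_n -> A :=
  fun i => if i == j then t else x i.

Section Resampling.
Context d (T : measurableType d) (R : realType) (P : probability T R).
Variables (X : nat -> {RV P >-> R}) (n : nat).
Hypothesis hindep : mutually_independent X.
Notation V := (n.-tuple R).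

Definition coords (w : T) : 'I_n -> R := fun i => X i w.

Let XV (w : T) : V := [tuple coords w i | i < n].

Let measurable_XV : measurable_fun setT XV.
Proof.
apply/measurable_fun_tnthP => i; rewrite (_ : _ \o _ = X i)//.
by apply/funext => w /=; rewrite tnth_mktuple.
Qed.

(** Expressed on the tuple space, which carries the product sigma-algebra. *)
Definition measV (h : ('I_n -> R) -> R) :=
  measurable_fun setT (fun t : V => h (tnth t)).

Let XV_box (B : 'I_n -> set R) : (forall i, measurable (B i)) ->
  P (XV @^-1` box B) = (\prod_(i < n) P (X i @^-1` B i))%E.
Proof.
move=> mB.
pose B' k := if insub k is Some i then B i else setT.
have B'E (i : 'I_n) : B' i = B i by rewrite /B' valK.
have mB' k : measurable (B' k) by rewrite /B'; case: insubP.
have -> : XV @^-1` box B = \big[setI/setT]_(i <- iota 0 n) (X i @^-1` B' i).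
  rewrite -bigcap_seq; apply/seteqP; split => [w /= h k /=|w /= h i].
    rewrite mem_iota add0n => kn; rewrite -[k]/(val (Ordinal kn)) B'E.
    by have := h (Ordinal kn); rewrite tnth_mktuple.
  by have := h i; rewrite /= mem_iota add0n ltn_ord B'E tnth_mktuple; exact.
rewrite hindep ?iota_uniq// (_ : iota 0 n = index_iota 0 n) ?big_mkord; last by rewrite /index_iota subn0.
by apply: eq_bigr => i _; rewrite B'E.
Qed.

Let law : probability V R := distribution P (mfun_Sub (mem_set measurable_XV)).

Lemma coordsE w : tnth (XV w) = coords w.
Proof. by apply/funext => i; rewrite tnth_mktuple. Qed.

Let updV (j : 'I_n) (z : T * R) : V := [tuple upd (coords z.1) j z.2 i | i < n].

Let measurable_updV j : measurable_fun setT (updV j).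
Proof.
apply/measurable_fun_tnthP => i; rewrite /updV.
rewrite (_ : _ \o _ = fun z : T * R => if i == j then z.2 else X i z.1); last first.
  by apply/funext => z /=; rewrite tnth_mktuple /upd.
case: eqP => _ //; exact: measurableT_comp.
Qed.

Let prodP (j : nat) : probability (T * R)%type R := (P \x distribution P (X j))%E.

Let updV_law (j : 'I_n) A : measurable A -> law A = prodP j (updV j @^-1` A).
Proof.
pose law2 : probability V R :=
  distribution (prodP j) (mfun_Sub (mem_set (measurable_updV j))).
apply: (box_unique (m2 := law2)) => B mB.
rewrite [LHS]XV_box// /law2 /distribution /pushforward /=.
have -> : updV j @^-1` box B =
    (XV @^-1` box (fun i => if i == j then setT else B i)) `*` B j.
  apply/seteqP; split => [[w t] /= h|[w t] /= [h1 h2] i].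
    split; last by have := h j; rewrite tnth_mktuple /upd eqxx.
    move=> i; rewrite tnth_mktuple; case: eqP => // /eqP ij.
    by have := h i; rewrite tnth_mktuple /upd (negbTE ij).
  rewrite tnth_mktuple /upd; case: eqP => [->//|/eqP ij].
  by have := h1 i; rewrite tnth_mktuple (negbTE ij).
have mB' i : measurable (if i == j then setT else B i) by case: eqP.
rewrite product_measure1E//; last first.
  by rewrite -[X in measurable X]setTI; apply: measurable_XV => //; exact: measurable_box.
transitivity ((\prod_(i < n) P (X i @^-1` (if i == j then setT else B i))) *
    P (X j @^-1` B j))%E; last by congr (_ * _)%E; rewrite -XV_box.
rewrite (bigD1 j)//= [in RHS](bigD1 j)//= eqxx preimage_setT.
rewrite [X in (X * _ * _)%E]probability_setT mul1e muleC; congr (_ * _)%E.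
by apply: eq_bigr => i /negbTE ->.
Qed.

(** By independence, the joint law is unchanged when the j-th coordinate is replaced
    by a copy independent of all the others, as one sees on boxes. *)
Lemma resample (j : 'I_n) (h : ('I_n -> R) -> R) : measV h ->
  P.-integrable setT (EFin \o (fun w => h (coords w))) ->
  (P \x distribution P (X j))%E.-integrable setT
    (EFin \o (fun z => h (upd (coords z.1) j z.2))) /\
  (\int[P]_w (h (coords w))%:E =
   \int[P]_w \int[distribution P (X j)]_t (h (upd (coords w) j t))%:E)%E.
Proof.
move=> mh Ih.
have Ilaw : law.-integrable setT (EFin \o (fun t : V => h (tnth t))).
  apply/(law_transfer_integrable measurable_XV) => //.
  by apply: integrable_eqR Ih => // w _ /=; rewrite coordsE.
have eU z : tnth (updV j z) = upd (coords z.1) j z.2.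
  by apply/funext => i; rewrite tnth_mktuple.
have I2 : (prodP j).-integrable setT (EFin \o (fun z => h (upd (coords z.1) j z.2))).
  have /(law_transfer_integrable (@measurable_updV j) (@updV_law j) mh) I3 := Ilaw.
  by apply: integrable_eqR I3 => // z _ /=; rewrite eU.
split=> //.
transitivity (\int[law]_t (h (tnth t))%:E)%E.
  rewrite (law_transfer_EFin (m := P) (p := law) measurable_XV (fun B _ => erefl) mh)//.
    by apply: eq_integral => w _; rewrite coordsE.
  by apply: integrable_eqR Ih => // w _ /=; rewrite coordsE.
rewrite (law_transfer_EFin (@measurable_updV j) (@updV_law j) mh); last first.
  by apply: integrable_eqR I2 => // z _ /=; rewrite eU.
transitivity (\int[prodP j]_z (h (upd (coords z.1) j z.2))%:E)%E.
  by apply: eq_integral => z _; rewrite eU.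
by rewrite -(integral12_prod_meas1 I2).
Qed.

Definition flip (j : 'I_n) (x : 'I_n -> R) : 'I_n -> R := upd x j (- x j).

Let flipV (j : 'I_n) (w : T) : V := [tuple flip j (coords w) i | i < n].

Let measurable_flipV j : measurable_fun setT (flipV j).
Proof.
apply/measurable_fun_tnthP => i; rewrite /flipV.
rewrite (_ : _ \o _ = fun w : T => if i == j then - X j w else X i w); last first.
  by apply/funext => z /=; rewrite tnth_mktuple /flip /upd.
case: eqP => _ //; exact: measurableT_comp.
Qed.

Hypothesis hsym : forall i, symmetric_rv (X i).

Let flipV_law (j : 'I_n) A : measurable A -> law A = P (flipV j @^-1` A).
Proof.
pose law2 : probability V R := distribution P (mfun_Sub (mem_set (measurable_flipV j))).
apply: (box_unique (m2 := law2)) => B mB.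
rewrite [LHS]XV_box//; transitivity (P (flipV j @^-1` box B)); last by [].
have -> : flipV j @^-1` box B =
    XV @^-1` box (fun i => if i == j then -%R @^-1` B i else B i).
  apply/seteqP; split => w /= h i; have := h i; rewrite !tnth_mktuple /flip /upd.
    by case: eqP => // ->.
  by case: eqP => // ->.
have mopp C : measurable C -> measurable ((-%R : R -> R) @^-1` C).
  by move=> mC; rewrite -[X in measurable X]setTI; exact: oppr_measurable.
rewrite XV_box; last by move=> i; case: eqP => _ //; exact: mopp.
apply: eq_bigr => i _; case: eqP => [->|//].
exact: hsym.
Qed.

(** Changing the sign of one coordinate preserves the joint law; hence odd
    functions of any coordinate integrate to 0. *)
Lemma flip_integrable (j : 'I_n) (h : ('I_n -> R) -> R) : measV h ->
  P.-integrable setT (EFin \o (fun w => h (coords w))) ->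
  \int[P]_w h (flip j (coords w)) = \int[P]_w h (coords w).
Proof.
move=> mh Ih.
have Ilaw : law.-integrable setT (EFin \o (fun t : V => h (tnth t))).
  apply/(law_transfer_integrable measurable_XV) => //.
  by apply: integrable_eqR Ih => // w _ /=; rewrite coordsE.
have eU w : tnth (flipV j w) = flip j (coords w).
  by apply/funext => i; rewrite tnth_mktuple.
have /(law_transfer_integrable (@measurable_flipV j) (@flipV_law j) mh) I3 := Ilaw.
transitivity (\int[law]_t h (tnth t)).
  rewrite (law_transfer (@measurable_flipV j) (@flipV_law j) mh)//.
  by apply: eq_Rintegral => w _; rewrite eU.
rewrite (law_transfer (m := P) (p := law) measurable_XV (fun B _ => erefl) mh)//.
  by apply: eq_Rintegral => w _; rewrite coordsE.
by apply: integrable_eqR Ih => // w _ /=; rewrite coordsE.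
Qed.

End Resampling.

(** * Moment bounds *)

Section Expectation.
Context d (T : measurableType d) (R : realType) (P : probability T R).
Implicit Types (f g : T -> R) (K : nat -> R).

Definition Ex f := \int[P]_w f w.

(** The bounds are explicit because they have to be uniform: over the variables,
    and over the monomials of a given degree in any number of variables.  They are
    stated in the extended reals so as to include integrability. *)
Definition mbd K f := measurable_fun setT f /\
  forall p, (\int[P]_w (f w ^+ (2 * p))%:E <= (K p)%:E)%E.

Definition tame f := exists K, mbd K f.

Lemma expr2n_ge0 (x : R) p : 0 <= x ^+ (2 * p).
Proof. by rewrite exprM exprn_ge0// sqr_ge0. Qed.

Lemma mbd_tame K f : mbd K f -> tame f. Proof. by exists K. Qed.

Lemma tame_measurable f : tame f -> measurable_fun setT f.
Proof. by case=> K []. Qed.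

Lemma mbd_le K1 K2 f : (forall p, K1 p <= K2 p) -> mbd K1 f -> mbd K2 f.
Proof.
by move=> K12 [mf h]; split=> // p; apply: le_trans (h p) _; rewrite lee_fin.
Qed.

Let le_int f g (b : R) : measurable_fun setT f -> measurable_fun setT g ->
  (forall w, 0 <= f w <= g w) -> (\int[P]_w (g w)%:E <= b%:E)%E ->
  (\int[P]_w (f w)%:E <= b%:E)%E.
Proof.
move=> mf mg fg; apply: le_trans; apply: ge0_le_integral => //.
- by move=> w _; rewrite lee_fin; have /andP[] := fg w.
- exact/measurable_EFinP.
- exact/measurable_EFinP.
- by move=> w _; rewrite lee_fin; have /andP[] := fg w.
Qed.

Let int_addZ f g (k a b : R) : measurable_fun setT f -> measurable_fun setT g ->
  0 <= k -> (forall w, 0 <= f w) -> (forall w, 0 <= g w) ->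
  (\int[P]_w (f w)%:E <= a%:E)%E -> (\int[P]_w (g w)%:E <= b%:E)%E ->
  (\int[P]_w (k * (f w + g w))%:E <= (k * (a + b))%:E)%E.
Proof.
move=> mf mg k0 f0 g0 fa gb.
under eq_integral do rewrite EFinM EFinD.
rewrite ge0_integralZl//; last 2 first.
- by apply: emeasurable_funD; exact/measurable_EFinP.
- by move=> w _; rewrite adde_ge0// lee_fin.
rewrite EFinM EFinD lee_wpmul2l ?lee_fin//.
rewrite ge0_integralD//; first exact: leeD.
- by move=> w _; rewrite lee_fin.
- exact/measurable_EFinP.
- by move=> w _; rewrite lee_fin.
- exact/measurable_EFinP.
Qed.

(** From (f g)^(2p) <= (f^(4p) + g^(4p)) / 2. *)
Lemma mbdM K1 K2 f g : mbd K1 f -> mbd K2 g ->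
  mbd (fun p => 2^-1 * (K1 (2 * p)%N + K2 (2 * p)%N)) (fun w => f w * g w).
Proof.
move=> [mf hf] [mg hg]; split; first exact: measurable_funM.
move=> p; have := int_addZ _ _ _ _ _ (hf (2 * p)%N) (hg (2 * p)%N) (k := 2^-1).
have mX (h : T -> R) q : measurable_fun setT h -> measurable_fun setT (fun w => h w ^+ q).
  by move=> mh; exact: measurable_funX.
move=> /(_ (mX _ _ mf) (mX _ _ mg)) H; apply: le_int (H _ _ _) => //.
- by apply: mX; exact: measurable_funM.
- by apply: measurable_funM => //; apply: measurable_funD; exact: mX.
- move=> w; rewrite expr2n_ge0/= exprMn !(mulnC 2 (2 * p)) !(exprM _ (2 * p) 2).
  move: (f w ^+ _) (g w ^+ _) => x y; have := sqr_ge0 (x - y).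
  by rewrite sqrrB; lra.
- by move=> w; exact: expr2n_ge0.
- by move=> w; exact: expr2n_ge0.
Qed.

Lemma mbdD K1 K2 f g : mbd K1 f -> mbd K2 g ->
  mbd (fun p => 2 ^+ (2 * p) * (K1 p + K2 p)) (fun w => f w + g w).
Proof.
move=> [mf hf] [mg hg]; split; first exact: measurable_funD.
move=> p; have := int_addZ _ _ _ _ _ (hf p) (hg p) (k := 2 ^+ (2 * p)).
have mX (h : T -> R) q : measurable_fun setT h -> measurable_fun setT (fun w => h w ^+ q).
  by move=> mh; exact: measurable_funX.
move=> /(_ (mX _ _ mf) (mX _ _ mg)) H; apply: le_int (H _ _ _) => //.
- by apply: mX; exact: measurable_funD.
- by apply: measurable_funM => //; apply: measurable_funD; exact: mX.
- move=> w; rewrite expr2n_ge0/=.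
  have e (x : R) : x ^+ (2 * p) = `|x| ^+ (2 * p) by rewrite !exprM real_normK ?num_real.
  move: (f w) (g w) => x y; wlog xy : x y / `|x| <= `|y|.
    move=> W; have [|/ltW] := leP `|x| `|y|; first exact: W.
    by move=> /W; rewrite addrC (addrC (y ^+ _)).
  rewrite mulrDr; apply: ler_wpDl; first by apply: mulr_ge0; exact: expr2n_ge0.
  rewrite e (e y) -exprMn lerXn2r ?nnegrE// ?mulr_ge0//.
  by apply: le_trans (ler_normD _ _) _; lra.
- by move=> w; exact: expr2n_ge0.
- by move=> w; exact: expr2n_ge0.
Qed.

Lemma mbd_bounded f c : measurable_fun setT f -> (forall w, `|f w| <= c) ->
  mbd (fun p => c ^+ (2 * p)) f.
Proof.
move=> mf fc; split=> // p.
apply: (@le_int _ (fun=> c ^+ (2 * p))) => //.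
- exact: measurable_funX.
- move=> w; rewrite expr2n_ge0/= [leLHS]exprM -real_normK ?num_real// -exprM.
  by rewrite lerXn2r ?nnegrE// (le_trans _ (fc w)).
- by rewrite integral_cst//= probability_setT mule1.
Qed.

Lemma tame_cst c : tame (fun=> c).
Proof. by exists (fun p => `|c| ^+ (2 * p)); apply: mbd_bounded. Qed.

Lemma tame_bounded f c : measurable_fun setT f -> (forall w, `|f w| <= c) -> tame f.
Proof. by move=> mf fc; exists (fun p => c ^+ (2 * p)); exact: mbd_bounded. Qed.

Lemma tameM f g : tame f -> tame g -> tame (fun w => f w * g w).
Proof. by move=> [K1 h1] [K2 h2]; eexists; exact: mbdM h1 h2. Qed.

Lemma tameD f g : tame f -> tame g -> tame (fun w => f w + g w).
Proof. by move=> [K1 h1] [K2 h2]; eexists; exact: mbdD h1 h2. Qed.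

Lemma tameZ c f : tame f -> tame (fun w => c * f w).
Proof. by move=> tf; apply: tameM => //; exact: tame_cst. Qed.

Lemma tameN f : tame f -> tame (fun w => - f w).
Proof.
by move=> /(tameZ (-1)) [K h]; exists K; move: h; under eq_fun do rewrite mulN1r.
Qed.

Lemma tameB f g : tame f -> tame g -> tame (fun w => f w - g w).
Proof. by move=> tf tg; apply: tameD => //; exact: tameN. Qed.

Lemma tameX f p : tame f -> tame (fun w => f w ^+ p).
Proof.
move=> tf; elim: p => [|p IH].
  by under eq_fun do rewrite expr0; exact: tame_cst.
by under eq_fun do rewrite exprS; exact: tameM.
Qed.

Lemma tame_sum I (s : seq I) (Q : pred I) (F : I -> T -> R) :
  (forall i, Q i -> tame (F i)) -> tame (fun w => \sum_(i <- s | Q i) F i w).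
Proof.
move=> tF; elim: s => [|i s IH].
  by under eq_fun do rewrite big_nil; exact: tame_cst.
under eq_fun do rewrite big_cons.
by case: (boolP (Q i)) => Qi //; apply: tameD => //; exact: tF.
Qed.

Lemma mbd_sqr_le K f : mbd K f -> Ex (fun w => f w ^+ 2) <= K 1%N.
Proof.
move=> [mf h]; have := h 1%N; rewrite /Ex /Rintegral muln1 => h1.
rewrite -lee_fin fineK// ge0_fin_numE; last first.
  by apply: integral_ge0 => w _; rewrite lee_fin sqr_ge0.
by apply: le_lt_trans h1 _; exact: ltry.
Qed.

Lemma tame_integrable f : tame f -> P.-integrable setT (EFin \o f).
Proof.
move=> [K [mf h]].
have I2 : P.-integrable setT (EFin \o (fun w => f w ^+ 2)).
  apply/integrableP; split; first by apply/measurable_EFinP; exact: measurable_funX.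
  under eq_integral do rewrite /= ger0_norm ?sqr_ge0//.
  by apply: le_lt_trans (h 1%N) _; exact: ltry.
have I1 := finite_measure_integrable_cst P 1 measurableT.
apply: (le_integrableR measurableT mf _ (integrableDR measurableT I1 I2)) => w _ /=.
have := normr_ge0 (f w); rewrite -(real_normK (num_real (f w))).
move: (`|f w|) => y y0; have := sqr_ge0 (y - 1); rewrite sqrrB; nra.
Qed.

Lemma ExD f g : tame f -> tame g -> Ex (fun w => f w + g w) = Ex f + Ex g.
Proof. by move=> tf tg; rewrite /Ex RintegralD//; exact: tame_integrable. Qed.

Lemma ExB f g : tame f -> tame g -> Ex (fun w => f w - g w) = Ex f - Ex g.
Proof. by move=> tf tg; rewrite /Ex RintegralB//; exact: tame_integrable. Qed.

Lemma ExZ c f : tame f -> Ex (fun w => c * f w) = c * Ex f.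
Proof. by move=> tf; rewrite /Ex RintegralZl//; exact: tame_integrable. Qed.

Lemma ExN f : tame f -> Ex (fun w => - f w) = - Ex f.
Proof. by move=> tf; rewrite -mulN1r -ExZ//; congr Ex; apply/funext => w; rewrite mulN1r. Qed.

Lemma Ex_cst c : Ex (fun=> c) = c.
Proof. exact: Rintegral_prob_cst. Qed.

Lemma Ex_sum I (s : seq I) (Q : pred I) (F : I -> T -> R) :
  (forall i, Q i -> tame (F i)) ->
  Ex (fun w => \sum_(i <- s | Q i) F i w) = \sum_(i <- s | Q i) Ex (F i).
Proof.
move=> tF; elim: s => [|i s IH].
  by under eq_fun do rewrite big_nil; rewrite big_nil Ex_cst.
under eq_fun do rewrite big_cons; rewrite big_cons.
case: (boolP (Q i)) => Qi //; rewrite ExD ?IH//; first exact: tF.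
exact: tame_sum.
Qed.

Lemma Ex_le f g : tame f -> tame g -> (forall w, f w <= g w) -> Ex f <= Ex g.
Proof.
move=> tf tg fg; apply: le_Rintegral => //; exact: tame_integrable.
Qed.

Lemma Ex_ge0 f : (forall w, 0 <= f w) -> 0 <= Ex f.
Proof. by move=> f0; apply: Rintegral_ge0 => w _. Qed.

Lemma tame_norm f : tame f -> tame (fun w => `|f w|).
Proof.
move=> [K [mf h]]; exists K; split; first exact: measurableT_comp.
move=> p; apply: le_trans (h p); rewrite le_eqVlt; apply/orP; left; apply/eqP.
by apply: eq_integral => w _; rewrite !exprM real_normK ?num_real.
Qed.

Lemma Ex_norm_le f : tame f -> `|Ex f| <= Ex (fun w => `|f w|).
Proof. by move=> tf; apply: le_normr_Rintegral => //; exact: tame_integrable. Qed.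

(** Young's inequality; the weight l serves to balance factors of different sizes. *)
Lemma Ex_young f g (l : R) : 0 < l -> tame f -> tame g ->
  Ex (fun w => `|f w * g w|) <=
  (l * Ex (fun w => f w ^+ 2) + l^-1 * Ex (fun w => g w ^+ 2)) / 2.
Proof.
move=> l0 tf tg.
have tf2 := tameX 2 tf; have tg2 := tameX 2 tg.
have -> : (l * Ex (fun w => f w ^+ 2) + l^-1 * Ex (fun w => g w ^+ 2)) / 2 =
    Ex (fun w => 2^-1 * (l * f w ^+ 2 + l^-1 * g w ^+ 2)).
  rewrite ExZ; last by apply: tameD; exact: tameZ.
  by rewrite ExD ?ExZ 1?mulrC//; exact: tameZ.
apply: Ex_le => [||w].
- by apply: tame_norm; exact: tameM.
- by apply: tameZ; apply: tameD; apply: tameZ; exact: tameX.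
have -> : `|f w * g w| = `|f w| * `|g w| by rewrite normrM.
rewrite -(real_normK (num_real (f w))) -(real_normK (num_real (g w))).
move: (`|f w|) (`|g w|) => x y; have li : l * l^-1 = 1 by rewrite divff ?gt_eqF.
have l1 : 0 < l^-1 by rewrite invr_gt0.
have := mulr_ge0 (ltW l1) (sqr_ge0 (l * x - y)).
have -> : l^-1 * (l * x - y) ^+ 2 = (l * l^-1) * (l * x ^+ 2) - (l * l^-1) * (2 * (x * y)) + l^-1 * y ^+ 2 by ring.
rewrite li; lra.
Qed.

End Expectation.

(** * Moments of subgaussian variables *)

Section SubgaussianMoments.
Context d (T : measurableType d) (R : realType) (P : probability T R).

Lemma exprn_le_expR (y : R) (m : nat) : 0 <= y -> y ^+ m <= m%:R ^+ m * expR y.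
Proof.
case: m => [|m] y0; first by rewrite !expr0 mul1r -expR0 ler_expR.
have m0 : 0 < m.+1%:R :> R by [].
have -> : expR y = expR (y / m.+1%:R) ^+ m.+1.
  by rewrite -expRM_natl mulrC divfK// gt_eqF.
rewrite -exprMn; apply: lerXn2r; rewrite ?nnegrE ?mulr_ge0 ?expR_ge0//.
rewrite mulrC -ler_pdivrMr//; apply: le_trans (expR_ge1Dx _).
by rewrite lerDr.
Qed.

Definition subgaussian_moment (sigma : R) (p : nat) : R :=
  (2 * p)%:R ^+ (2 * p) * (expR (sigma ^+ 2 / 2) + expR (sigma ^+ 2 / 2)).

(** y^m <= m^m exp y bounds the moments by the Laplace transform at 1 and -1. *)
Lemma subgaussian_mbd (sigma : R) (X : {RV P >-> R}) : subgaussian sigma X ->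
  mbd P (subgaussian_moment sigma) X.
Proof.
move=> hX; split=> // p.
have h1 := hX 1; have h2 := hX (-1).
rewrite /mmt_gen_fun unlock !expr1n ?sqrrN ?expr1n ?mulr1 in h1 h2.
apply: (@le_trans _ _ (\int[P]_w ((2 * p)%:R ^+ (2 * p) * (expR (X w) + expR (- X w)))%:E)%E).
  apply: ge0_le_integral => //.
  - by move=> w _; rewrite lee_fin expr2n_ge0.
  - by apply/measurable_EFinP; exact: measurable_funX.
  - apply/measurable_EFinP; apply: measurable_funM => //.
    apply: measurable_funD; apply: measurableT_comp => //.
    exact: measurableT_comp.
  move=> w _; rewrite lee_fin.
  have -> : X w ^+ (2 * p) = `|X w| ^+ (2 * p) by rewrite !exprM real_normK ?num_real.
  apply: le_trans (exprn_le_expR _ (normr_ge0 _)) _.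
  rewrite ler_wpM2l ?exprn_ge0//.
  by case: (ler0P (X w)) => _; [rewrite lerDr|rewrite lerDl]; exact: expR_ge0.
under eq_integral do rewrite EFinM EFinD.
rewrite ge0_integralZl//; last 2 first.
- apply: emeasurable_funD; apply/measurable_EFinP; apply: measurableT_comp => //.
  exact: measurableT_comp.
- by move=> w _; rewrite adde_ge0// lee_fin expR_ge0.
rewrite /subgaussian_moment EFinM lee_wpmul2l ?lee_fin ?exprn_ge0//.
have e0 (g : T -> R) w : setT w -> (0 <= (expR (g w))%:E)%E.
  by move=> _; rewrite lee_fin expR_ge0.
have mE : measurable_fun setT (fun w => (expR (X w))%:E).
  by apply/measurable_EFinP; exact: measurableT_comp.
have mEN : measurable_fun setT (fun w => (expR (- X w))%:E).
  by apply/measurable_EFinP; apply: measurableT_comp => //; exact: measurableT_comp.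
rewrite (ge0_integralD P measurableT (e0 X) mE (e0 (fun w => - X w)) mEN).
rewrite EFinD; apply: leeD.
  by apply: le_trans h1; rewrite le_eqVlt; apply/orP; left; apply/eqP;
    apply: eq_integral => w _; rewrite /= mulr1.
by apply: le_trans h2; rewrite le_eqVlt; apply/orP; left; apply/eqP;
  apply: eq_integral => w _; rewrite /= mulrN1.
Qed.

End SubgaussianMoments.

(** * Functions of finitely many independent coordinates *)

Section Coordinates.
Context d (T : measurableType d) (R : realType) (P : probability T R).
Variables (X : nat -> {RV P >-> R}) (n : nat).
Notation V := (n.-tuple R).
Notation fn := (('I_n -> R) -> R).
Implicit Types h g : fn.

Definition good h := measV h /\ tame P (fun w => h (coords X w)).

Definition EX h := Ex P (fun w => h (coords X w)).

Lemma good_cst c : good (fun=> c).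
Proof. by split; [exact: measurable_cst|exact: tame_cst]. Qed.

Lemma goodM h g : good h -> good g -> good (fun x => h x * g x).
Proof. by move=> [m1 t1] [m2 t2]; split; [exact: measurable_funM|exact: tameM]. Qed.

Lemma goodD h g : good h -> good g -> good (fun x => h x + g x).
Proof. by move=> [m1 t1] [m2 t2]; split; [exact: measurable_funD|exact: tameD]. Qed.

Lemma goodB h g : good h -> good g -> good (fun x => h x - g x).
Proof. by move=> [m1 t1] [m2 t2]; split; [exact: measurable_funB|exact: tameB]. Qed.

Lemma goodZ c h : good h -> good (fun x => c * h x).
Proof. by move=> gh; apply: goodM => //; exact: good_cst. Qed.

Lemma good_sum I (s : seq I) (Q : pred I) (F : I -> fn) :
  (forall i, Q i -> good (F i)) -> good (fun x => \sum_(i <- s | Q i) F i x).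
Proof.
move=> tF; elim: s => [|i s IH].
  by under eq_fun do rewrite big_nil; exact: good_cst.
under eq_fun do rewrite big_cons.
by case: (boolP (Q i)) => Qi //; apply: goodD => //; exact: tF.
Qed.

Lemma good_prod I (s : seq I) (Q : pred I) (F : I -> fn) :
  (forall i, Q i -> good (F i)) -> good (fun x => \prod_(i <- s | Q i) F i x).
Proof.
move=> tF; elim: s => [|i s IH].
  by under eq_fun do rewrite big_nil; exact: good_cst.
under eq_fun do rewrite big_cons.
by case: (boolP (Q i)) => Qi //; apply: goodM => //; exact: tF.
Qed.

Lemma good_coord (f : R -> R) (i : 'I_n) : measurable_fun setT f ->
  tame P (fun w => f (X i w)) -> good (fun x => f (x i)).
Proof.
move=> mf tf; split=> //.
by apply: (measurableT_comp mf); exact: measurable_tnth.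
Qed.

Lemma goodX p h : good h -> good (fun x => h x ^+ p).
Proof.
move=> gh; elim: p => [|p IH]; first by under eq_fun do rewrite expr0; exact: good_cst.
by under eq_fun do rewrite exprS; exact: goodM.
Qed.

Lemma good_int h : good h -> P.-integrable setT (EFin \o (fun w => h (coords X w))).
Proof. by case=> _; exact: tame_integrable. Qed.

Lemma EXD h g : good h -> good g -> EX (fun x => h x + g x) = EX h + EX g.
Proof. by move=> [_ t1] [_ t2]; exact: ExD. Qed.

Lemma EXB h g : good h -> good g -> EX (fun x => h x - g x) = EX h - EX g.
Proof. by move=> [_ t1] [_ t2]; exact: ExB. Qed.

Lemma EXZ c h : good h -> EX (fun x => c * h x) = c * EX h.
Proof. by move=> [_ t1]; exact: ExZ. Qed.

Lemma EX_cst c : EX (fun=> c) = c.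
Proof. exact: Ex_cst. Qed.

Lemma EX_sum I (s : seq I) (Q : pred I) (F : I -> fn) :
  (forall i, Q i -> good (F i)) ->
  EX (fun x => \sum_(i <- s | Q i) F i x) = \sum_(i <- s | Q i) EX (F i).
Proof. by move=> gF; rewrite /EX Ex_sum// => i /gF []. Qed.

Lemma EX_le h g : good h -> good g -> (forall x, h x <= g x) -> EX h <= EX g.
Proof. by move=> [_ t1] [_ t2] hg; exact: Ex_le. Qed.

Lemma EX_ge0 h : (forall x, 0 <= h x) -> 0 <= EX h.
Proof. by move=> h0; exact: Ex_ge0. Qed.

Lemma eq_EX h g : h =1 g -> EX h = EX g.
Proof. by move=> hg; congr Ex; apply/funext => w; exact: hg. Qed.

(** From ab <= (a^2 + b^2) / 2. *)
Lemma EX_mul_le h g (K : R) : good h -> good g ->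
  EX (fun x => h x ^+ 2) <= K -> EX (fun x => g x ^+ 2) <= K ->
  `|EX (fun x => h x * g x)| <= K.
Proof.
move=> [_ t1] [_ t2] h2 g2; have t12 := tameM t1 t2.
apply: (le_trans (Ex_norm_le t12)); apply: (le_trans (Ex_young ltr01 t1 t2)).
rewrite invr1 !mul1r ler_pdivrMr//.
have := lerD h2 g2; rewrite /EX; lra.
Qed.

(** Convexity of the square, with the weights of the family itself. *)
Lemma EX_wsum_sqr_le (I : finType) (Q : pred I) (c : I -> R) (F : I -> fn) (K : R) :
  (forall i, Q i -> good (F i)) ->
  (forall i, Q i -> EX (fun x => F i x ^+ 2) <= K) ->
  EX (fun x => (\sum_(i | Q i) c i * F i x) ^+ 2) <= K * (\sum_(i | Q i) `|c i|) ^+ 2.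
Proof.
move=> gF FK.
have -> : EX (fun x => (\sum_(i | Q i) c i * F i x) ^+ 2) =
    \sum_(i | Q i) \sum_(j | Q j) c i * c j * EX (fun x => F i x * F j x).
  under eq_EX do rewrite expr2 big_distrlr/=.
  rewrite EX_sum => [|i Qi]; last first.
    by apply: good_sum => j Qj; apply: goodM; apply: goodZ; exact: gF.
  apply: eq_bigr => i Qi; rewrite EX_sum => [|j Qj]; last first.
    by apply: goodM; apply: goodZ; exact: gF.
  apply: eq_bigr => j Qj; rewrite -EXZ; last by apply: goodM; exact: gF.
  by apply: eq_EX => x; rewrite mulrACA.
rewrite mulrC expr2 big_distrlr/= mulr_suml; apply: ler_sum => i Qi.
rewrite mulr_suml; apply: ler_sum => j Qj.
apply: (le_trans (ler_norm _)); rewrite !normrM ler_wpM2l ?mulr_ge0//.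
by apply: EX_mul_le; [exact: gF|exact: gF|exact: FK|exact: FK].
Qed.

Hypothesis hindep : mutually_independent X.

Lemma EX_indep (f : R -> R) (j : 'I_n) g : measurable_fun setT f ->
  good (fun x => f (x j)) -> good g ->
  (forall x t, g (upd x j t) = g x) ->
  EX (fun x => f (x j) * g x) = EX (fun x => f (x j)) * EX g.
Proof.
move=> mf gf gg inv.
have [mh th] := goodM gf gg.
rewrite {1}/EX /Ex /Rintegral.
have [_ ->] := resample hindep j mh (tame_integrable th).
have fj : P.-integrable setT (EFin \o (f \o X j)).
  by apply: integrable_eqR (good_int gf) => // w _; rewrite /coords.
have mj : measurable_fun setT (X j) by [].
have ij : (distribution P (X j)).-integrable setT (EFin \o f).
  by apply/(law_transfer_integrable mj).
have Ej : (\int[distribution P (X j)]_t (f t)%:E = (EX (fun x => f (x j)))%:E)%E.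
  rewrite integral_distribution//; last exact/measurable_EFinP.
  by rewrite /EX /Ex /Rintegral fineK//; exact: integrable_fin_num.
under eq_integral => w _.
  under eq_integral => t _ do rewrite {1}/upd eqxx inv mulrC EFinM.
  rewrite integralZl// Ej -EFinM; over.
rewrite -[fine _]/(\int[P]_w (g (coords X w) * EX (fun x => f (x j)))).
rewrite RintegralZr//; last exact: good_int.
exact: mulrC.
Qed.

(** The factors are split off one at a time, each being independent of a function
    that does not involve its coordinate. *)
Lemma EX_indep_prod (A : {set 'I_n}) (f : 'I_n -> R -> R) g :
  (forall i, measurable_fun setT (f i)) ->
  (forall i, good (fun x => f i (x i))) -> good g ->
  (forall i x t, i \in A -> g (upd x i t) = g x) ->
  EX (fun x => \prod_(i in A) f i (x i) * g x) =
  \prod_(i in A) EX (fun x => f i (x i)) * EX g.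
Proof.
move=> mf gf; move: {2}#|A| (erefl #|A|) => k; elim: k A g => [|k IH] A g cA gg inv.
  rewrite (cards0_eq cA) big_set0 mul1r; apply: eq_EX => x.
  by rewrite big_set0 mul1r.
have [i iA] : exists i, i \in A by apply/set0Pn; rewrite -cards_eq0 cA.
have cA' : #|A :\ i| = k by move: cA; rewrite (cardsD1 i A) iA => -[].
rewrite (big_setD1 i iA)/=.
have -> : EX (fun x => \prod_(j in A) f j (x j) * g x) =
    EX (fun x => f i (x i) * (\prod_(j in A :\ i) f j (x j) * g x)).
  by apply: eq_EX => x; rewrite (big_setD1 i iA)/= mulrA.
rewrite EX_indep//.
- rewrite IH ?mulrA// => j x t; rewrite in_setD1 => /andP[_]; exact: inv.
- by apply: goodM => //; apply: good_prod.
- move=> x t; rewrite inv//; congr (_ * _); apply: eq_bigr => j.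
  by rewrite in_setD1 => /andP[/negbTE ji _]; rewrite /upd ji.
Qed.

Lemma EX_prod (A : {set 'I_n}) (f : 'I_n -> R -> R) :
  (forall i, measurable_fun setT (f i)) ->
  (forall i, good (fun x => f i (x i))) ->
  EX (fun x => \prod_(i in A) f i (x i)) = \prod_(i in A) EX (fun x => f i (x i)).
Proof.
move=> mf gf; have := @EX_indep_prod A f (fun=> 1) mf gf (good_cst 1).
by rewrite EX_cst mulr1 => <-//; apply: eq_EX => x; rewrite mulr1.
Qed.

Hypothesis hsym : forall i, symmetric_rv (X i).

Lemma EX_odd (j : 'I_n) h : good h -> (forall x, h (flip j x) = - h x) -> EX h = 0.
Proof.
move=> gh hN; have := flip_integrable hindep hsym j gh.1 (good_int gh).
have -> : \int[P]_w h (flip j (coords X w)) = - EX h.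
  rewrite /EX -ExN; last exact: gh.2.
  by apply: eq_Rintegral => w _; rewrite hN.
rewrite -/(Ex P (fun w => h (coords X w))) -/(EX h); move: (EX h) => z; lra.
Qed.

End Coordinates.

(** * Integration by parts in one coordinate *)

Section SteinCoordinate.
Context d (T : measurableType d) (R : realType) (P : probability T R).
Variables (X : nat -> {RV P >-> R}) (n : nat).
Notation fn := (('I_n -> R) -> R).
Hypothesis hindep : mutually_independent X.
Variables (tau : nat -> R -> R) (ctau : R).
Hypothesis mtau : forall i, measurable_fun setT (tau i).
Hypothesis btau : forall i x, `|tau i x| <= ctau.
Hypothesis ktau : forall i, is_stein_kernel (distribution P (X i)) (tau i).
Hypothesis tX : forall i, tame P (X i).

Lemma good_id (j : 'I_n) : good X (fun x => x j).
Proof. by apply: (@good_coord _ _ _ _ _ _ id) => //; exact: tX. Qed.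

Lemma good_tau (j : 'I_n) : good X (fun x => tau j (x j)).
Proof.
apply: good_coord => //; apply: (@tame_bounded _ _ _ _ _ ctau) => //.
exact: measurableT_comp.
Qed.

Let integrable_law (j : nat) (f : R -> R) : measurable_fun setT f ->
  tame P (fun w => f (X j w)) ->
  (distribution P (X j)).-integrable setT (EFin \o f).
Proof.
move=> mf tf; have mj : measurable_fun setT (X j) by [].
by apply/(law_transfer_integrable (p := distribution P (X j)) mj) => //; exact: tame_integrable.
Qed.

Lemma measurable_horner (q : {poly R}) : measurable_fun setT (fun t : R => q.[t]).
Proof. by apply: continuous_measurable_fun; exact: continuous_horner. Qed.

Let integrable_horner (j : nat) (q : {poly R}) :
  (distribution P (X j)).-integrable setT (EFin \o (fun t => q.[t])).
Proof.
apply: integrable_law; first exact: measurable_horner.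
under eq_fun do rewrite horner_coef.
by apply: tame_sum => i _; apply: tameZ; apply: tameX; exact: tX.
Qed.

(** The Stein identity for psi = id. *)
Lemma EX_tau (j : 'I_n) : EX X (fun x => tau j (x j)) = EX X (fun x => x j ^+ 2).
Proof.
have mj : measurable_fun setT (X j) by [].
have h := @ktau j id (fun=> 1) 1 (fun x => is_derive_id x 1) (fun x => cvg_cst _).
have mt1 : measurable_fun setT (fun x : R => tau j x * 1).
  by apply: measurable_funM => //; exact: mtau.
have mx : measurable_fun setT (fun x : R => x * id x) by exact: measurable_funM.
have [gt gx] := (good_tau j, goodM (good_id j) (good_id j)).
have <- : \int[distribution P (X j)]_x (tau j x * 1) = EX X (fun x => tau j (x j)).
  rewrite (law_transfer (p := distribution P (X j)) (m := P) mj (fun B _ => erefl) mt1).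
    by apply: eq_Rintegral => w _; rewrite mulr1.
  by apply: integrable_eqR (good_int gt) => // w _ /=; rewrite mulr1.
rewrite -h.
- rewrite (law_transfer (p := distribution P (X j)) (m := P) mj (fun B _ => erefl) mx).
    by apply: eq_Rintegral => w _; rewrite expr2.
  by apply: integrable_eqR (good_int gx).
- by move=> x; rewrite mul1r lerDr.
- exact: finite_measure_integrable_cst.
Qed.

(** Integration by parts in one coordinate.  The dependence of F on that
    coordinate is polynomial, with coefficients depending on the others. *)
Lemma EX_stein (j : 'I_n) (A F D : fn) (Q : ('I_n -> R) -> {poly R})
    (f df : R -> R) (c : R) :
  good X A -> good X F -> good X D ->
  (forall x t, A (upd x j t) = A x) ->
  (forall x t, F (upd x j t) = (Q x).[t]) ->
  (forall x t, D (upd x j t) = ((Q x)^`()).[t]) ->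
  (forall x : R, is_derive x 1 f (df x)) -> continuous df ->
  (forall x, `|f x| <= c) -> (forall x, `|df x| <= c) ->
  EX X (fun x => x j * (A x * f (F x))) =
  EX X (fun x => tau j (x j) * (A x * (df (F x) * D x))).
Proof.
move=> gA gF gD invA FQ DQ Df cdf fc dfc.
have cf : continuous f by move=> x; exact: is_derive_continuous (Df x).
have mf : measurable_fun setT f by exact: continuous_measurable_fun.
have mdf : measurable_fun setT df by exact: continuous_measurable_fun.
have c0 : 0 <= c by apply: le_trans (fc 0).
have gcomp (g : R -> R) : measurable_fun setT g -> (forall x, `|g x| <= c) ->
    good X (fun x => g (F x)).
  move=> mg gc; split; first by apply: (measurableT_comp mg); exact: gF.1.
  apply: (@tame_bounded _ _ _ _ _ c) => //.
  by apply: (measurableT_comp mg); exact: tame_measurable gF.2.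
have g1 : good X (fun x => x j * (A x * f (F x))).
  by apply: goodM; [exact: good_id|apply: goodM => //; exact: gcomp].
have g2 : good X (fun x => tau j (x j) * (A x * (df (F x) * D x))).
  by apply: goodM; [exact: good_tau|apply: goodM => //; apply: goodM => //; exact: gcomp].
rewrite /EX /Ex /Rintegral; congr fine.
rewrite (resample hindep j g1.1 (good_int g1)).2.
rewrite (resample hindep j g2.1 (good_int g2)).2.
apply: eq_integral => w _; set x := coords X w.
pose psi t := f (Q x).[t].
pose dpsi t := df (Q x).[t] * ((Q x)^`()).[t].
have mQ := measurable_horner (Q x).
have mpsi : measurable_fun setT psi by exact: (measurableT_comp mf).
have mdpsi : measurable_fun setT dpsi.
  apply: measurable_funM; first exact: (measurableT_comp mdf).
  exact: measurable_horner.
have Dpsi (t : R) : is_derive t 1 psi (dpsi t).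
  exact: (is_derive1_comp (Df (Q x).[t]) (is_derive_poly (Q x) t)).
have cdpsi : continuous dpsi.
  move=> t; apply: cvgM; last exact: continuous_horner.
  by apply: continuous_comp; [exact: continuous_horner|exact: cdf].
have psic t : `|psi t| <= c * (1 + `|t|).
  by apply: (le_trans (fc _)); rewrite ler_peMr// lerDl.
have i2 : (distribution P (X j)).-integrable setT (EFin \o dpsi).
  have := integrable_mulb measurableT (measurableT_comp mdf mQ) (fun t _ => dfc (Q x).[t])
    (integrable_horner j ((Q x)^`())).
  by apply: integrable_eqR => // t _; rewrite /= mulrC.
have i1 : (distribution P (X j)).-integrable setT (EFin \o (fun t => t * psi t)).
  have it : (distribution P (X j)).-integrable setT (EFin \o (fun t : R => t)).
    by apply: integrable_law => //; exact: tX.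
  by apply: integrable_mulb it => // t _; exact: fc.
have i3 : (distribution P (X j)).-integrable setT (EFin \o (fun t => tau j t * dpsi t)).
  have := integrable_mulb measurableT (mtau j) (fun t _ => btau j t) i2.
  by apply: integrable_eqR => // t _; rewrite mulrC.
have := ktau Dpsi cdpsi psic i2.
rewrite /Rintegral => /(congr1 (fun r => (A x * r)%:E)).
rewrite !EFinM !fineK; [|exact: integrable_fin_num i3|exact: integrable_fin_num i1].
rewrite -(integralZl measurableT i1 (A x)) -(integralZl measurableT i3 (A x)).
move=> E; transitivity (\int[distribution P (X j)]_t ((A x)%:E * (t * psi t)%:E))%E.
  by apply: eq_integral => t _; rewrite invA FQ {1}/upd eqxx -EFinM mulrCA.
rewrite E; apply: eq_integral => t _.
by rewrite invA FQ DQ {1}/upd eqxx -EFinM mulrCA.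
Qed.

End SteinCoordinate.

(** * Sums over tuples of indices with a prescribed sum *)

Section IndexSums.
Local Close Scope classical_set_scope.
Variable n : nat.
Notation Z := 'I_n.+1.
Implicit Types (s i j : Z) (O : {set Z}).

(** Effect on the set of indices with odd multiplicity of adding i to a tuple. *)
Definition tog i O : {set Z} := if i \in O then O :\ i else i |: O.

Lemma in_tog i j O : (j \in tog i O) = (j == i) (+) (j \in O).
Proof.
rewrite /tog; case: ifP => iO; rewrite !inE; case: (eqVneq j i) => [->|] //=.
  by rewrite iO.
by rewrite iO.
Qed.

Lemma togK i : involutive (tog i).
Proof. by move=> O; apply/setP => j; rewrite !in_tog addbA addbb. Qed.

Lemma card_tog i O : #|tog i O| = if i \in O then #|O|.-1 else #|O|.+1.
Proof.
rewrite /tog; case: ifP => iO; last by rewrite cardsU1 iO.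
by rewrite (cardsD1 i O) iO.
Qed.

Section Ring.
Variables (A : comNzRingType) (y : Z -> A).

(** Sum over all k-tuples of indices with sum s of the product of the
    corresponding entries of y. *)
Fixpoint wsum (k : nat) (s : Z) : A :=
  if k is k'.+1 then \sum_i y i * wsum k' (s - i) else (s == 0)%:R.

(** The part of [wsum] given by the tuples in which the indices occurring an
    odd number of times are the elements of O. *)
Fixpoint osum (k : nat) (O : {set Z}) (s : Z) : A :=
  if k is k'.+1 then \sum_i y i * osum k' (tog i O) (s - i)
  else ((O == finset.set0) && (s == 0))%:R.

Lemma wsum_osum k s : wsum k s = \sum_O osum k O s.
Proof.
elim: k s => [|k IH] s /=.
  rewrite (bigD1 finset.set0)//= eqxx big1 ?addr0// => O /negbTE -> //.
rewrite exchange_big/=; apply: eq_bigr => i _; rewrite IH mulr_sumr.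
by rewrite (reindex_inj (inv_inj (togK i))).
Qed.

(** Each index of odd multiplicity occurs at least once. *)
Lemma osum_gt k O s : (k < #|O|)%N -> osum k O s = 0.
Proof.
elim: k O s => [|k IH] O s kO /=.
  by case: eqP kO => [->|//]; rewrite cards0.
rewrite big1 // => i _; rewrite IH ?mulr0// card_tog; case: ifP => _ //.
  by case: #|O| kO.
exact: (leq_trans (ltnW kO)).
Qed.

(** A tuple of length |O| in which the elements of O occur is an ordering of O. *)
Lemma osum_eq k O s : #|O| = k ->
  osum k O s = (k`! * (\sum_(i in O) i == s))%:R * \prod_(i in O) y i.
Proof.
elim: k O s => [|k IH] O s cO /=.
  by rewrite (cards0_eq cO) !big_set0 eqxx/= mulr1 fact0 mul1n eq_sym.
rewrite (bigID (mem O))/= [X in _ + X]big1 ?addr0; last first.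
  by move=> i iO; rewrite osum_gt ?mulr0// card_tog (negbTE iO) cO.
have E i : i \in O -> y i * osum k (tog i O) (s - i) =
    (k`! * (\sum_(j in O) j == s))%:R * \prod_(j in O) y j.
  move=> iO; rewrite IH; last by rewrite card_tog iO cO.
  rewrite mulrCA /tog iO (big_setD1 i iO)/= [X in _ = _ * X](big_setD1 i iO)/=.
  by rewrite addrC eq_sym subr_eq eq_sym.
rewrite (eq_bigr _ E) sumr_const cO -mulrnAl -mulrnA factS.
by rewrite mulnC mulnA.
Qed.

End Ring.

Lemma eq_wsum (A : comNzRingType) (y z : Z -> A) k s : y =1 z ->
  wsum y k s = wsum z k s.
Proof.
by move=> yz; elim: k s => //= k IH s; apply: eq_bigr => i _; rewrite yz IH.
Qed.

Lemma wsumZ (A : comNzRingType) (y : Z -> A) c k s :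
  wsum (fun i => c * y i) k s = c ^+ k * wsum y k s.
Proof.
elim: k s => [|k IH] s /=; first by rewrite expr0 mul1r.
by rewrite mulr_sumr; apply: eq_bigr => i _; rewrite IH exprS mulrACA.
Qed.

Lemma wsum_rmorph (A B : comNzRingType) (f : {rmorphism A -> B}) (y : Z -> A) k s :
  f (wsum y k s) = wsum (f \o y) k s.
Proof.
elim: k s => [|k IH] s /=; first by rewrite rmorph_nat.
by rewrite rmorph_sum; apply: eq_bigr => i _; rewrite rmorphM IH.
Qed.

Lemma wsum_const (A : comNzRingType) k s :
  wsum (fun=> 1 : A) k.+1 s = (n.+1 ^ k)%:R.
Proof.
elim: k s => [|k IH] s.
  rewrite /= (bigD1 s)//= subrr eqxx mul1r big1 ?addr0// => i /negbTE is_.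
  by rewrite mul1r subr_eq0 eq_sym is_.
rewrite -[wsum _ _ _]/(\sum_i 1 * wsum (fun=> 1 : A) k.+1 (s - i)).
under eq_bigr do rewrite IH mul1r.
by rewrite sumr_const card_ord expnSr mulrnA.
Qed.

(** The vector x with an indeterminate as j-th entry, which makes sums over
    tuples polynomials in that entry. *)
Definition poly_at (R : comNzRingType) (x : Z -> R) (j : Z) : Z -> {poly R} :=
  upd (fun i => (x i)%:P) j 'X.

Lemma wsum_poly_at (R : comNzRingType) (x : Z -> R) j t k s :
  (wsum (poly_at x j) k s).[t] = wsum (upd x j t) k s.
Proof.
rewrite -[_.[t]]/(horner_eval t _) wsum_rmorph; apply: eq_wsum => i /=.
by rewrite /poly_at /upd /horner_eval; case: eqP => _; rewrite ?hornerX ?hornerC.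
Qed.

(** By symmetry, the k positions of j in a tuple contribute equally. *)
Lemma deriv_wsum_poly_at (R : comNzRingType) (x : Z -> R) j k s :
  (wsum (poly_at x j) k s)^`() = (wsum (poly_at x j) k.-1 (s - j)) *+ k.
Proof.
elim: k s => [|k IH] s; first by rewrite /= mulr0n; case: eqP => _; rewrite derivC.
rewrite /= raddf_sum.
have E i : (poly_at x j i * wsum (poly_at x j) k (s - i))^`() =
   (i == j)%:R * wsum (poly_at x j) k (s - j) +
   (poly_at x j i * wsum (poly_at x j) k.-1 (s - j - i)) *+ k.
  rewrite derivM IH /poly_at /upd; case: eqP => [->|_].
    by rewrite derivX mulrnAr.
  by rewrite derivC !mul0r !add0r mulrnAr addrAC.
rewrite (eq_bigr _ (fun i _ => E i)) big_split/= -mulr_suml sumrMnl.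
have -> : \sum_i ((i == j)%:R : {poly R}) = 1.
  by rewrite (bigD1 j)//= eqxx big1 ?addr0// => i /negbTE ->.
rewrite mul1r mulrS; congr (_ + _).
by case: k {IH E} => [|k]; rewrite ?mulr0n.
Qed.

Lemma osum_flip (R : comNzRingType) (x : Z -> R) j k O s :
  osum (upd x j (- x j)) k O s = (-1) ^+ (j \in O) * osum x k O s.
Proof.
elim: k O s => [|k IH] O s /=.
  by case: eqP => [->|_]; rewrite ?mulr0// inE expr0 mul1r.
rewrite mulr_sumr; apply: eq_bigr => i _; rewrite IH in_tog /upd.
case: (eqVneq i j) => [->|ij] /=; last by rewrite mulrCA.
by case: (j \in O); rewrite /= ?expr0 ?expr1 ?mul1r ?mulN1r ?mulrN ?mulNr ?opprK.
Qed.

(** As integers, x + x is congruent to c, and lies in one of two ranges of length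
    n + 1; each of them determines x. *)
Lemma card_double_le2 (c : Z) : (#|[set x : Z | (x + x)%R == c]%SET| <= 2)%N.
Proof.
pose g (x : Z) : bool := (val x + val x < n.+1)%N.
have inj : {in [set x : Z | (x + x)%R == c]%SET &, injective g}.
  move=> x z; rewrite !inE => /eqP xc /eqP zc gxz.
  have : val (x + x)%R = val (z + z)%R by rewrite xc zc.
  rewrite /= => h; apply: val_inj => /=; move: gxz h; rewrite /g /=.
  have := ltn_ord x; have := ltn_ord z; move: (nat_of_ord x) (nat_of_ord z) => a b bn an.
  case: ltnP => ha; case: ltnP => hb // _.
    rewrite !modn_small// => /eqP; rewrite !addnn => /eqP; exact: double_inj.
  have e (m : nat) : (n.+1 <= m + m)%N -> (m < n.+1)%N -> ((m + m) %% n.+1)%N = (m + m - n.+1)%N.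
    move=> h1 h2; rewrite -{1}(subnK h1) modnDr modn_small//.
    by rewrite ltn_subLR//; lia.
  by rewrite !e//; lia.
by rewrite -(card_in_imset inj); apply: leq_trans (max_card _) _; rewrite card_bool.
Qed.

End IndexSums.

(** * Counting tuples and sets with a prescribed sum *)

Lemma bin_le_expn n k : ('C(n, k) <= n ^ k)%N.
Proof.
elim: n k => [|n IH] [|k]; rewrite ?bin0 ?bin0n ?expn0 ?exp0n//.
rewrite binS; apply: leq_trans (leq_add (IH _) (IH _)) _.
rewrite expnS -[X in (_ + X <= _)%N]mul1n -mulnDl addn1 [X in (_ <= X)%N]expnS.
by rewrite leq_mul2l/=; case: k => // k; rewrite leq_exp2r ?leqnSn.
Qed.

Lemma sum_by_rank (R : nmodType) (I : finType) (f : I -> nat) (Q : pred I)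
    (g : I -> R) k :
  (\sum_(i | Q i && (f i < k)%N) g i =
  \sum_(o < k) \sum_(i | Q i && (f i == o)) g i)%R.
Proof.
elim: k => [|k IH]; first by rewrite big_ord0 big_pred0// => i; rewrite ltn0 andbF.
rewrite big_ord_recr/= -IH (bigID (fun i => (f i < k)%N))/=; congr (_ + _).
  by apply: eq_bigl => i; rewrite -andbA; congr (_ && _); lia.
by apply: eq_bigl => i; rewrite -andbA; congr (_ && _); lia.
Qed.

Section SetCounting.
Local Close Scope classical_set_scope.
Variable R : realType.

Definition nset (n k : nat) (c : 'I_n.+1) : nat :=
  #|[set S : {set 'I_n.+1} | (#|S| == k) && ((\sum_(i in S) i)%R == c)]%SET|.

(** The number of tuples of length k and sum s in which the indices of odd
    multiplicity are the elements of O. *)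
Definition cnt (n : nat) k (O : {set 'I_n.+1}) s : R := osum (fun=> 1) k O s.

(** The normalization of the matrix; counts are expressed as powers of it, so
    that odd powers are available. *)
Definition rt (n : nat) : R := Num.sqrt n.+1%:R.

Lemma rt_ge1 n : 1 <= rt n.
Proof. by rewrite -sqrtr1 ler_sqrt// ler1n. Qed.

Lemma rt_gt0 n : 0 < rt n. Proof. exact: lt_le_trans ltr01 (rt_ge1 n). Qed.

Lemma rt_neq0 n : rt n != 0. Proof. by rewrite gt_eqF// rt_gt0. Qed.

Lemma rt_sqr n : rt n ^+ 2 = n.+1%:R.
Proof. by rewrite sqr_sqrtr. Qed.

Arguments cnt : simpl never.

Lemma cnt_ge0 n k (O : {set 'I_n.+1}) s : 0 <= cnt k O s.
Proof.
rewrite /cnt; elim: k O s => [|k IH] O s /=; first exact: ler0n.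
by apply: sumr_ge0 => i _; rewrite mul1r.
Qed.

Lemma cnt_eq n k (O : {set 'I_n.+1}) s : #|O| = k ->
  cnt k O s = (k`! * ((\sum_(i in O) i)%R == s))%:R.
Proof. by move=> cO; rewrite /cnt osum_eq// [X in _ * X]big1 ?mulr1. Qed.

Lemma sum_cnt n k (s : 'I_n.+1) : \sum_(O : {set 'I_n.+1}) cnt k.+1 O s = rt n ^+ (2 * k).
Proof. by rewrite -wsum_osum wsum_const exprM rt_sqr natrX. Qed.

Lemma sum_cnt_card n k (s : 'I_n.+1) :
  \sum_(O : {set 'I_n.+1} | #|O| == k) cnt k O s = (k`! * nset k s)%:R.
Proof.
under eq_bigr => O /eqP cO do rewrite cnt_eq//.
rewrite -natr_sum -big_distrr/=; congr ((_ * _)%:R).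
rewrite /nset -sum1dep_card [RHS]big_mkcondr/=.
by apply: eq_bigr => O _; case: eqP.
Qed.

Lemma nset_le n k (s : 'I_n.+1) : (nset k.+1 s)%:R <= rt n ^+ (2 * k).
Proof.
rewrite -(sum_cnt k s) (bigID (fun O : {set 'I_n.+1} => #|O| == k.+1))/=.
rewrite sum_cnt_card natrM -[leLHS]addr0 lerD//; last first.
  by apply: sumr_ge0 => O _; exact: (cnt_ge0 k.+1).
by rewrite ler_peMl// ler1n fact_gt0.
Qed.

Lemma card_sets_le n k : (#|[set O : {set 'I_n.+1} | #|O| == k]%SET|)%:R <= rt n ^+ (2 * k).
Proof.
rewrite card_draws card_ord exprM rt_sqr -natrX ler_nat; exact: bin_le_expn.
Qed.

(** The elements of O being fixed, the (k - |O|) / 2 repeated pairs are free except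
    for one condition, the sum: there are about N^((k - |O|)/2 - 1) choices.  In the
    induction, the first entry either belongs to O or does not; in the second case
    it is free unless it leaves a tuple of distinct entries, where the sum leaves
    it at most two values. *)
Lemma cnt_le k : exists2 C : R, 0 <= C & forall n (O : {set 'I_n.+1}) s,
  (#|O| < k)%N -> cnt k O s * rt n ^+ #|O|.+2 <= C * rt n ^+ k.
Proof.
elim: k => [|k [C C0 IH]]; first by exists 0.
exists (k.+1%:R * C + C + 2 * k`!%:R).
  by rewrite !addr_ge0 ?mulr_ge0.
move=> n O s; rewrite ltnS => Ok.
have r0 := rt_gt0 n; have r1 := rt_ge1 n.
have -> : cnt k.+1 O s = \sum_(i in O) cnt k (tog i O) (s - i) +
    \sum_(i | i \notin O) cnt k (tog i O) (s - i).
  rewrite /cnt/= (bigID (mem O))/=.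
  by congr (_ + _); apply: eq_bigr => i _; rewrite mul1r.
have hA : (\sum_(i in O) cnt k (tog i O) (s - i)) * rt n ^+ #|O|.+2 <=
    k.+1%:R * C * rt n ^+ k.+1.
  have [z0|O0] := posnP #|O|.
    by rewrite (cards0_eq z0) big_set0 mul0r !mulr_ge0// exprn_ge0// ltW.
  apply: (@le_trans _ _ (\sum_(i in O) C * rt n ^+ k.+1)).
    rewrite mulr_suml; apply: ler_sum => i iO.
    have ct : #|tog i O|.+1 = #|O| by rewrite card_tog iO prednK.
    have h : (#|tog i O| < k)%N by rewrite ct.
    have := IH n (tog i O) (s - i) h.
    by rewrite ct => /(ler_wpM2r (ltW r0)); rewrite -!mulrA -!exprSr.
  rewrite sumr_const -[leLHS]mulr_natl mulrA ler_wpM2r ?exprn_ge0 ?(ltW r0)//.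
  by rewrite ler_wpM2r// ler_nat (leq_trans Ok).
have hB : (\sum_(i | i \notin O) cnt k (tog i O) (s - i)) * rt n ^+ #|O|.+2 <=
    (C + 2 * k`!%:R) * rt n ^+ k.+1.
  have [k1|k1] := ltnP #|O|.+1 k.
    apply: (@le_trans _ _ (C * rt n ^+ k.+1)); last first.
      by rewrite ler_wpM2r ?exprn_ge0 ?(ltW r0)// lerDl mulr_ge0.
    rewrite -(ler_pM2r r0) -[leLHS]mulrA -exprSr mulr_suml.
    apply: (@le_trans _ _ (\sum_(i : 'I_n.+1) C * rt n ^+ k)).
      rewrite [leRHS](bigID (mem O))/= -[leLHS]add0r lerD//.
        by apply: sumr_ge0 => i _; rewrite mulr_ge0// exprn_ge0// ltW.
      apply: ler_sum => i iO.
      have ct : #|tog i O| = #|O|.+1 by rewrite card_tog (negbTE iO).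
      by have := IH n (tog i O) (s - i); rewrite ct; apply.
    rewrite sumr_const card_ord -[leLHS]mulr_natl -rt_sqr le_eqVlt.
    by apply/orP; left; apply/eqP; rewrite [rt n ^+ k.+1]exprS; ring.
  have {Ok k1}[kO|kO] : #|O|.+1 = k \/ #|O| = k by lia.
    apply: (@le_trans _ _ ((2 * k`!%:R) * rt n ^+ k.+1)); last first.
      by rewrite ler_wpM2r ?exprn_ge0 ?(ltW r0)// lerDr.
    rewrite -kO ler_wpM2r ?exprn_ge0 ?(ltW r0)// kO.
    under eq_bigr => i iO.
      rewrite cnt_eq ?card_tog ?(negbTE iO)//.
      rewrite /tog (negbTE iO) big_setU1//= natrM; over.
    rewrite -mulr_sumr mulrC ler_wpM2r//.
    pose m2 := (\sum_(i : 'I_n.+1) ((i + \sum_(j in O) j) == s - i)%R : nat)%N.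
    apply: (@le_trans _ _ m2%:R).
      rewrite natr_sum [leRHS](bigID (mem O))/= -[leLHS]add0r lerD//.
      by apply: sumr_ge0.
    rewrite ler_nat /m2; apply: leq_trans (card_double_le2 (s - \sum_(j in O) j)).
    rewrite -sum1dep_card [leqRHS]big_mkcond/=; apply: leq_sum => i _.
    by rewrite eq_sym subr_eq addrAC -subr_eq eq_sym; case: eqP.
  rewrite big1 ?mul0r; last first.
    by move=> i iO; rewrite /cnt osum_gt// card_tog (negbTE iO) kO.
  by rewrite mulr_ge0 ?exprn_ge0 ?(ltW r0)// addr_ge0 ?mulr_ge0.
by rewrite mulrDl -addrA [leRHS]mulrDl lerD.
Qed.

(** Sets are counted by their trace on D; the sum condition fixes one of the u + 1
    elements outside D. *)
Lemma card_setD_le n (D : {set 'I_n.+1}) u :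
  (#|[set S : {set 'I_n.+1} | ((\sum_(i in S) i)%R == 0) && (#|S :\: D| == u.+1)]%SET|)%:R
  <= 2 ^+ #|D| * rt n ^+ (2 * u).
Proof.
pose Q (S : {set 'I_n.+1}) := ((\sum_(i in S) i)%R == 0 :> 'I_n.+1) && (#|S :\: D| == u.+1).
rewrite (_ : [set S | _]%SET = [set S | Q S]%SET)// -sum1dep_card.
rewrite (partition_big (fun S : {set 'I_n.+1} => S :&: D) (mem (powerset D)))/=; last first.
  by move=> S _; rewrite powersetE subsetIr.
rewrite -natrX -(card_powerset D) -sum1_card natr_sum natr_sum mulr_suml.
apply: ler_sum => D1 _; rewrite mul1r.
apply: le_trans (nset_le u (- \sum_(i in D1) i)); rewrite ler_nat.
rewrite sum1dep_card /nset.
have inj : {in [set S | Q S && (S :&: D == D1)]%SET &, injective (fun S : {set 'I_n.+1} => S :\: D)}.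
  move=> S S'; rewrite !inE => /andP[_ /eqP h] /andP[_ /eqP h'] e.
  by rewrite -(setID S D) -(setID S' D) h h' e.
rewrite -(card_in_imset inj); apply: subset_leq_card; apply/fintype.subsetP => _ /imsetP[S + ->].
rewrite !inE => /andP[/andP[/eqP s0 ->] /eqP SD]/=.
by move: s0; rewrite (big_setID D)/= SD addrC => /eqP; rewrite addr_eq0.
Qed.

(** The weight compensates a free choice of every element outside D, and the sum
    condition gains one factor N = r^2. *)
Lemma sum_setD_le n (D : {set 'I_n.+1}) d :
  \sum_(S : {set 'I_n.+1} | ((\sum_(i in S) i)%R == 0) && (0 < #|S :\: D| < d.+1)%N)
    (rt n ^+ (2 * #|S :\: D|))^-1 <= d%:R * 2 ^+ #|D| / rt n ^+ 2.
Proof.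
have r0 := rt_gt0 n.
under eq_bigl => S do rewrite andbA.
rewrite sum_by_rank big_ord_recl/= big_pred0 ?add0r; last first.
  by move=> S /=; lia.
apply: (@le_trans _ _ (\sum_(u < d) 2 ^+ #|D| / rt n ^+ 2)); last first.
  by rewrite sumr_const card_ord -[leLHS]mulr_natl mulrA.
apply: ler_sum => u _.
under eq_bigr => S /andP[_ /eqP ->] do rewrite /bump/= add1n.
rewrite sumr_const -[leLHS]mulr_natl.
apply: (@le_trans _ _ (2 ^+ #|D| * rt n ^+ (2 * u) / rt n ^+ (2 * u.+1))).
  rewrite ler_wpM2r ?invr_ge0 ?exprn_ge0 ?(ltW r0)//.
  apply: le_trans (card_setD_le D u); rewrite ler_nat; apply: subset_leq_card.
  apply/fintype.subsetP => S; rewrite !inE /bump/= add1n.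
  by move=> /andP[/andP[-> _] ->].
by rewrite mulnS exprD -mulf_div divff ?mulr1// expf_neq0// gt_eqF.
Qed.

Lemma sum_sets_le n o (g : {set 'I_n.+1} -> R) (c : R) : 0 <= c ->
  (forall O : {set 'I_n.+1}, #|O| = o -> g O <= c) ->
  \sum_(O : {set 'I_n.+1} | #|O| == o) g O <= rt n ^+ (2 * o) * c.
Proof.
move=> c0 gc; apply: (@le_trans _ _ (\sum_(O : {set 'I_n.+1} | #|O| == o) c)).
  by apply: ler_sum => O /eqP; exact: gc.
rewrite sumr_const -[leLHS]mulr_natl ler_wpM2r//.
by apply: le_trans (card_sets_le n o); rewrite ler_nat cardsE.
Qed.

(** There are at most r^(2 |O|) sets O of a given size, and the square of the bound
    of [cnt_le] is smaller than r^(2k-4) by that factor. *)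
Lemma sum_cnt_lt k : exists2 C : R, 0 <= C & forall n (s : 'I_n.+1),
  (\sum_(O : {set 'I_n.+1} | (#|O| < k)%N) cnt k O s ^+ 2) * rt n ^+ 4 <= C * rt n ^+ (2 * k).
Proof.
have [C C0 cC] := cnt_le k; exists (k%:R * C ^+ 2).
  by rewrite mulr_ge0 ?sqr_ge0.
move=> n s; have r0 := rt_gt0 n.
rewrite -[X in X * _]/(\sum_(O : {set 'I_n.+1} | xpredT O && (#|O| < k)%N) cnt k O s ^+ 2).
rewrite sum_by_rank mulr_suml.
apply: (@le_trans _ _ (\sum_(o < k) C ^+ 2 * rt n ^+ (2 * k))); last first.
  by rewrite sumr_const card_ord -[leLHS]mulr_natl mulrA.
apply: ler_sum => o _; rewrite mulr_suml.
have -> : C ^+ 2 * rt n ^+ (2 * k) =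
    rt n ^+ (2 * o) * (C ^+ 2 * rt n ^+ (2 * k) / rt n ^+ (2 * o)).
  by rewrite mulrCA divff ?mulr1// expf_neq0// gt_eqF.
apply: sum_sets_le.
  by rewrite mulr_ge0 ?invr_ge0 ?mulr_ge0 ?sqr_ge0// exprn_ge0// ltW.
move=> O cO; rewrite ler_pdivlMr ?exprn_gt0//.
have Ok : (#|O| < k)%N by rewrite cO.
have h := cC n O s Ok; have h0 := mulr_ge0 (cnt_ge0 k O s) (exprn_ge0 #|O|.+2 (ltW r0)).
have := ler_pM h0 h0 h h; rewrite cO -(addn2 o).
have -> : rt n ^+ (2 * k) = rt n ^+ k * rt n ^+ k by rewrite -exprD addnn mul2n.
have E : rt n ^+ (o + 2) * rt n ^+ (o + 2) = rt n ^+ 4 * rt n ^+ (2 * o).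
  by rewrite -!exprD; congr (_ ^+ _); lia.
rewrite -[X in _ -> X <= _]mulrA -E.
move: (rt n ^+ (o + 2)) (rt n ^+ k) (cnt k O s) => x y z; lra.
Qed.

(** All tuples of length k + 1 and sum 0, of which there are N^k, except those with
    a repetition, of which there are O(r^(2k-1)). *)
Lemma nset_ge k : exists2 C : R, 0 <= C & forall n,
  rt n ^+ (2 * k.+1) <= (k.+1`!%:R * (nset k.+1 (0 : 'I_n.+1))%:R) * rt n ^+ 2 +
    C * rt n ^+ (2 * k).+1.
Proof.
have [C C0 cC] := cnt_le k.+1; exists (k.+1%:R * C).
  by rewrite mulr_ge0.
move=> n; have r0 := rt_gt0 n; have r1 := rt_ge1 n.
rewrite mulnS addnC exprD -(sum_cnt k 0).
rewrite (bigID (fun O : {set 'I_n.+1} => #|O| == k.+1))/= sum_cnt_card natrM mulrDl lerD2l.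
rewrite (bigID (fun O : {set 'I_n.+1} => (#|O| < k.+1)%N))/= [X in _ + X]big1 ?addr0; last first.
  move=> O /andP[h1]; rewrite -leqNgt leq_eqVlt eq_sym (negbTE h1)/= => h2.
  by rewrite /cnt osum_gt.
under eq_bigl => O do rewrite andbC -[(_ < _)%N && _]/(xpredT O && _).
have -> : \sum_(O : {set 'I_n.+1} | (#|O| < k.+1)%N && (#|O| != k.+1)) cnt k.+1 O 0 =
    \sum_(O : {set 'I_n.+1} | xpredT O && (#|O| < k.+1)%N) cnt k.+1 O 0.
  by apply: eq_bigl => O /=; case: ltngtP.
rewrite sum_by_rank mulr_suml.
apply: (@le_trans _ _ (\sum_(o < k.+1) C * rt n ^+ (2 * k).+1)); last first.
  by rewrite sumr_const card_ord -[leLHS]mulr_natl mulrA.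
apply: ler_sum => o _; rewrite mulr_suml.
apply: (@le_trans _ _ (rt n ^+ (2 * o) * (C * rt n ^+ k.+1 / rt n ^+ o))).
  apply: sum_sets_le.
    by rewrite mulr_ge0 ?invr_ge0 ?mulr_ge0// exprn_ge0// ltW.
  move=> O cO; rewrite ler_pdivlMr ?exprn_gt0//.
  have Ok : (#|O| < k.+1)%N by rewrite cO.
  by have := cC n O 0 Ok; rewrite cO -mulrA -exprD.
rewrite -(mulrA C) (mulrCA _ C) ler_wpM2l// mul2n -addnn exprD.
have -> : rt n ^+ o * rt n ^+ o * (rt n ^+ k.+1 / rt n ^+ o) = rt n ^+ (o + k.+1).
  by rewrite exprD mulrA mulrAC -[rt n ^+ o * _ * _]mulrA divff ?mulr1// expf_neq0// gt_eqF.
by rewrite ler_weXn2l//; have := ltn_ord o; lia.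
Qed.

End SetCounting.

(** * Orthogonality of parity classes *)

Section OsumMoments.
Local Close Scope classical_set_scope.
Context d (T : measurableType d) (R : realType) (P : probability T R).
Variable X : nat -> {RV P >-> R}.

Section Squares.
Variable n : nat.
Notation fn := (('I_n -> R) -> R).
Implicit Types h g : fn.

(** Cauchy-Schwarz, by Young's inequality with the weight b / a. *)
Lemma EX_cs h g (K a b : R) : good X h -> good X g -> 0 <= a -> 0 <= b ->
  EX X (fun x => h x ^+ 2) <= K * a ^+ 2 -> EX X (fun x => g x ^+ 2) <= K * b ^+ 2 ->
  `|EX X (fun x => h x * g x)| <= K * (a * b).
Proof.
move=> gh gg a0 b0 ha hb; have [_ th] := gh; have [_ tg] := gg.
apply: (le_trans (Ex_norm_le (tameM th tg))).
have yg l (l0 : 0 < l) := Ex_young l0 th tg.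
have zero (u v z : R) : u <= 0 -> (forall l : R, 0 < l -> z <= (l * u + l^-1 * v) / 2) ->
    0 <= v -> z <= 0.
  move=> u0 hz v0; rewrite leNgt; apply/negP => z0.
  have l0 : 0 < (v + 1) / z by rewrite divr_gt0// ltr_wpDl.
  have := hz _ l0; rewrite invf_div => hl.
  have h1 : (v + 1) / z * u <= 0 by rewrite mulr_ge0_le0// ltW.
  have h2 : z / (v + 1) * v <= z.
    by rewrite mulrAC ler_pdivrMr ?ltr_wpDl// ler_wpM2l ?(ltW z0)// lerDl.
  lra.
have H0 f : 0 <= EX X (fun x : 'I_n -> R => f x ^+ 2) by apply: EX_ge0 => x; exact: sqr_ge0.
have [a00|an0] := eqVneq a 0.
  rewrite a00 mul0r mulr0; apply: (zero _ _ _ _ yg (H0 g)).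
  by move: ha; rewrite a00 expr0n mulr0.
have [b00|bn0] := eqVneq b 0.
  rewrite b00 !mulr0; apply: (zero (EX X (fun x => g x ^+ 2)) (EX X (fun x => h x ^+ 2))).
  - by move: hb; rewrite b00 expr0n mulr0.
  - move=> l l0; have := yg l^-1; rewrite invr_gt0 invrK => /(_ l0).
    by rewrite [X in _ <= X / 2]addrC.
  - exact: H0.
have ap : 0 < a by rewrite lt_neqAle eq_sym an0.
have bp : 0 < b by rewrite lt_neqAle eq_sym bn0.
have l0 : 0 < b / a by rewrite divr_gt0.
apply: (le_trans (yg _ l0)); rewrite ler_pdivrMr// invf_div.
have e1 : b / a * (K * a ^+ 2) = K * (a * b) by field.
have e2 : a / b * (K * b ^+ 2) = K * (a * b) by field.
have := ler_wpM2l (ltW l0) ha; rewrite e1 => h1.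
have l1 : 0 < a / b by rewrite divr_gt0.
have := ler_wpM2l (ltW l1) hb; rewrite e2 => h2.
move: h1 h2; rewrite /EX; lra.
Qed.

Lemma EX_sum_sqr_le (I : finType) (Q : pred I) (c : I -> R) (F : I -> fn) (K : R) :
  (forall i, Q i -> good X (F i)) -> (forall i, Q i -> 0 <= c i) ->
  (forall i, Q i -> EX X (fun x => F i x ^+ 2) <= K * c i ^+ 2) ->
  EX X (fun x => (\sum_(i | Q i) F i x) ^+ 2) <= K * (\sum_(i | Q i) c i) ^+ 2.
Proof.
move=> gF c0 FK.
have -> : EX X (fun x => (\sum_(i | Q i) F i x) ^+ 2) =
    \sum_(i | Q i) \sum_(j | Q j) EX X (fun x => F i x * F j x).
  under eq_EX do rewrite expr2 big_distrlr/=.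
  rewrite EX_sum => [|i Qi]; last first.
    by apply: good_sum => j Qj; apply: goodM; exact: gF.
  apply: eq_bigr => i Qi; rewrite EX_sum => [//|j Qj].
  by apply: goodM; exact: gF.
rewrite expr2 big_distrlr/= mulr_sumr; apply: ler_sum => i Qi.
rewrite mulr_sumr; apply: ler_sum => j Qj.
apply: (le_trans (ler_norm _)); apply: EX_cs; [exact: gF|exact: gF|exact: c0|exact: c0|..].
- exact: FK.
- exact: FK.
Qed.

(** The parity class of the monomials whose exponents are odd exactly on O. *)
Definition odd_part h (O : {set 'I_n}) :=
  forall j x, h (flip j x) = (-1) ^+ (j \in O) * h x.

Hypothesis hindep : mutually_independent X.
Hypothesis hsym : forall i, symmetric_rv (X i).

(** Reflecting a coordinate that belongs to one set only changes the sign. *)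
Lemma EX_orth2 h g (O O' : {set 'I_n}) : good X h -> good X g -> odd_part h O ->
  odd_part g O' -> O != O' -> EX X (fun x => h x * g x) = 0.
Proof.
move=> gh gg ho go OO'.
have [j hj] : exists j, (j \in O) != (j \in O').
  apply/existsP; rewrite -negb_forall; apply: contra OO' => /forallP h'.
  by apply/eqP/setP => j; apply/eqP; exact: h'.
apply: (EX_odd hindep hsym (j := j)); first exact: goodM.
move=> x; rewrite ho go mulrACA -[RHS]mulN1r; congr (_ * _).
by move: hj; case: (j \in O); case: (j \in O') => //= _; rewrite ?expr0 ?expr1 ?mulr1 ?mul1r.
Qed.

Lemma EX_orth (I : finType) (Q : pred I) (p : I -> {set 'I_n}) (F : I -> fn) :
  {in Q &, injective p} ->
  (forall i, Q i -> good X (F i)) -> (forall i, Q i -> odd_part (F i) (p i)) ->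
  EX X (fun x => (\sum_(i | Q i) F i x) ^+ 2) = \sum_(i | Q i) EX X (fun x => F i x ^+ 2).
Proof.
move=> pI gF oF.
under eq_EX do rewrite expr2 big_distrlr/=.
rewrite EX_sum => [|i Qi]; last first.
  by apply: good_sum => j Qj; apply: goodM; exact: gF.
apply: eq_bigr => i Qi; rewrite EX_sum => [|j Qj]; last by apply: goodM; exact: gF.
rewrite (bigD1 i)//= big1 ?addr0; first by apply: eq_EX => x; rewrite expr2.
move=> j /andP[Qj ji]; apply: EX_orth2 (gF _ Qi) (gF _ Qj) (oF _ Qi) (oF _ Qj) _.
by apply: contra ji => /eqP/pI/eqP; rewrite eq_sym; apply.
Qed.

End Squares.

Variable KX : nat -> R.
Hypothesis mX : forall i, mbd P KX (X i).

Definition mulK (K1 K2 : nat -> R) (p : nat) := 2^-1 * (K1 (2 * p)%N + K2 (2 * p)%N).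

Lemma good_X n (i : 'I_n) : good X (fun x => x i).
Proof. by apply: (@good_coord _ _ _ _ _ _ id) => //; exact: (mbd_tame (mX i)). Qed.

Lemma good_osum n k (O : {set 'I_n.+1}) s : good X (fun x => osum x k O s).
Proof.
elim: k O s => [|k IH] O s /=; first exact: good_cst.
by apply: good_sum => i _; apply: goodM; [exact: good_X|exact: IH].
Qed.

(** The second moment is controlled by the square of the number of terms.  The
    extra factor h carries the entries of the tuple read so far in the induction. *)
Lemma osum_sqr_le k (Kh : nat -> R) : exists2 C : R, 0 <= C &
  forall n (h : ('I_n.+1 -> R) -> R) (O : {set 'I_n.+1}) s,
    good X h -> mbd P Kh (fun w => h (coords X w)) ->
    EX X (fun x => (h x * osum x k O s) ^+ 2) <= C * cnt R k O s ^+ 2.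
Proof.
elim: k Kh => [|k IH] Kh.
  exists `|Kh 1%N| => // n h O s gh mh; rewrite /cnt/=.
  case: (_ && _).
    rewrite expr1n mulr1; under eq_EX do rewrite mulr1.
    by apply: le_trans (ler_norm _); exact: mbd_sqr_le mh.
  under eq_EX do rewrite mulr0 expr0n/=.
  by rewrite EX_cst expr0n mulr0.
have [C C0 hC] := IH (mulK Kh KX); exists C => // n h O s gh mh.
have -> : EX X (fun x => (h x * osum x k.+1 O s) ^+ 2) =
    EX X (fun x => (\sum_i (h x * x i) * osum x k (tog i O) (s - i)) ^+ 2).
  apply: eq_EX => x /=; congr (_ ^+ 2); rewrite mulr_sumr.
  by apply: eq_bigr => i _; rewrite mulrA.
have -> : cnt R k.+1 O s = \sum_i cnt R k (tog i O) (s - i).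
  by rewrite /cnt/=; apply: eq_bigr => i _; rewrite mul1r.
apply: EX_sum_sqr_le.
- move=> i _; apply: goodM; last exact: good_osum.
  by apply: goodM => //; exact: good_X.
- by move=> i _; exact: cnt_ge0.
- move=> i _; apply: hC; first by apply: goodM => //; exact: good_X.
  exact: (mbdM mh (mX i)).
Qed.

Lemma osum_sqr_le1 k : exists2 C : R, 0 <= C &
  forall n (O : {set 'I_n.+1}) s,
    EX X (fun x => osum x k O s ^+ 2) <= C * cnt R k O s ^+ 2.
Proof.
have [C C0 hC] := osum_sqr_le k (fun p => 1 ^+ (2 * p)); exists C => // n O s.
have b1 : mbd P (fun p => 1 ^+ (2 * p)) (fun w : T => 1 : R).
  by apply: mbd_bounded => // w; rewrite normr1.
apply: le_trans (hC n (fun=> 1) O s (good_cst _ _ 1) b1).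
by rewrite le_eqVlt; apply/orP; left; apply/eqP; apply: eq_EX => x; rewrite mul1r.
Qed.

Lemma odd_part_osum n k (O : {set 'I_n.+1}) s : odd_part (fun x => osum x k O s) O.
Proof. by move=> j x; exact: osum_flip. Qed.

End OsumMoments.

(** * Algebra of the trace *)

Section TracePolynomial.
Local Close Scope classical_set_scope.
Variables (R : realType) (a : nat -> R) (d n : nat).
Notation Z := 'I_n.+1.
Notation r := (rt R n).
Implicit Types (x : Z -> R) (S : {set Z}) (j : Z).

(** The trace of C^k has N = r^2 equal diagonal entries, and C is r^-1 times the
    circulant matrix of the variables. *)
Definition coef k := a k * (r ^+ 2 / r ^+ k).

Definition mono S x := \prod_(i in S) x i.

Definition trace_poly x := \sum_(k < d.+1 | (1 < k)%N) coef k * wsum x k 0.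

(** Each set S of zero sum is the set of entries of (|S|)! tuples. *)
Definition mono_coef S : R :=
  if ((\sum_(i in S) i)%R == 0) && (1 < #|S| < d.+1)%N
  then coef #|S| * (#|S|)`!%:R else 0.

(** The tuples with distinct entries; [rest] collects the tuples with repetitions. *)
Definition main_part x := \sum_S mono_coef S * mono S x.

Definition rest x := \sum_(k < d.+1 | (1 < k)%N) coef k *
  \sum_(O : {set Z} | (#|O| < k)%N) osum x k O 0.

(** The partial derivatives of [main_part].  In [half_grad] each monomial is also
    divided by its degree, as in Euler's identity. *)
Definition main_grad j x := \sum_(S : {set Z} | j \in S) mono_coef S * mono (S :\ j) x.

Definition half_grad j x :=
  \sum_(S : {set Z} | j \in S) mono_coef S / #|S|%:R * mono (S :\ j) x.

(** The partial derivative of [trace_poly]: fixing one entry of a tuple to be j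
    leaves a shorter tuple of sum - j. *)
Definition grad j x :=
  \sum_(k < d.+1 | (1 < k)%N) coef k * k%:R * wsum x k.-1 (- j).

(** The part of [grad] that is not multilinear, or no longer so once multiplied by
    x_j. *)
Definition rest_grad j x :=
  \sum_(k < d.+1 | (1 < k)%N) coef k * k%:R *
    \sum_(O : {set Z} | (#|O| < k.-1)%N || ((#|O| == k.-1) && (j \in O)))
       osum x k.-1 O (- j).

Lemma wsum_split x k s : wsum x k s =
  \sum_(O : {set Z} | #|O| == k) (k`! * ((\sum_(i in O) i)%R == s))%:R * mono O x +
  \sum_(O : {set Z} | (#|O| < k)%N) osum x k O s.
Proof.
rewrite wsum_osum (bigID (fun O : {set Z} => #|O| == k))/=; congr (_ + _).
  by apply: eq_bigr => O /eqP cO; rewrite osum_eq.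
rewrite (bigID (fun O : {set Z} => (#|O| < k)%N))/= [X in _ + X]big1 ?addr0; last first.
  move=> O /andP[h1]; rewrite -leqNgt leq_eqVlt eq_sym (negbTE h1)/= => h2.
  by rewrite osum_gt.
by apply: eq_bigl => O /=; case: ltngtP.
Qed.

Lemma trace_poly_split x : trace_poly x = main_part x + rest x.
Proof.
rewrite /trace_poly /main_part /rest.
under eq_bigr => k _ do rewrite wsum_split mulrDr mulr_sumr.
rewrite big_split/=; congr (_ + _).
rewrite (exchange_big_dep xpredT)//=; apply: eq_bigr => S _.
have [Sd|Sd] := boolP (1 < #|S| < d.+1)%N; last first.
  rewrite /mono_coef (negbTE Sd) andbF mul0r big1// => k /andP[k1 /eqP Sk].
  by move: Sd; rewrite Sk k1 ltn_ord.
have /andP[S1 S2] := Sd.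
rewrite (big_pred1 (Ordinal S2)) => [|k /=].
  rewrite /mono_coef Sd andbT /=; case: eqP => _; first by rewrite muln1 mulrA.
  by rewrite muln0 !(mulr0n, mul0r, mulr0).
rewrite -val_eqE/= eq_sym; case: (eqVneq (k : nat) #|S|) => [->|]; rewrite ?andbF//.
by rewrite S1.
Qed.

Lemma main_part_grad x : main_part x = \sum_j x j * half_grad j x.
Proof.
rewrite /main_part /half_grad.
under [RHS]eq_bigr do rewrite mulr_sumr.
rewrite (exchange_big_dep xpredT)//=; apply: eq_bigr => S _.
have [S0|S0] := eqVneq #|S| 0%N.
  have -> : mono_coef S = 0 by rewrite /mono_coef S0 andbF.
  by rewrite mul0r big1// => j; rewrite (cards0_eq S0) inE.
have E j : j \in S -> x j * (mono_coef S / #|S|%:R * mono (S :\ j) x) =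
    mono_coef S / #|S|%:R * mono S x.
  by move=> jS; rewrite mulrCA [mono S x](big_setD1 j).
rewrite (eq_bigr _ E) sumr_const -[RHS]mulr_natl !mulrA; congr (_ * _).
by rewrite mulrAC mulfV ?mul1r// pnatr_eq0.
Qed.

Lemma wsum_grad_split x k j s : wsum x k s =
  \sum_(O : {set Z} | (#|O| == k) && (j \notin O))
    (k`! * ((\sum_(i in O) i)%R == s))%:R * mono O x +
  \sum_(O : {set Z} | (#|O| < k)%N || ((#|O| == k) && (j \in O))) osum x k O s.
Proof.
rewrite wsum_osum (bigID (fun O : {set Z} => (#|O| == k) && (j \notin O)))/=; congr (_ + _).
  by apply: eq_bigr => O /andP[/eqP cO _]; rewrite osum_eq.
rewrite (bigID (fun O : {set Z} => (#|O| <= k)%N))/= [X in _ + X]big1 ?addr0; last first.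
  by move=> O /andP[_]; rewrite -ltnNge => h; rewrite osum_gt.
by apply: eq_bigl => O /=; case: ltngtP => //=; rewrite ?andbT ?andbF ?negbK.
Qed.

Lemma grad_split j x : grad j x = main_grad j x + rest_grad j x.
Proof.
rewrite /grad /main_grad /rest_grad.
under eq_bigr => k _ do rewrite (wsum_grad_split x k.-1 j) mulrDr.
rewrite big_split/=; congr (_ + _).
rewrite (reindex_onto (fun O : {set Z} => j |: O) (fun S => S :\ j))/=; last first.
  by move=> S jS; rewrite finset.setD1K.
under eq_bigr do rewrite mulr_sumr.
rewrite (exchange_big_dep (fun O : {set Z} => j \notin O))/=; last by move=> k O _ /andP[].
rewrite [RHS](eq_bigl (fun O : {set Z} => j \notin O)); last first.
  move=> O; rewrite !inE eqxx/=; apply/eqP/idP => [<-|jO]; first by rewrite !inE eqxx.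
  by rewrite finset.setU1K.
apply: eq_bigr => O jO; rewrite finset.setU1K//.
have cO : #|(j |: O)%SET| = #|O|.+1 by rewrite cardsU1 jO.
have sO : (\sum_(i in j |: O) i)%R = j + \sum_(i in O) i by rewrite big_setU1.
have [Od|Od] := boolP (1 < #|O|.+1 < d.+1)%N; last first.
  rewrite /mono_coef cO (negbTE Od) andbF mul0r big1// => k /andP[k1 /andP[/eqP Ok _]].
  by move: Od; rewrite Ok prednK ?(ltnW k1)// k1 ltn_ord.
have /andP[hO1 hO2] := Od.
rewrite (big_pred1 (Ordinal hO2)) => [|k /=].
  rewrite /mono_coef cO sO Od andbT /= addrC addr_eq0; case: eqP => _; rewrite ?muln1 ?muln0.
    by rewrite factS natrM !mulrA.
  by rewrite !(mulr0n, mul0r, mulr0).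
rewrite jO andbT -val_eqE/=; apply/andP/eqP => [[k1 /eqP ->]|->].
  by rewrite prednK// ltnW.
by rewrite hO1.
Qed.

Lemma half_grad_upd j x t : half_grad j (upd x j t) = half_grad j x.
Proof.
apply: eq_bigr => S _; congr (_ * _); apply: eq_bigr => i.
by rewrite !inE /upd => /andP[/negbTE ->].
Qed.

Definition trace_poly_at x j : {poly R} :=
  \sum_(k < d.+1 | (1 < k)%N) (coef k)%:P * wsum (poly_at x j) k 0.

Lemma trace_poly_upd x j t : trace_poly (upd x j t) = (trace_poly_at x j).[t].
Proof.
rewrite /trace_poly_at horner_sum; apply: eq_bigr => k _.
by rewrite hornerM hornerC wsum_poly_at.
Qed.

Lemma grad_upd x j t : grad j (upd x j t) = (trace_poly_at x j)^`().[t].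
Proof.
rewrite /trace_poly_at raddf_sum horner_sum; apply: eq_bigr => k _ /=.
rewrite derivM derivC mul0r add0r deriv_wsum_poly_at hornerM hornerC hornerMn.
by rewrite wsum_poly_at sub0r -mulrA mulr_natl.
Qed.

End TracePolynomial.

Section CirculantTrace.
Local Close Scope classical_set_scope.
Local Open Scope ring_scope.
Variables (R : realType) (n : nat).

(** Powers of circulant matrices are convolution powers on Z/N. *)
Lemma circulant_pow (y : nat -> R) k i j :
  (circulant n.+1 y ^+ k) i j = wsum (fun l : 'I_n.+1 => y l) k (j - i).
Proof.
elim: k i j => [|k IH] i j; first by rewrite expr0 mxE /= subr_eq0 eq_sym.
rewrite exprS mxE /= (reindex_inj (addrI i)); apply: eq_bigr => l _.
rewrite IH opprD addrA; congr (_ * _); rewrite mxE; congr y => /=.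
have [hi hl] := (ltn_ord i, ltn_ord l).
rewrite -addnBA ?(ltnW hi)// modnDml addnAC subnKC ?(ltnW hi)//.
by rewrite modnDl modn_small.
Qed.

Lemma circulant_trace_poly (T : Type) (X : nat -> T -> R) (a : nat -> R) d w :
  circulant_trace X (\sum_(2 <= k < d.+1) a k *: 'X^k) n w =
  trace_poly a d (fun i : 'I_n.+1 => X i w).
Proof.
rewrite /circulant_trace /trace_poly; set C := circulant _ _.
have CE : mxtrace (horner_mx C (\sum_(2 <= k < d.+1) a k *: 'X^k)) =
    \sum_(2 <= k < d.+1) a k * mxtrace (C ^+ k).
  rewrite rmorph_sum/= raddf_sum; apply: eq_bigr => k _ /=.
  by rewrite linearZ/= rmorphXn/= horner_mx_X mxtraceZ.
rewrite CE -(big_mkord (fun k => 1 < k)%N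
  (fun k => coef a n k * wsum (fun i : 'I_n.+1 => X i w) k 0)) big_geq_mkord big_mkord.
apply: eq_bigr => k _; rewrite /coef.
rewrite /mxtrace; under eq_bigr do rewrite circulant_pow subrr.
rewrite sumr_const card_ord.
have -> : wsum (fun l : 'I_n.+1 => X l w / Num.sqrt n.+1%:R) k 0 =
    (rt R n)^-1 ^+ k * wsum (fun i : 'I_n.+1 => X i w) k 0.
  by rewrite -wsumZ; apply: eq_wsum => l; rewrite mulrC.
rewrite -[X in _ * X = _]mulr_natl rt_sqr exprVn !mulrA; congr (_ * _).
Qed.

End CirculantTrace.

(** * Sums of coefficients *)

Section CoefficientBounds.
Local Close Scope classical_set_scope.
Variables (R : realType) (a : nat -> R) (d : nat).

Definition coef_bound : R := \sum_(k < d.+1) `|a k| * k`!%:R.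

Lemma coef_bound_ge0 : 0 <= coef_bound.
Proof. by apply: sumr_ge0 => k _; rewrite mulr_ge0. Qed.

Section Fixed.
Variable n : nat.
Notation Z := 'I_n.+1.
Notation r := (rt R n).
Notation c := (mono_coef a d).
Implicit Types (S D : {set Z}) (j : Z).

Definition zsum_small S := ((\sum_(i in S) i)%R == 0) && (1 < #|S| < d.+1)%N.

Lemma mono_coef_out S : ~~ zsum_small S -> c S = 0.
Proof. by rewrite /mono_coef /zsum_small => /negbTE ->. Qed.

Lemma mono_coef_le S : `|c S| <= coef_bound * (r ^+ 2 / r ^+ #|S|).
Proof.
have r0 := rt_gt0 R n.
have p0 : 0 < r ^+ 2 / r ^+ #|S| by rewrite divr_gt0// exprn_gt0.
rewrite /mono_coef; case: ifP => [/andP[_ /andP[_ S2]]|_]; last first.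
  by rewrite normr0 mulr_ge0 ?coef_bound_ge0// ltW.
rewrite /coef normrM normrM normr_nat (gtr0_norm p0) mulrAC ler_pM2r//.
rewrite /coef_bound (bigD1 (Ordinal S2))//= lerDl.
by apply: sumr_ge0 => k _; rewrite mulr_ge0.
Qed.

Lemma mono_coef_sqr_le S : c S ^+ 2 <= coef_bound ^+ 2 * (r ^+ 4 / r ^+ (2 * #|S|)).
Proof.
have := mono_coef_le S; have r0 := rt_gt0 R n.
have -> : coef_bound ^+ 2 * (r ^+ 4 / r ^+ (2 * #|S|)) = (coef_bound * (r ^+ 2 / r ^+ #|S|)) ^+ 2.
  by rewrite [(2 * _)%N]mulnC [r ^+ (_ * 2)]exprM -[4%N]/(2 * 2)%N exprM !exprMn exprVn.
rewrite -[c S ^+ 2]real_normK ?num_real// => h; rewrite lerXn2r ?nnegrE//.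
by rewrite mulr_ge0 ?coef_bound_ge0// divr_ge0// exprn_ge0// ltW.
Qed.

Let rne k : r ^+ k != 0. Proof. by rewrite expf_neq0// rt_neq0. Qed.
Let rp k : 0 < r ^+ k. Proof. by rewrite exprn_gt0// rt_gt0. Qed.
Let rw k : 0 <= r ^+ k. Proof. exact: ltW. Qed.
Let ri k : 0 <= (r ^+ k)^-1. Proof. by rewrite invr_ge0. Qed.
Ltac nonneg := by repeat first [done | exact: sqr_ge0 | exact: rw | exact: ri |
  exact: coef_bound_ge0 | exact: exprn_ge0 | apply: mulr_ge0].

(** The condition that S contains j saves a factor N, and so does that of zero sum. *)
Lemma sum_mono_coef_sqr_mem j : \sum_(S : {set Z} | j \in S) c S ^+ 2 <= 2 * d%:R * coef_bound ^+ 2.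
Proof.
have := sum_setD_le R [set j]%SET d; rewrite cards1 expr1 => h.
apply: (@le_trans _ _ (coef_bound ^+ 2 * r ^+ 2 *
  (\sum_(S : {set Z} | ((\sum_(i in S) i)%R == 0) && (0 < #|S :\ j| < d.+1)%N)
     (r ^+ (2 * #|S :\ j|))^-1))); last first.
  have h2 : 0 <= coef_bound ^+ 2 * r ^+ 2 by nonneg.
  apply: le_trans (ler_wpM2l h2 h) _.
  have := rne 2; move: (r ^+ 2) => u u0.
  rewrite (_ : coef_bound ^+ 2 * u * (d%:R * 2 / u) = 2 * d%:R * coef_bound ^+ 2)//; by field.
rewrite mulr_sumr [leRHS]big_mkcond [leLHS]big_mkcond/=.
apply: ler_sum => S _; case: ifPn => jS; last first.
  case: ifP => // _; nonneg.
have [Sd|Sd] := boolP (zsum_small S); last first.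
  rewrite mono_coef_out// expr0n/=; case: ifP => // _.
  nonneg.
have /andP[S0 /andP[S1 S2]] := Sd.
have cj : #|S| = #|S :\ j|.+1 by rewrite (cardsD1 j S) jS.
rewrite S0 -ltnS -cj S1 ltnW -?cj//=.
apply: (le_trans (mono_coef_sqr_le S)); rewrite -mulrA ler_wpM2l ?sqr_ge0//.
rewrite cj mulnS exprD invfM -[4%N]/(2 + 2)%N exprD.
have := rne 2; have := rne (2 * #|S :\ j|).
move: (r ^+ 2) (r ^+ (2 * _)) => u u' u0 u'0.
by rewrite le_eqVlt; apply/orP; left; apply/eqP; field; rewrite u0 u'0.
Qed.

Lemma sum_sets_inv_le : \sum_(S : {set Z} | zsum_small S) (r ^+ (2 * #|S|))^-1 <= d%:R / r ^+ 2.
Proof.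
have := sum_setD_le R (finset.set0 : {set Z}) d; rewrite cards0 expr0 mulr1.
apply: le_trans; rewrite [leRHS]big_mkcond [leLHS]big_mkcond/=.
apply: ler_sum => S _; rewrite finset.setD0 /zsum_small.
case: ifP => [/andP[-> /andP[S1 ->]]|_]; first by rewrite ltnW.
by case: ifP => // _; rewrite invr_ge0 ltW.
Qed.

Lemma sum_mono_coef_sqr_le : \sum_(S : {set Z}) c S ^+ 2 <= d%:R * coef_bound ^+ 2 * r ^+ 2.
Proof.
rewrite (bigID zsum_small)/= [X in _ + X]big1 ?addr0; last first.
  by move=> S /mono_coef_out ->; rewrite expr0n.
apply: (@le_trans _ _ (\sum_(S : {set Z} | zsum_small S)
    coef_bound ^+ 2 * r ^+ 4 * (r ^+ (2 * #|S|))^-1)).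
  by apply: ler_sum => S _; rewrite -mulrA; exact: mono_coef_sqr_le.
rewrite -mulr_sumr.
have h0 : 0 <= coef_bound ^+ 2 * r ^+ 4 by nonneg.
apply: le_trans (ler_wpM2l h0 sum_sets_inv_le) _.
rewrite -[4%N]/(2 + 2)%N exprD; have := rne 2; move: (r ^+ 2) => u u0.
by rewrite le_eqVlt; apply/orP; left; apply/eqP; field.
Qed.

(** The symmetric difference is the set of the variables of odd degree in the
    product of the two monomials. *)
Definition sdiff S D : {set Z} := (S :\: D) :|: (D :\: S).

Lemma in_sdiff S D i : (i \in sdiff S D) = (i \in S) (+) (i \in D).
Proof. by rewrite !inE; case: (i \in S); case: (i \in D). Qed.

Lemma sdiffK S : involutive (sdiff S).
Proof. by move=> D; apply/setP => i; rewrite !in_sdiff addbA addbb. Qed.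

Lemma sdiff_eq0 S D : (sdiff S D == finset.set0) = (S == D).
Proof.
apply/eqP/eqP => [|->]; last by apply/setP => i; rewrite in_sdiff addbb inE.
move/setP => h; apply/setP => i; have := h i; rewrite in_sdiff inE.
by case: (i \in S); case: (i \in D).
Qed.

Lemma card_sdiff S D : #|sdiff S D| = (#|S :\: D| + #|D :\: S|)%N.
Proof.
rewrite cardsU (_ : (S :\: D) :&: (D :\: S) = finset.set0) ?cards0 ?subn0//.
by apply/setP => i; rewrite !inE; case: (i \in S); case: (i \in D).
Qed.

Lemma card_add_sdiff S D : (#|S| + #|sdiff S D| = 2 * #|S :\: D| + #|D|)%N.
Proof.
rewrite card_sdiff -(cardsID D S) -(cardsID S D) [(D :&: S)%SET]finset.setIC.
lia.
Qed.

(** The total weight of the products of two monomials, with a common variable,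
    whose variables of odd degree are the elements of D. *)
Definition class_weight D :=
  \sum_(S : {set Z} | S :\: D != finset.set0) `|c S * c (sdiff S D)|.

Lemma mono_coef_mul_le S S' : `|c S * c S'| <= coef_bound ^+ 2 * (r ^+ 4 / r ^+ (#|S| + #|S'|)).
Proof.
rewrite normrM; apply: le_trans (ler_pM _ _ (mono_coef_le S) (mono_coef_le S')) _ => //.
rewrite -[4%N]/(2 + 2)%N !exprD.
have := rne #|S|; have := rne #|S'|; move: (r ^+ 2) (r ^+ #|S|) (r ^+ #|S'|) => u v w v0 w0.
by rewrite le_eqVlt; apply/orP; left; apply/eqP; field; rewrite v0 w0.
Qed.

Definition weight_bound : R := coef_bound ^+ 2 * d%:R * 2 ^+ (2 * d).

Lemma weight_bound_ge0 : 0 <= weight_bound.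
Proof. by rewrite !mulr_ge0 ?coef_bound_ge0 ?exprn_ge0//. Qed.

Lemma class_weight_ge0 D : 0 <= class_weight D.
Proof. exact: sumr_ge0. Qed.

(** |S| + |S'| = 2 |S - D| + |D| when D is the symmetric difference of S and S'. *)
Lemma class_weight_le D : class_weight D <= weight_bound * (r ^+ 2 / r ^+ #|D|).
Proof.
have [Dd|Dd] := leqP #|D| (2 * d)%N; last first.
  rewrite /class_weight big1 => [|S _].
    by rewrite mulr_ge0 ?weight_bound_ge0// divr_ge0// ltW.
  apply/eqP; rewrite normr_eq0; apply: contraTT Dd.
  rewrite mulf_eq0 negb_or -leqNgt => /andP[s1 s2].
  have /andP[_ /andP[_ h1]] : zsum_small S by apply: contraR s1 => /mono_coef_out ->.
  have /andP[_ /andP[_ h2]] : zsum_small (sdiff S D) by apply: contraR s2 => /mono_coef_out ->.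
  by have := card_add_sdiff S D; move: h1 h2; lia.
apply: (@le_trans _ _ (coef_bound ^+ 2 * r ^+ 4 / r ^+ #|D| *
  (\sum_(S : {set Z} | ((\sum_(i in S) i)%R == 0) && (0 < #|S :\: D| < d.+1)%N)
     (r ^+ (2 * #|S :\: D|))^-1))); last first.
  have h0 : 0 <= coef_bound ^+ 2 * r ^+ 4 / r ^+ #|D|.
    nonneg.
  apply: le_trans (ler_wpM2l h0 (sum_setD_le R D d)) _.
  apply: (@le_trans _ _ (coef_bound ^+ 2 * r ^+ 4 / r ^+ #|D| * (d%:R * 2 ^+ (2 * d) / r ^+ 2))).
    rewrite ler_wpM2l// ler_pM2r ?invr_gt0//; rewrite ler_wpM2l//.
    by rewrite ler_weXn2l// ler1n.
  rewrite /weight_bound -[4%N]/(2 + 2)%N exprD.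
  have := rne #|D|; have := rne 2; move: (r ^+ 2) (r ^+ #|D|) (2 ^+ _) => u v w v0 w0.
  by rewrite le_eqVlt; apply/orP; left; apply/eqP; field; rewrite v0 w0.
rewrite mulr_sumr [leRHS]big_mkcond [leLHS]big_mkcond/=.
apply: ler_sum => S _; case: ifPn => SD; last first.
  by case: ifP => // _; nonneg.
have [Sd|Sd] := boolP (zsum_small S); last first.
  rewrite mono_coef_out// mul0r normr0; case: ifP => // _.
  nonneg.
have /andP[S0 /andP[S1 S2]] := Sd.
rewrite S0 card_gt0 SD (leq_ltn_trans (subset_leq_card (subsetDl S D)))//=.
apply: (le_trans (mono_coef_mul_le _ _)); rewrite card_add_sdiff exprD.
have := rne (2 * #|S :\: D|); have := rne #|D|.
move: (coef_bound ^+ 2) (r ^+ 4) (r ^+ #|D|) (r ^+ (2 * _)) => t u v w v0 w0.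
by rewrite le_eqVlt; apply/orP; left; apply/eqP; field; rewrite v0 w0.
Qed.

Lemma card_setU_eq S S' : #|S :|: S'| = (#|S| + #|S' :\: S|)%N.
Proof.
rewrite -(cardsID S (S :|: S')); congr (_ + _)%N; apply: eq_card => i; rewrite !inE.
  by case: (i \in S); rewrite ?andbT ?andbF ?orbT.
by case: (i \in S).
Qed.

Let pairs_le : \sum_(S : {set Z} | zsum_small S)
    \sum_(S' : {set Z} | zsum_small S' && (S' :\: S != finset.set0))
      (r ^+ (2 * #|S :|: S'|))^-1 <= d%:R ^+ 2 * 2 ^+ d / r ^+ 4.
Proof.
have K0 : 0 <= d%:R * 2 ^+ d / r ^+ 2 by nonneg.
apply: (@le_trans _ _ (\sum_(S : {set Z} | zsum_small S)
   (r ^+ (2 * #|S|))^-1 * (d%:R * 2 ^+ d / r ^+ 2))); last first.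
  rewrite -mulr_suml; apply: (le_trans (ler_wpM2r K0 sum_sets_inv_le)).
  rewrite -[4%N]/(2 + 2)%N exprD.
  have := rne 2; move: (r ^+ 2) (2 ^+ _) => u w u0.
  by rewrite le_eqVlt; apply/orP; left; apply/eqP; field.
apply: ler_sum => S /andP[_ /andP[_ S2]].
under eq_bigr do rewrite card_setU_eq mulnDr exprD invfM.
rewrite -mulr_sumr ler_wpM2l ?invr_ge0 ?(ltW (rp _))//.
apply: (@le_trans _ _ (d%:R * 2 ^+ #|S| / r ^+ 2)); last first.
  rewrite ler_pM2r ?invr_gt0// ler_wpM2l// ler_weXn2l ?ler1n//.
apply: le_trans (sum_setD_le R S d).
rewrite [leRHS]big_mkcond [leLHS]big_mkcond/=.
apply: ler_sum => S' _; rewrite /zsum_small -andbA -card_gt0.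
case: ifP => [/andP[-> /andP[/andP[_ h] ->]]|_].
  by rewrite (leq_ltn_trans (subset_leq_card (subsetDl S' S))).
by case: ifP => // _; rewrite invr_ge0 ltW.
Qed.

(** One factor is bounded by [class_weight_le]; the remaining sum over pairs
    S <> S' has weight r^(-2 |S U S'|), and each of S and the part of S' outside S,
    or vice versa, is bound by a condition of zero sum. *)
Lemma sum_class_weight_sqr_le :
  \sum_(D : {set Z} | D != finset.set0) class_weight D ^+ 2 <=
  2 * weight_bound * coef_bound ^+ 2 * d%:R ^+ 2 * 2 ^+ d * r ^+ 2.
Proof.
apply: (@le_trans _ _ (\sum_(D : {set Z} | D != finset.set0)
   weight_bound * r ^+ 2 * (class_weight D / r ^+ #|D|))).
  apply: ler_sum => D _; rewrite expr2.
  apply: (le_trans (ler_wpM2l (class_weight_ge0 D) (class_weight_le D))).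
  have := rne #|D|; move: (class_weight D) weight_bound (r ^+ 2) (r ^+ #|_|) => t u v w w0.
  by rewrite le_eqVlt; apply/orP; left; apply/eqP; field.
rewrite -mulr_sumr.
have -> : 2 * weight_bound * coef_bound ^+ 2 * d%:R ^+ 2 * 2 ^+ d * r ^+ 2 =
   weight_bound * r ^+ 2 * (2 * coef_bound ^+ 2 * d%:R ^+ 2 * 2 ^+ d) by ring.
have wr0 : 0 <= weight_bound * r ^+ 2 by apply: mulr_ge0; [exact: weight_bound_ge0|exact: rw].
apply: (ler_wpM2l wr0).
pose g S S' := coef_bound ^+ 2 * r ^+ 4 * (r ^+ (2 * #|S :|: S'|))^-1.
have g0 S S' : 0 <= g S S' by nonneg.
apply: (@le_trans _ _ (\sum_(S : {set Z} | zsum_small S)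
  \sum_(S' : {set Z} | zsum_small S' && (S' != S)) g S S')).
  have cwE D : D != finset.set0 -> class_weight D / r ^+ #|D| =
      \sum_(S : {set Z} | S :\: D != finset.set0) `|c S * c (sdiff S D)| / r ^+ #|D|.
    by move=> _; rewrite /class_weight mulr_suml.
  rewrite (eq_bigr _ cwE) (exchange_big_dep xpredT)//= [leRHS]big_mkcond/=; apply: ler_sum => S _.
  rewrite (reindex_inj (inv_inj (sdiffK S)))/=.
  under eq_bigr do rewrite sdiffK.
  case: ifPn => Ss; last first.
    by rewrite big1// => S' _; rewrite mono_coef_out// mul0r normr0 mul0r.
  rewrite [leRHS]big_mkcond [leLHS]big_mkcond/=.
  apply: ler_sum => S' _; rewrite sdiff_eq0 [S' == S]eq_sym.
  have [S's|S's] := boolP (zsum_small S'); last first.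
    by rewrite (mono_coef_out S's) mulr0 normr0 mul0r if_same.
  case: eqVneq => //= SS'; case: ifP => // _.
  apply: (le_trans (ler_wpM2r _ (mono_coef_mul_le S S'))); first by rewrite invr_ge0 ltW.
  have cE : (2 * #|S :|: S'| = #|S| + #|S'| + #|sdiff S S'|)%N.
    rewrite card_setU_eq card_sdiff -(cardsID S' S) -(cardsID S S').
    by rewrite [(S' :&: S)%SET]finset.setIC; lia.
  rewrite /g cE [r ^+ (_ + #|sdiff _ _|)]exprD.
  have := rne (#|S| + #|S'|)%N; have := rne #|sdiff S S'|.
  move: (coef_bound ^+ 2) (r ^+ 4) (r ^+ (_ + _)) (r ^+ #|_|) => t u v w v0 w0.
  by rewrite le_eqVlt; apply/orP; left; apply/eqP; field; rewrite v0 w0.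
have split2 : \sum_(S : {set Z} | zsum_small S)
    \sum_(S' : {set Z} | zsum_small S' && (S' != S)) g S S' <=
  \sum_(S : {set Z} | zsum_small S)
    \sum_(S' : {set Z} | zsum_small S' && (S' :\: S != finset.set0)) g S S' +
  \sum_(S : {set Z} | zsum_small S)
    \sum_(S' : {set Z} | zsum_small S' && (S :\: S' != finset.set0)) g S S'.
  rewrite -big_split/=; apply: ler_sum => S _.
  rewrite [leLHS]big_mkcond ![X in _ <= X + _]big_mkcond ![X in _ <= _ + X]big_mkcond -big_split/=.
  apply: ler_sum => S' _; case: (zsum_small S') => /=; last by rewrite addr0.
  case: eqVneq => /= [_|SS'].
    by apply: addr_ge0; case: ifP.
  have : (S' :\: S != finset.set0) || (S :\: S' != finset.set0).
    apply: contraR SS'; rewrite negb_or !negbK !finset.setD_eq0 => h.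
    by rewrite finset.eqEsubset.
  by case/orP => ->; [rewrite lerDl|rewrite lerDr]; case: ifP.
apply: (le_trans split2).
have h1 : \sum_(S : {set Z} | zsum_small S)
    \sum_(S' : {set Z} | zsum_small S' && (S' :\: S != finset.set0)) g S S' <=
    coef_bound ^+ 2 * d%:R ^+ 2 * 2 ^+ d.
  rewrite /g; under eq_bigr do rewrite -mulr_sumr.
  rewrite -mulr_sumr.
  have h0 : 0 <= coef_bound ^+ 2 * r ^+ 4 by nonneg.
  apply: (le_trans (ler_wpM2l h0 pairs_le)).
  have := rne 4; move: (r ^+ 4) (2 ^+ d) => u w u0.
  by rewrite le_eqVlt; apply/orP; left; apply/eqP; field.
have h2 : \sum_(S : {set Z} | zsum_small S)
    \sum_(S' : {set Z} | zsum_small S' && (S :\: S' != finset.set0)) g S S' =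
   \sum_(S : {set Z} | zsum_small S)
    \sum_(S' : {set Z} | zsum_small S' && (S' :\: S != finset.set0)) g S S'.
  rewrite (exchange_big_dep zsum_small)/=; last by move=> S S' _ /andP[].
  apply: eq_bigr => S Ss; apply: eq_big => [S'|S' _]; first by rewrite Ss.
  by rewrite /g finset.setUC.
by rewrite h2; apply: (le_trans (lerD h1 h1)); rewrite -!mulrA -mulrDr; lra.
Qed.

End Fixed.
End CoefficientBounds.

(** * Tuples with repeated indices *)

Section MomentBounds.
Local Close Scope classical_set_scope.
Context d0 (T : measurableType d0) (R : realType) (P : probability T R).
Variable X : nat -> {RV P >-> R}.
Hypothesis hindep : mutually_independent X.
Hypothesis hsym : forall i, symmetric_rv (X i).
Variable KX : nat -> R.
Hypothesis mX : forall i, mbd P KX (X i).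
Variables (a : nat -> R) (d : nat).

Lemma EX_sqrZ n c (h : ('I_n -> R) -> R) : good X h ->
  EX X (fun x => (c * h x) ^+ 2) = c ^+ 2 * EX X (fun x => h x ^+ 2).
Proof.
move=> gh; rewrite -EXZ; last exact: goodX.
by apply: eq_EX => x; rewrite exprMn.
Qed.

Lemma EX_center_sqr n (h : ('I_n -> R) -> R) : good X h ->
  EX X (fun x => (h x - EX X h) ^+ 2) = EX X (fun x => h x ^+ 2) - EX X h ^+ 2.
Proof.
move=> gh; transitivity (EX X (fun x => h x ^+ 2 - (2 * EX X h * h x - EX X h ^+ 2))).
  by apply: eq_EX => x; ring.
have gz : good X (fun x => 2 * EX X h * h x) by exact: goodZ.
rewrite EXB; [|exact: goodX|by apply: goodB => //; exact: good_cst].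
by rewrite (EXB gz (good_cst _ _ _)) EX_cst (EXZ _ gh); ring.
Qed.

Lemma sqr_sum_le (I : finType) (Q : pred I) (f : I -> R) :
  (\sum_(i | Q i) f i) ^+ 2 <= #|I|%:R * \sum_(i | Q i) f i ^+ 2.
Proof.
have h : (\sum_(i | Q i) f i) ^+ 2 <= #|Q|%:R * \sum_(i | Q i) f i ^+ 2.
  rewrite expr2 big_distrlr/=.
  apply: (@le_trans _ _ (\sum_(i | Q i) \sum_(j | Q j) (f i ^+ 2 + f j ^+ 2) / 2)).
    apply: ler_sum => i _; apply: ler_sum => j _.
    by have := sqr_ge0 (f i - f j); rewrite sqrrB; lra.
  set S := \sum_(i | Q i) f i ^+ 2.
  rewrite (eq_bigr (fun i => (#|Q|%:R * f i ^+ 2 + S) / 2)) => [|i _]; last first.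
    by rewrite -mulr_suml big_split/= sumr_const mulr_natl.
  rewrite -mulr_suml big_split/= -mulr_sumr sumr_const -/S -[X in _ + X]mulr_natl.
  by move: (#|Q|%:R * _) => z; lra.
apply: (le_trans h); rewrite ler_wpM2r ?sumr_ge0// => [i _|]; first exact: sqr_ge0.
by rewrite ler_nat max_card.
Qed.

Lemma EX_sqr_sum_le n (I : finType) (Q : pred I) (F : I -> ('I_n -> R) -> R) :
  (forall i, Q i -> good X (F i)) ->
  EX X (fun x => (\sum_(i | Q i) F i x) ^+ 2) <=
  #|I|%:R * \sum_(i | Q i) EX X (fun x => F i x ^+ 2).
Proof.
move=> gF.
have gF2 i : Q i -> good X (fun x => F i x ^+ 2) by move=> Qi; apply: goodX; exact: gF.
rewrite -EX_sum// -EXZ; last exact: good_sum.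
apply: EX_le => [|| x]; last exact: sqr_sum_le.
  by apply: goodX; exact: good_sum.
by apply: goodZ; exact: good_sum.
Qed.

Lemma sum_bounds (B : nat -> nat -> R) :
  (forall k, (1 < k)%N -> exists C, 0 <= C /\ forall n, B n k <= C) ->
  exists2 C, 0 <= C & forall n, \sum_(k < d.+1 | (1 < k)%N) B n k <= C.
Proof.
move=> h.
have /choice[C hC] : forall k, exists C, (1 < k)%N -> 0 <= C /\ forall n, B n k <= C.
  by move=> k; case: (boolP (1 < k)%N) => [/h [c hc]|_]; [exists c|exists 0].
exists (\sum_(k < d.+1 | (1 < k)%N) C k).
  by apply: sumr_ge0 => k /hC [].
by move=> n; apply: ler_sum => k /hC [].
Qed.

Lemma coef_sqr k n : coef a n k ^+ 2 = a k ^+ 2 * rt R n ^+ 4 / rt R n ^+ (2 * k).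
Proof.
by rewrite /coef [(2 * k)%N]mulnC exprM -[4%N]/(2 * 2)%N exprM !exprMn exprVn mulrA.
Qed.

Lemma good_rest_term n k (Q : pred {set 'I_n.+1}) s :
  good X (fun x => \sum_(O : {set 'I_n.+1} | Q O) osum x k O s).
Proof. by apply: good_sum => O _; exact: (good_osum mX). Qed.

Lemma EX_osum_sum_le k : exists2 C : R, 0 <= C &
  forall n (Q : pred {set 'I_n.+1}) s,
  EX X (fun x => (\sum_(O : {set 'I_n.+1} | Q O) osum x k O s) ^+ 2) <=
  C * \sum_(O : {set 'I_n.+1} | Q O) cnt R k O s ^+ 2.
Proof.
have [C C0 hC] := osum_sqr_le1 mX k; exists C => // n Q s.
rewrite (EX_orth hindep hsym (p := id)).
- by rewrite mulr_sumr; apply: ler_sum => O _; exact: hC.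
- by move=> O O' _ _.
- by move=> O _; exact: (good_osum mX).
- by move=> O _; exact: odd_part_osum.
Qed.

Lemma good_rest n : good X (rest a d (n := n)).
Proof. by apply: good_sum => k _; apply: goodZ; exact: good_rest_term. Qed.

(** For each k, the second moment is at most the sum of the squared counts, which
    is smaller by r^4 than r^(2k), while the squared coefficient is r^(4-2k). *)
Lemma EX_rest_le : exists2 C : R, 0 <= C &
  forall n, EX X (fun x : 'I_n.+1 -> R => rest a d x ^+ 2) <= C.
Proof.
pose B n k := EX X (fun x => (coef a n k *
  \sum_(O : {set 'I_n.+1} | (#|O| < k)%N) osum x k O 0) ^+ 2).
have [k _|C C0 hC] := @sum_bounds B.
  have [C1 C10 h1] := EX_osum_sum_le k; have [C2 C20 h2] := sum_cnt_lt R k.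
  exists (a k ^+ 2 * C1 * C2); split=> [|n]; first by rewrite mulr_ge0// mulr_ge0// sqr_ge0.
  rewrite /B EX_sqrZ; last exact: good_rest_term.
  apply: le_trans (ler_wpM2l (sqr_ge0 _) (h1 n _ _)) _.
  rewrite coef_sqr; have := h2 n 0; move: (\sum_(O | _) _) => S hS.
  have r0 := exprn_gt0 (2 * k) (rt_gt0 R n).
  rewrite mulrAC ler_pdivrMr//.
  have := ler_wpM2l (mulr_ge0 (sqr_ge0 (a k)) C10) hS.
  by move: (rt R n ^+ 4) (rt R n ^+ (2 * k)) => u v; congr (_ <= _); ring.
exists (d.+1%:R * C) => [|n]; first by rewrite mulr_ge0.
apply: (@le_trans _ _ (d.+1%:R * \sum_(k < d.+1 | (1 < k)%N) B n k)); last first.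
  by rewrite ler_wpM2l.
have := @EX_sqr_sum_le n.+1 'I_d.+1 (fun k => (1 < k)%N) (fun k x => coef a n k *
  \sum_(O : {set 'I_n.+1} | (#|O| < k)%N) osum x k O 0).
rewrite card_ord; apply => k _.
by apply: goodZ; exact: good_rest_term.
Qed.

Lemma good_rest_grad n j : good X (rest_grad a d (n := n) j).
Proof. by apply: good_sum => k _; apply: goodZ; exact: good_rest_term. Qed.

(** The other elements being fixed, j satisfies an equation 2 j = c. *)
Lemma sum_repeat_le n m :
  \sum_(j : 'I_n.+1) \sum_(O : {set 'I_n.+1} | (#|O| == m.+1) && (j \in O))
    ((\sum_(i in O) i)%R == - j)%:R <= 2 * rt R n ^+ (2 * m).
Proof.
have E j : \sum_(O : {set 'I_n.+1} | (#|O| == m.+1) && (j \in O))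
    ((\sum_(i in O) i)%R == - j)%:R <=
    \sum_(O : {set 'I_n.+1} | #|O| == m) ((j + j)%R == - (\sum_(i in O) i)%R)%:R :> R.
  rewrite (reindex_onto (fun O : {set 'I_n.+1} => j |: O) (fun S => S :\ j))/=; last first.
    by move=> S /andP[_ jS]; rewrite finset.setD1K.
  rewrite [leRHS]big_mkcond [leLHS]big_mkcond/=; apply: ler_sum => O _.
  case: ifP => [|_]; last by case: ifP.
  rewrite !inE eqxx andbT => /andP[/eqP cO /eqP jO].
  have jNO : j \notin O by rewrite -jO !inE eqxx.
  have -> : #|O| == m by move: cO; rewrite cardsU1 jNO add1n => -[->].
  rewrite big_setU1//= (_ : (j + \sum_(i in O) i == - j) = (j + j == - \sum_(i in O) i))//.
  by rewrite -!addr_eq0 addrAC.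
apply: (le_trans (ler_sum _ (fun j _ => E j))); rewrite exchange_big/=.
rewrite mulrC; apply: (@sum_sets_le _ _ _ _ 2) => // O _.
rewrite -natr_sum ler_nat.
apply: leq_trans (card_double_le2 (- (\sum_(i in O) i)%R)).
rewrite -sum1_card [leqRHS]big_mkcond/=; apply: leq_sum => j _.
by rewrite inE; case: eqP.
Qed.

(** Summing over j costs a factor N.  For the tuples with repetitions it is
    compensated by their being one entry shorter than those of [rest]; the tuples
    of distinct entries that contain j are few by [sum_repeat_le]. *)
Lemma EX_rest_grad_le : exists2 C : R, 0 <= C &
  forall n, \sum_j EX X (fun x : 'I_n.+1 -> R => rest_grad a d j x ^+ 2) <= C.
Proof.
pose Q n k (j : 'I_n.+1) (O : {set 'I_n.+1}) := (#|O| < k)%N || ((#|O| == k) && (j \in O)).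
pose B n k := \sum_j EX X (fun x => (coef a n k * k%:R *
  \sum_(O | @Q n k.-1 j O) osum x k.-1 O (- j)) ^+ 2).
have [[//|[//|m]] _|C C0 hC] := @sum_bounds B.
  have [C1 C10 h1] := EX_osum_sum_le m.+1; have [C2 C20 h2] := sum_cnt_lt R m.+1.
  exists ((a m.+2 * m.+2%:R) ^+ 2 * C1 * (C2 + (m.+1)`!%:R ^+ 2 * 2)).
  split=> [|n].
    by rewrite mulr_ge0 ?addr_ge0// mulr_ge0// sqr_ge0.
  set r := rt R n.
  have hQ : (\sum_j \sum_(O | @Q n m.+1 j O) cnt R m.+1 O (- j) ^+ 2) * r ^+ 4 <=
      (C2 + (m.+1)`!%:R ^+ 2 * 2) * r ^+ (2 * m.+2).
    have q1 : (\sum_(j : 'I_n.+1) \sum_(O : {set 'I_n.+1} | (#|O| < m.+1)%N)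
        cnt R m.+1 O (- j) ^+ 2) * r ^+ 4 <= C2 * r ^+ (2 * m.+2).
      rewrite mulr_suml; apply: (le_trans (ler_sum _ (fun j _ => h2 n (- j)))).
      rewrite sumr_const card_ord -[leLHS]mulr_natl -rt_sqr mulrCA -exprD.
      by rewrite (_ : (2 + 2 * m.+1 = 2 * m.+2)%N)//; lia.
    have q2 : (\sum_(j : 'I_n.+1) \sum_(O : {set 'I_n.+1} | (#|O| == m.+1) && (j \in O))
        cnt R m.+1 O (- j) ^+ 2) * r ^+ 4 <= (m.+1)`!%:R ^+ 2 * 2 * r ^+ (2 * m.+2).
      have -> : (2 * m.+2 = 2 * m + 4)%N by lia.
      rewrite exprD mulrA ler_pM2r ?exprn_gt0 ?rt_gt0// -mulrA.
      apply: (le_trans _ (ler_wpM2l (sqr_ge0 _) (sum_repeat_le n m))).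
      rewrite mulr_sumr; apply: ler_sum => j _; rewrite mulr_sumr; apply: ler_sum => O.
      move=> /andP[/eqP cO _]; rewrite cnt_eq// natrM exprMn.
      by case: eqP => _; rewrite ?expr1n ?expr0n.
    rewrite mulrDl; apply: le_trans (lerD q1 q2); rewrite -mulrDl ler_pM2r ?exprn_gt0 ?rt_gt0//.
    rewrite -big_split/=; apply: ler_sum => j _.
    rewrite [leLHS]big_mkcond ![X in _ <= X + _]big_mkcond ![X in _ <= _ + X]big_mkcond -big_split/=.
    apply: ler_sum => O _; rewrite /Q; case: (_ < _)%N => /=.
      by rewrite lerDl; case: ifP => // _; rewrite sqr_ge0.
    by case: ifP => _; rewrite add0r.
  apply: (@le_trans _ _ (\sum_j (coef a n m.+2 * m.+2%:R) ^+ 2 *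
      (C1 * \sum_(O | @Q n m.+1 j O) cnt R m.+1 O (- j) ^+ 2))).
    apply: ler_sum => j _; rewrite EX_sqrZ; last exact: good_rest_term.
    by rewrite ler_wpM2l ?sqr_ge0//; exact: h1.
  rewrite -mulr_sumr -mulr_sumr exprMn coef_sqr -/r [(a _ * _) ^+ 2]exprMn.
  move: (\sum_j _) hQ => S hQ.
  have r0 : 0 < r ^+ (2 * m.+2) by rewrite exprn_gt0// rt_gt0.
  have := ler_wpM2l (mulr_ge0 (mulr_ge0 (sqr_ge0 (a m.+2)) (sqr_ge0 m.+2%:R)) C10) hQ.
  move: (r ^+ 4) (r ^+ (2 * m.+2)) r0 (a _ ^+ 2) (_%:R ^+ 2) (C2 + _) => u v v0 w t C3.
  have vi : 0 < v^-1 by rewrite invr_gt0.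
  rewrite -(ler_pM2r vi).
  have v1 : v != 0 by rewrite gt_eqF.
  by congr (_ <= _); field.
exists (d.+1%:R * C) => [|n]; first by rewrite mulr_ge0.
apply: (@le_trans _ _ (d.+1%:R * \sum_(k < d.+1 | (1 < k)%N) B n k)); last first.
  by rewrite ler_wpM2l.
rewrite /B exchange_big/= mulr_sumr; apply: ler_sum => j _.
have := @EX_sqr_sum_le n.+1 'I_d.+1 (fun k => (1 < k)%N) (fun k x => coef a n k * k%:R *
  \sum_(O | @Q n k.-1 j O) osum x k.-1 O (- j)).
rewrite card_ord; apply => k _.
by apply: goodZ; exact: good_rest_term.
Qed.

End MomentBounds.

(** * The multilinear part *)

Section Monomials.
Local Close Scope classical_set_scope.
Context d0 (T : measurableType d0) (R : realType) (P : probability T R).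
Variable X : nat -> {RV P >-> R}.
Hypothesis hindep : mutually_independent X.
Hypothesis hsym : forall i, symmetric_rv (X i).
Variable KX : nat -> R.
Hypothesis mX : forall i, mbd P KX (X i).
Variables (a : nat -> R) (d : nat).

Lemma good_mono n (S : {set 'I_n}) : good X (fun x => \prod_(i in S) x i).
Proof. by apply: good_prod => i _; exact: (good_X mX). Qed.

Lemma odd_part_prod n (S : {set 'I_n}) : odd_part (fun x : 'I_n -> R => \prod_(i in S) x i) S.
Proof.
move=> j x; have [jS|jS] := boolP (j \in S).
  rewrite expr1 mulN1r !(big_setD1 j jS)/= /flip {1}/upd eqxx mulNr; congr (- (_ * _)).
  by apply: eq_bigr => i; rewrite !inE /upd => /andP[/negbTE ->].
rewrite expr0 mul1r; apply: eq_bigr => i iS; rewrite /flip /upd.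
by case: eqP => // ij; rewrite ij (negbTE jS) in iS.
Qed.

(** Uniform in the number of variables, which is why it is an induction on the
    degree with explicit bounds. *)
Lemma mono_mbd k : exists K, forall n (S : {set 'I_n.+1}), (#|S| <= k)%N ->
  mbd P K (fun w => mono S (coords X w)).
Proof.
elim: k => [|k [K IH]].
  exists (fun p => 1 ^+ (2 * p)) => n S; rewrite leqn0 cards_eq0 => /eqP ->.
  have -> : (fun w => mono (finset.set0 : {set 'I_n.+1}) (coords X w)) = (fun=> 1).
    by apply/funext => w; rewrite /mono big_set0.
  by apply: mbd_bounded => // w; rewrite normr1.
exists (fun p => Num.max (K p) (mulK KX K p)) => n S Sk.
have [->|/set0Pn[j jS]] := eqVneq S finset.set0.
  by apply: mbd_le (IH n finset.set0 _) => [p|]; rewrite ?cards0// le_max lexx.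
have -> : (fun w => mono S (coords X w)) = (fun w => X j w * mono (S :\ j) (coords X w)).
  by apply/funext => w; rewrite /mono (big_setD1 j jS).
apply: mbd_le (mbdM (mX j) (IH n (S :\ j) _)) => [p|].
  by rewrite le_max lexx orbT.
by rewrite (cardsD1 j S) jS in Sk.
Qed.

Lemma mono_moment : exists2 K : R, 0 <= K & forall n (S : {set 'I_n.+1}),
  (#|S| <= d)%N -> EX X (fun x => mono S x ^+ 2) <= K.
Proof.
have [K hK] := mono_mbd d; exists (Num.max 0 (K 1%N)); first by rewrite le_max lexx.
move=> n S Sd; rewrite le_max; apply/orP; right; exact: mbd_sqr_le (hK n S Sd).
Qed.

Section HalfGradient.
Variable n : nat.
Notation c := (mono_coef (n := n) a d).

Lemma good_half_grad j : good X (half_grad a d (n := n) j).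
Proof. by apply: good_sum => S _; apply: goodZ; exact: good_mono. Qed.

Lemma good_main_grad j : good X (main_grad a d (n := n) j).
Proof. by apply: good_sum => S _; apply: goodZ; exact: good_mono. Qed.

Lemma good_main_part : good X (main_part a d (n := n)).
Proof. by apply: good_sum => S _; apply: goodZ; exact: good_mono. Qed.

Lemma odd_part_scale n' k (h : ('I_n' -> R) -> R) O : odd_part h O ->
  odd_part (fun x => k * h x) O.
Proof. by move=> ho j x; rewrite ho mulrCA. Qed.

Lemma EX_main_part_sqr : EX X (fun x => main_part a d (n := n) x ^+ 2) =
  \sum_S c S ^+ 2 * EX X (fun x => mono S x ^+ 2).
Proof.
rewrite (EX_orth hindep hsym (p := id)).
- by apply: eq_bigr => S _; rewrite EX_sqrZ//; exact: good_mono.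
- by move=> S S' _ _.
- by move=> S _; apply: goodZ; exact: good_mono.
- by move=> S _; apply: odd_part_scale; exact: odd_part_prod.
Qed.

Lemma EX_main_part : EX X (main_part a d (n := n)) = 0.
Proof.
rewrite EX_sum => [|S _]; last by apply: goodZ; exact: good_mono.
rewrite big1// => S _; rewrite EXZ; last exact: good_mono.
have [Ss|/mono_coef_out ->] := boolP (zsum_small d S); last by rewrite mul0r.
have /andP[_ /andP[S1 _]] := Ss.
have /set0Pn[j jS] : S != finset.set0 by rewrite -card_gt0 ltnW.
rewrite (EX_odd hindep hsym (j := j)) ?mulr0//; first exact: good_mono.
by move=> x; rewrite /mono odd_part_prod jS expr1 mulN1r.
Qed.

End HalfGradient.

(** The monomials of [half_grad] are orthogonal, since S is determined by S - j. *)
Lemma EX_half_grad_le : exists2 C : R, 0 <= C & forall n (j : 'I_n.+1),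
  EX X (fun x => half_grad a d j x ^+ 2) <= C.
Proof.
have [K K0 hK] := mono_moment; exists (K * (2 * d%:R * coef_bound a d ^+ 2)) => [|n j].
  by rewrite mulr_ge0// mulr_ge0// sqr_ge0.
rewrite (EX_orth hindep hsym (p := fun S : {set 'I_n.+1} => S :\ j)).
- apply: (le_trans _ (ler_wpM2l K0 (sum_mono_coef_sqr_mem a d j))).
  rewrite mulr_sumr; apply: ler_sum => S jS.
  rewrite EX_sqrZ; last exact: good_mono.
  have [Ss|/mono_coef_out ->] := boolP (zsum_small d S); last first.
    by rewrite mul0r expr0n/= mul0r mulr0.
  have /andP[_ /andP[S1 S2]] := Ss.
  rewrite mulrC ler_pM ?sqr_ge0//.
  + by apply: EX_ge0 => x; exact: sqr_ge0.
  + by apply: hK; rewrite -ltnS (leq_ltn_trans _ S2)// subset_leq_card// subsetDl.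
  rewrite exprMn ler_piMr ?sqr_ge0// -[leRHS](expr1n _ 2) lerXn2r ?nnegrE//.
  by rewrite invf_le1 ?ltr0n ?ler1n ltnW.
- by move=> S S' /= jS jS' E; rewrite -(finset.setD1K jS) E finset.setD1K.
- by move=> S _; apply: goodZ; exact: good_mono.
- by move=> S _; apply: odd_part_scale; exact: odd_part_prod.
Qed.

Lemma EX_main_part_sqr_le : exists2 C : R, 0 <= C & forall n,
  EX X (fun x : 'I_n.+1 -> R => main_part a d x ^+ 2) <= C * rt R n ^+ 2.
Proof.
have [K K0 hK] := mono_moment; exists (K * (d%:R * coef_bound a d ^+ 2)) => [|n].
  by rewrite mulr_ge0// mulr_ge0// sqr_ge0.
rewrite EX_main_part_sqr -mulrA; apply: (le_trans _ (ler_wpM2l K0 (sum_mono_coef_sqr_le a d n))).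
rewrite mulr_sumr; apply: ler_sum => S _.
have [Ss|/mono_coef_out ->] := boolP (zsum_small d S); last by rewrite expr0n/= mul0r mulr0.
have /andP[_ /andP[S1 S2]] := Ss.
by rewrite mulrC ler_wpM2r ?sqr_ge0//; exact: hK.
Qed.

Variable v : R.
Hypothesis v0 : 0 < v.
Hypothesis hv : forall n (j : 'I_n.+1), v <= EX X (fun x => x j ^+ 2).

Lemma EX_mono_sqr n (S : {set 'I_n.+1}) :
  EX X (fun x => mono S x ^+ 2) = \prod_(i in S) EX X (fun x => x i ^+ 2).
Proof.
rewrite -(EX_prod hindep S (f := fun _ t => t ^+ 2)).
- by apply: eq_EX => x; rewrite /mono prodrXl.
- by move=> i; exact: measurable_funX.
- by move=> i; apply: goodX; exact: (good_X mX).
Qed.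

(** Only the sets with d elements are kept. *)
Lemma EX_main_part_sqr_ge : (1 < d)%N -> a d != 0 ->
  exists c C : R, [/\ 0 < c, 0 <= C & forall n,
  c * rt R n ^+ 2 - C * rt R n <= EX X (fun x : 'I_n.+1 -> R => main_part a d x ^+ 2)].
Proof.
move=> d1; have [k dk] : exists k, d = k.+2.
  by case: d d1 => [//|[//|k]] _; exists k.
rewrite {1}dk => ak.
have [C C0 hC] := nset_ge R k.+1.
pose c := a k.+2 ^+ 2 * (k.+2)`!%:R * v ^+ k.+2.
have f0 : 0 < (k.+2)`!%:R :> R by rewrite ltr0n fact_gt0.
have a0 : 0 < a k.+2 ^+ 2 by rewrite exprn_even_gt0.
have c0 : 0 < c by apply: mulr_gt0; [exact: mulr_gt0|exact: exprn_gt0].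
exists c, (c * C); split => // [|n]; first by rewrite mulr_ge0// ltW.
set r := rt R n; have r0 : 0 < r := rt_gt0 R n.
rewrite EX_main_part_sqr.
have hN := hC n; rewrite -/r in hN.
apply: (@le_trans _ _ (coef a n k.+2 ^+ 2 * (k.+2)`!%:R ^+ 2 * v ^+ k.+2 *
    (nset k.+2 (0 : 'I_n.+1))%:R)).
  rewrite coef_sqr -/r.
  have e2 : (2 * k.+2 = 2 * k.+1 + 2)%N by lia.
  have p1 : 0 < r ^+ (2 * k.+1) by rewrite exprn_gt0.
  have p2 : 0 < r ^+ 2 by rewrite exprn_gt0.
  have e4 : r ^+ 4 = r ^+ 2 * r ^+ 2 by rewrite -exprD.
  move: hN; rewrite e2 [r ^+ (2 * k.+1).+1]exprS [r ^+ (2 * k.+1 + 2)]exprD e4 /c.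
  have := ltW c0; rewrite /c.
  move: (r ^+ (2 * k.+1)) (r ^+ 2) p1 p2 => p q p1 p2.
  move: f0 (a k.+2 ^+ 2) (v ^+ k.+2); move: (_)`!%:R (nset _ _)%:R => f m f0 A B ABf hN.
  have pn : p != 0 by rewrite gt_eqF.
  have qn : q != 0 by rewrite gt_eqF.
  have -> : A * (q * q) / (p * q) * f ^+ 2 * B * m = A * f * B * ((f * m * q) / p).
    by field; rewrite pn qn.
  have -> : A * f * B * q - A * f * B * C * r = A * f * B * (q - C * r) by ring.
  rewrite ler_wpM2l// ler_pdivlMr//; move: hN.
  by move=> hN; nra.
rewrite [leRHS](bigID (fun S : {set 'I_n.+1} => (#|S| == k.+2) && ((\sum_(i in S) i)%R == 0)))/=.
rewrite -[leLHS]addr0 lerD//; last first.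
  apply: sumr_ge0 => S _; rewrite mulr_ge0 ?sqr_ge0//.
  by apply: EX_ge0 => x; exact: sqr_ge0.
rewrite mulr_natr /nset -sumr_const [leLHS]big_mkcond [leRHS]big_mkcond/=.
apply: ler_sum => S _; rewrite inE; case: ifP => // /andP[/eqP cs /eqP Ss].
rewrite {1}/mono_coef Ss eqxx cs dk ltnSn/= [(coef _ _ _ * _) ^+ 2]exprMn ler_wpM2l//.
  by rewrite mulr_ge0// sqr_ge0.
rewrite EX_mono_sqr -cs -prodr_const; apply: ler_prod => i _.
by rewrite (ltW v0) hv.
Qed.

End Monomials.

(** * Fluctuations of the Stein factor *)

Section SteinFactor.
Local Close Scope classical_set_scope.
Context d0 (T : measurableType d0) (R : realType) (P : probability T R).
Variable X : nat -> {RV P >-> R}.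
Hypothesis hindep : mutually_independent X.
Hypothesis hsym : forall i, symmetric_rv (X i).
Variable KX : nat -> R.
Hypothesis mX : forall i, mbd P KX (X i).
Variables (tau : nat -> R -> R) (ctau : R).
Hypothesis mtau : forall i, measurable_fun setT (tau i).
Hypothesis btau : forall i x, `|tau i x| <= ctau.
Hypothesis ktau : forall i, is_stein_kernel (distribution P (X i)) (tau i).
Hypothesis etau : forall i x, tau i (- x) = tau i x.
Variables (a : nat -> R) (d : nat).

Let tX i : tame P (X i) := mbd_tame (mX i).

Definition pair_term n (S S' : {set 'I_n.+1}) (j : 'I_n.+1) (x : 'I_n.+1 -> R) :=
  tau j (x j) * (mono (S :\ j) x * mono (S' :\ j) x).

(** The factor of the Stein identity, with the derivatives of the whole trace
    replaced by those of its multilinear part. *)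
Definition stein_main n (x : 'I_n.+1 -> R) :=
  \sum_(j : 'I_n.+1) tau j (x j) * (half_grad a d j x * main_grad a d j x).

(** The pairs (S, S') of monomials with symmetric difference D; as the kernels are
    even, the variables of odd degree in the product are the elements of D. *)
Definition stein_class n (D : {set 'I_n.+1}) (x : 'I_n.+1 -> R) :=
  \sum_S \sum_(j in S :\: D)
    mono_coef a d S / #|S|%:R * mono_coef a d (sdiff S D) * pair_term S (sdiff S D) j x.

Lemma good_pair n (S S' : {set 'I_n.+1}) j : good X (pair_term S S' j).
Proof.
apply: goodM; first exact: (good_tau X mtau btau).
by apply: goodM; exact: (good_mono mX).
Qed.

Lemma good_stein_class n (D : {set 'I_n.+1}) : good X (stein_class D).
Proof.
by apply: good_sum => S _; apply: good_sum => j _; apply: goodZ; exact: good_pair.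
Qed.

Lemma stein_main_split n (x : 'I_n.+1 -> R) :
  stein_main x = \sum_(D : {set 'I_n.+1}) stein_class D x.
Proof.
pose g S S' j := mono_coef a d S / #|S|%:R * mono_coef a d S' * pair_term S S' j x.
have E (j : 'I_n.+1) : tau j (x j) * (half_grad a d j x * main_grad a d j x) =
    \sum_(S : {set 'I_n.+1}) \sum_(S' : {set 'I_n.+1}) if (j \in S) && (j \in S') then g S S' j else 0.
  rewrite /half_grad /main_grad big_distrlr/= mulr_sumr big_mkcond/=; apply: eq_bigr => S _.
  case: (j \in S) => /=; last by rewrite big1.
  rewrite mulr_sumr big_mkcond/=; apply: eq_bigr => S' _; case: ifP => // _.
  by rewrite /g /pair_term; ring.
rewrite /stein_main (eq_bigr _ (fun j _ => E j)) exchange_big/=.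
rewrite /stein_class [RHS]exchange_big/=; apply: eq_bigr => S _.
rewrite exchange_big/= (reindex_inj (inv_inj (sdiffK S)))/=; apply: eq_bigr => D _.
rewrite [RHS]big_mkcond/=; apply: eq_bigr => j _; rewrite in_sdiff finset.in_setD.
by case: (j \in S); case: (j \in D).
Qed.

Lemma odd_part_class n (D : {set 'I_n.+1}) : odd_part (stein_class D) D.
Proof.
move=> i x; rewrite mulr_sumr; apply: eq_bigr => S _.
rewrite mulr_sumr; apply: eq_bigr => j; rewrite finset.in_setD => /andP[jD jS].
rewrite [RHS]mulrCA; congr (_ * _); rewrite /pair_term.
have -> : tau j (flip i x j) = tau j (x j).
  by rewrite /flip /upd; case: eqP => // ->.
rewrite [RHS]mulrCA; congr (_ * _).
rewrite /mono !odd_part_prod mulrACA; congr (_ * _).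
rewrite !in_setD1 in_sdiff; case: eqVneq => [->|_] /=.
  by rewrite (negbTE jD) mulr1.
by rewrite -signr_addb addbA addbb.
Qed.

Lemma pair_moment : exists2 K : R, 0 <= K & forall n (S S' : {set 'I_n.+1}) j,
  (#|S| <= d)%N -> (#|S'| <= d)%N -> EX X (fun x => pair_term S S' j x ^+ 2) <= K.
Proof.
have [K hK] := mono_mbd mX d.
have mt i : mbd P (fun p => ctau ^+ (2 * p)) (fun w => tau i (X i w)).
  by apply: mbd_bounded => //; exact: measurableT_comp.
exists (Num.max 0 (mulK (fun p => ctau ^+ (2 * p)) (mulK K K) 1%N)); first by rewrite le_max lexx.
move=> n S S' j Sd S'd; rewrite le_max; apply/orP; right.
have le_d (A : {set 'I_n.+1}) : (#|A| <= d)%N -> (#|A :\ j| <= d)%N.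
  by apply: leq_trans; rewrite subset_leq_card// subsetDl.
apply: (@mbd_sqr_le _ _ _ _ (mulK (fun p => ctau ^+ (2 * p)) (mulK K K))
  (fun w => pair_term S S' j (coords X w))).
apply: (mbdM (mt j)); apply: mbdM; apply: hK; exact: le_d.
Qed.

Let avg_le n (K : R) (c0 : R) (S D : {set 'I_n.+1}) (F : 'I_n.+1 -> ('I_n.+1 -> R) -> R) :
  0 <= K -> (forall j, good X (F j)) -> (forall j, EX X (fun x => F j x ^+ 2) <= K) ->
  EX X (fun x => (\sum_(j in S :\: D) c0 / #|S|%:R * F j x) ^+ 2) <= K * `|c0| ^+ 2.
Proof.
move=> K0 gF FK; have := @EX_wsum_sqr_le _ _ _ P X n.+1 'I_n.+1 (fun j => j \in S :\: D)
  (fun=> c0 / #|S|%:R) F K (fun j _ => gF j) (fun j _ => FK j).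
move=> h; apply: (le_trans h).
rewrite ler_wpM2l// lerXn2r ?nnegrE ?sumr_ge0// sumr_const -[leLHS]mulr_natl.
rewrite normrM normfV normr_nat mulrCA ler_piMr//.
have [->|S0] := eqVneq S finset.set0; first by rewrite finset.set0D cards0 mul0r.
rewrite ler_pdivrMr ?ltr0n ?card_gt0// mul1r ler_nat subset_leq_card// subsetDl//.
Qed.

Lemma EX_stein_class_le : exists2 K : R, 0 <= K & forall n (D : {set 'I_n.+1}),
  EX X (fun x => stein_class D x ^+ 2) <= K * class_weight a d D ^+ 2.
Proof.
have [K K0 hK] := pair_moment; exists K => // n D.
pose w (S : {set 'I_n.+1}) := if S :\: D == finset.set0 then 0 else `|mono_coef a d S * mono_coef a d (sdiff S D)|.
have -> : class_weight a d D = \sum_S w S.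
  by rewrite /class_weight big_mkcond/=; apply: eq_bigr => S _; rewrite /w; case: eqP.
apply: EX_sum_sqr_le => S _.
- by apply: good_sum => j _; apply: goodZ; exact: good_pair.
- by rewrite /w; case: ifP.
rewrite /w; case: eqP => [->|_].
  by under eq_EX do rewrite big_set0 expr0n; rewrite EX_cst expr0n mulr0.
have [/andP[Ss S's]|h] := boolP (zsum_small d S && zsum_small d (sdiff S D)); last first.
  have -> : mono_coef a d S * mono_coef a d (sdiff S D) = 0.
    by move: h; rewrite negb_and => /orP[] /mono_coef_out ->; rewrite ?mul0r ?mulr0.
  rewrite normr0 expr0n/= mulr0.
  under eq_EX => x.
    rewrite big1 ?expr0n => [|j _]; first over.
    by move: h; rewrite negb_and => /orP[] /mono_coef_out ->; rewrite ?(mul0r, mulr0).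
  by rewrite EX_cst.
have /andP[_ /andP[_ h1]] := Ss; have /andP[_ /andP[_ h2]] := S's.
have := @avg_le n K (mono_coef a d S * mono_coef a d (sdiff S D)) S D
  (fun j => pair_term S (sdiff S D) j) K0 (fun j => good_pair _ _ j)
  (fun j => hK n S _ j h1 h2).
apply: le_trans; rewrite le_eqVlt; apply/orP; left; apply/eqP; apply: eq_EX => x.
by congr (_ ^+ 2); apply: eq_bigr => j _; rewrite [_ / _ * _]mulrAC.
Qed.

Lemma EX_odd_classes_le : exists2 C : R, 0 <= C & forall n,
  EX X (fun x => (\sum_(D : {set 'I_n.+1} | D != finset.set0) stein_class D x) ^+ 2)
  <= C * rt R n ^+ 2.
Proof.
have [K K0 hK] := EX_stein_class_le.
exists (K * (2 * weight_bound a d * coef_bound a d ^+ 2 * d%:R ^+ 2 * 2 ^+ d)) => [|n].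
  by rewrite mulr_ge0// !mulr_ge0 ?weight_bound_ge0 ?coef_bound_ge0// exprn_ge0.
rewrite (EX_orth hindep hsym (p := id)).
- rewrite -mulrA; apply: (le_trans _ (ler_wpM2l K0 (sum_class_weight_sqr_le a d n))).
  by rewrite mulr_sumr; apply: ler_sum => D _; exact: hK.
- by move=> D D' _ _.
- by move=> D _; exact: good_stein_class.
- by move=> D _; exact: odd_part_class.
Qed.

Section EvenClass.
Variable n : nat.
Notation Z := 'I_n.+1.
Implicit Types S : {set Z}.

Definition even_term S (x : Z -> R) :=
  mono_coef a d S ^+ 2 / #|S|%:R * \sum_(j : Z | j \in S) tau j (x j) * mono (S :\ j) x ^+ 2.

Lemma stein_class0 x : stein_class finset.set0 x = \sum_S even_term S x.
Proof.
apply: eq_bigr => S _; rewrite finset.setD0 /even_term mulr_sumr; apply: eq_bigr => j _.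
have -> : sdiff S finset.set0 = S by apply/setP => i; rewrite in_sdiff inE addbF.
by rewrite /pair_term; ring.
Qed.

(** The factors of tau_j times the squared monomial; the one of index i has mean
    E X_i^2, whether or not i = j. *)
Let fS (j i : Z) (t : R) := if i == j then tau j t else t ^+ 2.

Let fSE S (j : Z) (x : Z -> R) : j \in S -> \prod_(i in S) fS j i (x i) = tau j (x j) * mono (S :\ j) x ^+ 2.
Proof.
move=> jS; rewrite (big_setD1 j jS)/= {1}/fS eqxx; congr (_ * _).
rewrite /mono -prodrXl; apply: eq_bigr => i; rewrite !inE => /andP[/negbTE ij _].
by rewrite /fS ij.
Qed.

Let mfS j i : measurable_fun setT (fS j i).
Proof.
rewrite /fS; case: (i == j); first exact: mtau.
exact: measurable_funX.
Qed.

Let gfS j i : good X (fun x => fS j i (x i)).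
Proof.
rewrite /fS; case: eqP => [->|_]; first exact: (good_tau X mtau btau).
by apply: goodX; exact: (good_X mX).
Qed.

Let EX_fS j i : EX X (fun x => fS j i (x i)) = EX X (fun x => x i ^+ 2).
Proof.
rewrite /fS; case: eqP => [->|_] //.
exact: (EX_tau mtau btau ktau tX).
Qed.

Let goodfS S (j : Z) : good X (fun x => tau j (x j) * mono (S :\ j) x ^+ 2).
Proof.
apply: goodM; first exact: (good_tau X mtau btau).
by apply: goodX; exact: (good_mono mX).
Qed.

Lemma good_even_term S : good X (even_term S).
Proof. by apply: goodZ; apply: good_sum => j _. Qed.

(** By independence, and since the Stein kernel has mean E X_j^2. *)
Lemma EX_even_term S : EX X (even_term S) = mono_coef a d S ^+ 2 * EX X (fun x => mono S x ^+ 2).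
Proof.
rewrite EXZ ?EX_sum//; last by apply: good_sum => j _.
rewrite (eq_bigr (fun=> EX X (fun x => mono S x ^+ 2))) => [|j jS]; last first.
  rewrite (EX_mono_sqr hindep mX).
  rewrite -(eq_bigr _ (fun i _ => EX_fS j i)) -(EX_prod hindep S (f := fS j))//.
  by apply: eq_EX => x; rewrite fSE.
rewrite sumr_const -[X in _ * X]mulr_natl mulrA; congr (_ * _).
have [S0|S0] := eqVneq #|S| 0%N.
  by rewrite mono_coef_out ?expr0n ?mul0r// /zsum_small S0 andbF.
by rewrite mulfVK// pnatr_eq0.
Qed.

Lemma EX_even_indep S S' : [disjoint S & S'] ->
  EX X (fun x => even_term S x * even_term S' x) =
  EX X (even_term S) * EX X (even_term S').
Proof.
move=> dS; have gS' := good_even_term S'; set k := mono_coef a d S ^+ 2 / #|S|%:R.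
have gp j : good X (fun x => \prod_(i in S) fS j i (x i)) by apply: good_prod => i _.
have -> : EX X (fun x => even_term S x * even_term S' x) =
    EX X (fun x => \sum_(j in S) k * (\prod_(i in S) fS j i (x i) * even_term S' x)).
  apply: eq_EX => x; rewrite {1}/even_term -/k mulr_sumr mulr_suml.
  by apply: eq_bigr => j jS; rewrite -fSE// mulrA.
have -> : EX X (even_term S) =
    \sum_(j in S) k * \prod_(i in S) EX X (fun x => fS j i (x i)).
  rewrite EXZ ?EX_sum//; last by apply: good_sum => j _.
  rewrite mulr_sumr; apply: eq_bigr => j jS; congr (_ * _).
  by rewrite -(EX_prod hindep S (f := fS j))//; apply: eq_EX => x; rewrite fSE.
rewrite EX_sum => [|j _]; last by apply: goodZ; exact: goodM.
rewrite mulr_suml; apply: eq_bigr => j jS.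
rewrite EXZ; last exact: goodM.
rewrite (EX_indep_prod hindep (f := fS j))// ?mulrA// => i x t iS.
congr (_ * _); apply: eq_bigr => l lS'.
have iS' : i \notin S' by rewrite (disjointFr dS iS).
have li : (l == i) = false by apply: contraNF iS' => /eqP <-.
rewrite {1}/upd li; congr (_ * _ ^+ 2); apply: eq_bigr => m; rewrite !inE => /andP[_ mS'].
by rewrite /upd; case: eqP => // mi; rewrite -mi mS' in iS'.
Qed.

End EvenClass.

Lemma EX_even_term_le : exists2 K : R, 0 <= K & forall n (S : {set 'I_n.+1}),
  EX X (fun x => even_term S x ^+ 2) <= K * (mono_coef a d S ^+ 2) ^+ 2.
Proof.
have [K K0 hK] := pair_moment; exists K => // n S.
have [Ss|/mono_coef_out h] := boolP (zsum_small d S); last first.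
  rewrite h expr0n/= expr0n/= mulr0.
  under eq_EX do rewrite /even_term h expr0n/= mul0r mul0r expr0n/=.
  by rewrite EX_cst.
have /andP[_ /andP[_ h1]] := Ss.
have := @avg_le n K (mono_coef a d S ^+ 2) S finset.set0 (fun j => pair_term S S j) K0.
rewrite finset.setD0 ger0_norm ?sqr_ge0// => h.
apply: le_trans (h _ _) => [|j|j]; [|exact: good_pair|exact: hK].
rewrite le_eqVlt; apply/orP; left; apply/eqP; apply: eq_EX => x; congr (_ ^+ 2).
rewrite /even_term mulr_sumr; apply: eq_bigr => j _.
by rewrite /pair_term expr2.
Qed.

(** Terms with disjoint index sets are uncorrelated; pairs with a common index j
    are counted through the sum over j of the squared sums over S containing j. *)
Lemma EX_even_class_le : exists2 C : R, 0 <= C & forall n,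
  EX X (fun x : 'I_n.+1 -> R => (stein_class finset.set0 x -
    EX X (fun x : 'I_n.+1 -> R => main_part a d x ^+ 2)) ^+ 2) <= C * rt R n ^+ 2.
Proof.
have [K K0 hK] := EX_even_term_le.
exists (K * (2 * d%:R * coef_bound a d ^+ 2) ^+ 2) => [|n]; first by rewrite mulr_ge0// sqr_ge0.
pose u (S : {set 'I_n.+1}) x := even_term S x - EX X (even_term S).
have gu S : good X (u S) by apply: goodB; [exact: good_even_term|exact: good_cst].
have -> : EX X (fun x : 'I_n.+1 -> R => (stein_class finset.set0 x -
    EX X (fun x : 'I_n.+1 -> R => main_part a d x ^+ 2)) ^+ 2) =
    \sum_S \sum_S' EX X (fun x => u S x * u S' x).
  transitivity (EX X (fun x => (\sum_S u S x) ^+ 2)).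
    apply: eq_EX => x; congr (_ ^+ 2).
    rewrite stein_class0 (EX_main_part_sqr hindep hsym mX) /u sumrB; congr (_ - _).
    by apply: eq_bigr => S _; rewrite EX_even_term.
  under eq_EX do rewrite expr2 big_distrlr/=.
  rewrite EX_sum => [|S _]; last by apply: good_sum => S' _; exact: goodM.
  by apply: eq_bigr => S _; rewrite EX_sum// => S' _; exact: goodM.
have u2 S : EX X (fun x => u S x ^+ 2) <= K * (mono_coef a d S ^+ 2) ^+ 2.
  apply: (le_trans _ (hK n S)).
  rewrite /u EX_center_sqr; last exact: good_even_term.
  by rewrite lerBlDr lerDl sqr_ge0.
have cov S S' : EX X (fun x => u S x * u S' x) <=
    K * \sum_j (if (j \in S) && (j \in S') then mono_coef a d S ^+ 2 * mono_coef a d S' ^+ 2 else 0).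
  have s0 : 0 <= \sum_j (if (j \in S) && (j \in S') then mono_coef a d S ^+ 2 * mono_coef a d S' ^+ 2 else 0).
    by apply: sumr_ge0 => j _; case: ifP => // _; rewrite mulr_ge0// sqr_ge0.
  have [dS|] := boolP [disjoint S & S'].
    suff -> : EX X (fun x => u S x * u S' x) = 0 by rewrite mulr_ge0.
    have [g1 g2] := (good_even_term S, good_even_term S').
    set e := EX X (even_term S); set e' := EX X (even_term S').
    transitivity (EX X (fun x => even_term S x * even_term S' x -
        (e * even_term S' x + (e' * even_term S x - e * e')))).
      by apply: eq_EX => x; rewrite /u -/e -/e'; ring.
    have gc := good_cst X n.+1 (e * e').
    have [z1 z2] := (goodZ e g2, goodZ e' g1).
    rewrite EXB; [|exact: goodM|by apply: goodD => //; exact: goodB].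
    rewrite EXD//; last exact: goodB.
    rewrite (EXB z2 gc) EX_cst (EXZ e g2) (EXZ e' g1) EX_even_indep// -/e -/e'; ring.
  rewrite -setI_eq0 => /set0Pn[j]; rewrite inE => jSS'.
  apply: (le_trans (ler_norm _)).
  apply: (le_trans (EX_cs (gu S) (gu S') (sqr_ge0 _) (sqr_ge0 _) (u2 S) (u2 S'))).
  rewrite ler_wpM2l// (bigD1 j)//= jSS' lerDl sumr_ge0// => i _.
  by case: ifP => // _; rewrite mulr_ge0// sqr_ge0.
apply: (le_trans (ler_sum _ (fun S _ => ler_sum _ (fun S' _ => cov S S')))).
under eq_bigr do rewrite -mulr_sumr.
rewrite -mulr_sumr -mulrA ler_wpM2l//.
rewrite (_ : \sum_S _ = \sum_(j : 'I_n.+1) (\sum_(S : {set 'I_n.+1} | j \in S) mono_coef a d S ^+ 2) ^+ 2).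
  rewrite rt_sqr mulr_natr -[X in _ *+ X](card_ord n.+1) -sumr_const; apply: ler_sum => j _.
  have s0 : 0 <= \sum_(S : {set 'I_n.+1} | j \in S) mono_coef a d S ^+ 2.
    by apply: sumr_ge0 => S _; exact: sqr_ge0.
  have b0 : 0 <= 2 * d%:R * coef_bound a d ^+ 2 by rewrite mulr_ge0// sqr_ge0.
  by rewrite lerXn2r ?nnegrE// sum_mono_coef_sqr_mem.
under eq_bigr do rewrite exchange_big/=.
rewrite exchange_big/=; apply: eq_bigr => j _.
rewrite expr2 big_distrlr/= [RHS]big_mkcond/=; apply: eq_bigr => S _.
case: (j \in S) => /=; last by rewrite big1.
by rewrite [RHS]big_mkcond.
Qed.

(** Its mean is the variance of the multilinear part, which comes entirely from the
    class D = 0. *)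
Lemma EX_stein_main_le : exists2 C : R, 0 <= C & forall n,
  EX X (fun x : 'I_n.+1 -> R => (stein_main x -
    EX X (fun x : 'I_n.+1 -> R => main_part a d x ^+ 2)) ^+ 2) <= C * rt R n ^+ 2.
Proof.
have [C1 C10 h1] := EX_odd_classes_le; have [C2 C20 h2] := EX_even_class_le.
exists (2 * (C1 + C2)) => [|n]; first by rewrite mulr_ge0// addr_ge0.
set m2 := EX X (fun x : 'I_n.+1 -> R => main_part a d x ^+ 2).
have g0 : good X (fun x => (stein_class (finset.set0 : {set 'I_n.+1}) x - m2) ^+ 2).
  by apply: goodX; apply: goodB; [exact: good_stein_class|exact: good_cst].
have g1 : good X (fun x => (\sum_(D : {set 'I_n.+1} | D != finset.set0) stein_class D x) ^+ 2).
  by apply: goodX; apply: good_sum => D _; exact: good_stein_class.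
apply: (@le_trans _ _ (EX X (fun x =>
   2 * ((\sum_(D : {set 'I_n.+1} | D != finset.set0) stein_class D x) ^+ 2 +
   (stein_class (finset.set0 : {set 'I_n.+1}) x - m2) ^+ 2)))).
  apply: EX_le => [||x].
  - apply: goodX; apply: goodB; last exact: good_cst.
    have -> : @stein_main n = fun x => \sum_(D : {set 'I_n.+1}) stein_class D x.
      by apply/funext => x; exact: stein_main_split.
    by apply: good_sum => D _; exact: good_stein_class.
  - by apply: goodZ; exact: goodD.
  rewrite stein_main_split (bigD1 finset.set0)//=; set U := \sum_(i | _) _.
  move: (stein_class _ x) => V; rewrite -addrA addrCA.
  by have := sqr_ge0 (U - (V - m2)); rewrite [(U + _) ^+ 2]sqrrD sqrrB; lra.
rewrite EXZ ?EXD//; last exact: goodD.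
have := lerD (h1 n) (h2 n); rewrite -/m2 -mulrDl => h.
by have := ler_wpM2l (ler0n R 2) h; rewrite mulrA.
Qed.

End SteinFactor.

(** * Stein discrepancy of the trace *)

Section SteinDiscrepancy.
Local Close Scope classical_set_scope.
Context d0 (T : measurableType d0) (R : realType) (P : probability T R).
Variable X : nat -> {RV P >-> R}.
Hypothesis hindep : mutually_independent X.
Hypothesis hsym : forall i, symmetric_rv (X i).
Variable KX : nat -> R.
Hypothesis mX : forall i, mbd P KX (X i).
Variables (tau : nat -> R -> R) (ctau : R).
Hypothesis mtau : forall i, measurable_fun setT (tau i).
Hypothesis btau : forall i x, `|tau i x| <= ctau.
Hypothesis ktau : forall i, is_stein_kernel (distribution P (X i)) (tau i).
Hypothesis etau : forall i x, tau i (- x) = tau i x.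
Variables (a : nat -> R) (d : nat).

Let tX i : tame P (X i) := mbd_tame (mX i).

(** The Stein factor T of the normalized trace, up to its variance. *)
Definition stein_factor n (x : 'I_n.+1 -> R) :=
  \sum_(j : 'I_n.+1) tau j (x j) * (half_grad a d j x * grad a d j x).

Definition center n : R := EX X (fun x : 'I_n.+1 -> R => trace_poly a d x).

Definition spread n : R :=
  EX X (fun x : 'I_n.+1 -> R => (trace_poly a d x - center n) ^+ 2).

Definition normalized n (x : 'I_n.+1 -> R) :=
  (trace_poly a d x - center n) / Num.sqrt (spread n).

Definition main_spread n : R := EX X (fun x : 'I_n.+1 -> R => main_part a d x ^+ 2).

Definition rest0 n (x : 'I_n.+1 -> R) := rest a d x - EX X (rest a d (n := n)).

Lemma good_trace n : good X (trace_poly a d (n := n)).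
Proof.
have -> : trace_poly a d (n := n) = fun x => main_part a d x + rest a d x.
  by apply/funext => x; exact: trace_poly_split.
by apply: goodD; [exact: (good_main_part mX)|exact: (good_rest mX)].
Qed.

Lemma good_grad n j : good X (grad a d (n := n) j).
Proof.
have -> : grad a d (n := n) j = fun x => main_grad a d j x + rest_grad a d j x.
  by apply/funext => x; exact: grad_split.
by apply: goodD; [exact: (good_main_grad mX)|exact: (good_rest_grad mX)].
Qed.

Lemma good_rest0 n : good X (rest0 (n := n)).
Proof. by apply: goodB; [exact: (good_rest mX)|exact: good_cst]. Qed.

Lemma trace_center n (x : 'I_n.+1 -> R) :
  trace_poly a d x - center n = main_part a d x + rest0 x.
Proof.
have -> : center n = EX X (rest a d (n := n)).
  rewrite /center (eq_EX X (trace_poly_split a d (n := n))).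
  rewrite EXD; [|exact: (good_main_part mX)|exact: (good_rest mX)].
  by rewrite (EX_main_part hindep hsym mX) add0r.
by rewrite trace_poly_split addrA.
Qed.

Lemma EX_rest0_le : exists2 C : R, 0 <= C & forall n,
  EX X (fun x : 'I_n.+1 -> R => rest0 x ^+ 2) <= C.
Proof.
have [C C0 hC] := EX_rest_le hindep hsym mX a d; exists C => // n.
rewrite /rest0 EX_center_sqr; last exact: (good_rest mX).
by apply: (le_trans _ (hC n)); rewrite lerBlDr lerDl sqr_ge0.
Qed.

(** By Cauchy-Schwarz, g having second moment at most 1. *)
Let EX_mul1_le n (h g : ('I_n -> R) -> R) (B : R) : good X h -> good X g -> 0 <= B ->
  (forall x, `|g x| <= 1) -> EX X (fun x => h x ^+ 2) <= B ^+ 2 ->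
  `|EX X (fun x => h x * g x)| <= B.
Proof.
move=> gh gg B0 g1 hB.
have := @EX_cs _ _ _ _ X n h g 1 B 1 gh gg B0 ler01; rewrite !mul1r mulr1; apply=> //.
rewrite -[X in _ <= X](EX_cst X n (1 ^+ 2)); apply: EX_le => [||x].
- exact: goodX.
- exact: good_cst.
- by rewrite -[leLHS]real_normK ?num_real// lerXn2r ?nnegrE.
Qed.

Lemma spread_diff_le : exists2 C : R, 0 <= C & forall n,
  `|spread n - main_spread n| <= C * rt R n.
Proof.
have [C1 C10 h1] := EX_main_part_sqr_le hindep hsym mX a d.
have [C2 C20 h2] := EX_rest0_le.
exists (2 * (Num.sqrt C1 * Num.sqrt C2) + C2) => [|n].
  by rewrite addr_ge0// mulr_ge0// mulr_ge0 ?sqrtr_ge0.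
have r1 := rt_ge1 R n; have r0 := rt_gt0 R n.
have [gm gr] := (good_main_part mX a d n, good_rest0 n).
have -> : spread n - main_spread n = 2 * EX X (fun x : 'I_n.+1 -> R => main_part a d x * rest0 x) +
    EX X (fun x : 'I_n.+1 -> R => rest0 x ^+ 2).
  have -> : spread n = EX X (fun x : 'I_n.+1 -> R => main_part a d x ^+ 2 +
      (2 * (main_part a d x * rest0 x) + rest0 x ^+ 2)).
    by apply: eq_EX => x; rewrite trace_center; ring.
  have gmr := goodM gm gr.
  rewrite EXD; [|exact: goodX|by apply: goodD; [exact: goodZ|exact: goodX]].
  rewrite EXD; [|exact: goodZ|exact: goodX].
  by rewrite EXZ// /main_spread addrC addKr.
have hmr : `|EX X (fun x : 'I_n.+1 -> R => main_part a d x * rest0 x)| <=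
    1 * ((Num.sqrt C1 * rt R n) * Num.sqrt C2).
  apply: EX_cs => //; rewrite ?mulr_ge0 ?sqrtr_ge0 ?(ltW r0)//.
    by rewrite mul1r exprMn sqr_sqrtr.
  by rewrite mul1r sqr_sqrtr.
apply: (le_trans (ler_normD _ _)); rewrite normrM ger0_norm// [leRHS]mulrDl lerD//.
  apply: (le_trans (ler_wpM2l (ler0n R 2) hmr)).
  by rewrite le_eqVlt; apply/orP; left; apply/eqP; ring.
rewrite ger0_norm; last by apply: EX_ge0 => x; exact: sqr_ge0.
by apply: (le_trans (h2 n)); rewrite ler_peMr.
Qed.

Lemma good_stein_factor n : good X (stein_factor (n := n)).
Proof.
apply: good_sum => j _; apply: goodM; first exact: (good_tau X mtau btau).
by apply: goodM; [exact: (good_half_grad mX)|exact: good_grad].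
Qed.

(** The derivative of the rest contributes a sum of N products whose first factors
    are O(1) each and whose second factors are O(1) in total: O(r) by Young's
    inequality with weight 1/r. *)
Lemma stein_factor_le : exists2 C : R, 0 <= C & forall n (g : ('I_n.+1 -> R) -> R),
  good X g -> (forall x, `|g x| <= 1) ->
  `|EX X (fun x => (main_spread n - stein_factor x) * g x)| <= C * rt R n.
Proof.
have [C1 C10 h1] := EX_stein_main_le hindep hsym mX mtau btau ktau etau a d.
have [C2 C20 h2] := EX_half_grad_le hindep hsym mX a d.
have [C3 C30 h3] := EX_rest_grad_le hindep hsym mX a d.
have ct0 : 0 <= ctau by apply: le_trans (btau 0 0).
exists (Num.sqrt C1 + (C2 + ctau ^+ 2 * C3) / 2) => [|n g gg g1].
  by rewrite addr_ge0 ?sqrtr_ge0// divr_ge0// addr_ge0// mulr_ge0// sqr_ge0.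
have r0 := rt_gt0 R n.
pose h x := main_spread n - stein_main tau a d (n := n) x.
pose rg (j : 'I_n.+1) (x : 'I_n.+1 -> R) := tau j (x j) * g x * rest_grad a d (n := n) j x.
have gT : good X (stein_main tau a d (n := n)).
  apply: good_sum => j _; apply: goodM; first exact: (good_tau X mtau btau).
  by apply: goodM; [exact: (good_half_grad mX)|exact: (good_main_grad mX)].
have gh : good X h by apply: goodB => //; exact: good_cst.
have grg j : good X (rg j).
  apply: goodM; last exact: (good_rest_grad mX).
  by apply: goodM => //; exact: (good_tau X mtau btau).
have ghf j : good X (half_grad a d (n := n) j) by exact: (good_half_grad mX).
have -> : EX X (fun x => (main_spread n - stein_factor x) * g x) =
    EX X (fun x => h x * g x) - \sum_j EX X (fun x => half_grad a d j x * rg j x).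
  rewrite -EX_sum => [|j _]; last exact: goodM.
  rewrite -EXB; last 2 first.
  - exact: goodM.
  - by apply: good_sum => j _; exact: goodM.
  apply: eq_EX => x; rewrite /h /stein_factor /stein_main.
  under eq_bigr do rewrite grad_split mulrDr mulrDr.
  rewrite big_split/= opprD addrA mulrDl; congr (_ + _).
  rewrite mulNr mulr_suml; congr (- _); apply: eq_bigr => j _.
  by rewrite /rg; ring.
apply: (le_trans (ler_normB _ _)); rewrite mulrDl lerD//.
  apply: EX_mul1_le => //; first by rewrite mulr_ge0 ?sqrtr_ge0// ltW.
  rewrite exprMn sqr_sqrtr//; apply: le_trans (h1 n).
  rewrite le_eqVlt; apply/orP; left; apply/eqP; apply: eq_EX => x.
  by rewrite /h -sqrrN opprB.
apply: (le_trans (ler_norm_sum _ _ _)).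
have rg2 j : EX X (fun x => rg j x ^+ 2) <= ctau ^+ 2 * EX X (fun x => rest_grad a d j x ^+ 2).
  rewrite -EXZ; last by apply: goodX; exact: (good_rest_grad mX).
  apply: EX_le => [||x]; first exact: goodX.
    by apply: goodZ; apply: goodX; exact: (good_rest_grad mX).
  rewrite /rg exprMn ler_wpM2r ?sqr_ge0// -[leLHS]real_normK ?num_real//.
  rewrite lerXn2r ?nnegrE// normrM -[leRHS]mulr1.
  by rewrite ler_pM.
have term j : `|EX X (fun x => half_grad a d j x * rg j x)| <=
   ((rt R n)^-1 * C2 + rt R n * (ctau ^+ 2 * EX X (fun x => rest_grad a d j x ^+ 2))) / 2.
  have [[_ t1] [_ t2]] := (ghf j, grg j).
  apply: (le_trans (Ex_norm_le (tameM t1 t2))).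
  have l0 : 0 < (rt R n)^-1 by rewrite invr_gt0.
  apply: (le_trans (Ex_young l0 t1 t2)); rewrite ler_pM2r// invrK lerD//.
    by rewrite ler_wpM2l ?(ltW l0)//; exact: h2.
  by rewrite ler_wpM2l ?(ltW r0)//; exact: rg2.
apply: (le_trans (ler_sum _ (fun j _ => term j))).
rewrite -mulr_suml big_split/= sumr_const card_ord -[X in X + _]mulr_natl -rt_sqr -!mulr_sumr.
have w0 : 0 <= rt R n * ctau ^+ 2 by rewrite mulr_ge0 ?sqr_ge0// ltW.
have := ler_wpM2l w0 (h3 n); move: (\sum_(_ < _) _) => S3.
have -> : rt R n ^+ 2 * ((rt R n)^-1 * C2) = rt R n * C2 by field; rewrite gt_eqF.
by move: (rt R n) => r; lra.
Qed.

(** Stein's identity for the centered trace, from integration by parts in each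
    coordinate of the main part. *)
Lemma stein_identity n (f df : R -> R) : stein_test f df -> 0 < spread n ->
  let s := Num.sqrt (spread n) in let W := normalized (n := n) in
  [/\ good X (fun x => df (W x)), good X (fun x => f (W x)) &
  EX X (fun x => df (W x)) - EX X (fun x => W x * f (W x)) =
  (spread n)^-1 * EX X (fun x => (spread n - stein_factor x) * df (W x)) -
  s^-1 * EX X (fun x => rest0 x * f (W x))].
Proof.
move=> [Df cdf f1 df1] sp0 s W.
have s0 : 0 < s by rewrite sqrtr_gt0.
have ss : s ^+ 2 = spread n by rewrite sqr_sqrtr// ltW.
have gW : good X W.
  have -> : W = fun x => s^-1 * (trace_poly a d x - center n).
    by apply/funext => x; rewrite mulrC.
  by apply: goodZ; apply: goodB; [exact: good_trace|exact: good_cst].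
have cf : continuous f by move=> y; exact: is_derive_continuous (Df y).
have gcomp (g : R -> R) : continuous g -> (forall y, `|g y| <= 1) -> good X (fun x => g (W x)).
  move=> cg gc; have mg : measurable_fun setT g by exact: continuous_measurable_fun.
  split; first by apply: (measurableT_comp mg); exact: gW.1.
  apply: (@tame_bounded _ _ _ _ _ 1) => //.
  by apply: (measurableT_comp mg); exact: tame_measurable gW.2.
have gdf := gcomp _ cdf df1; have gf := gcomp _ cf f1; split=> //.
have gm := good_main_part mX a d n; have gr := good_rest0 n.
have gT := good_stein_factor n.
have E1 : EX X (fun x => W x * f (W x)) = s^-1 *
    (EX X (fun x => main_part a d x * f (W x)) + EX X (fun x => rest0 x * f (W x))).
  rewrite -EXD; [|exact: goodM|exact: goodM].
  rewrite -EXZ; last by apply: goodD; exact: goodM.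
  by apply: eq_EX => x; rewrite {1}/W /normalized trace_center; ring.
have E2 : EX X (fun x => main_part a d x * f (W x)) =
    s^-1 * EX X (fun x => stein_factor x * df (W x)).
  have gtj (j : 'I_n.+1) : good X (fun x => x j * (half_grad a d j x * f (W x))).
    apply: goodM; first exact: (good_X mX).
    by apply: goodM => //; exact: (good_half_grad mX).
  have gtj' (j : 'I_n.+1) : good X (fun x =>
      tau j (x j) * (half_grad a d j x * (s^-1 * df (W x) * grad a d j x))).
    apply: goodM; first exact: (good_tau X mtau btau).
    apply: goodM; first exact: (good_half_grad mX).
    by apply: goodM; [exact: goodZ|exact: good_grad].
  transitivity (\sum_(j : 'I_n.+1) EX X (fun x => x j * (half_grad a d j x * f (W x)))).
    rewrite -EX_sum//; apply: eq_EX => x; rewrite main_part_grad mulr_suml.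
    by apply: eq_bigr => j _; rewrite mulrA.
  transitivity (\sum_(j : 'I_n.+1) EX X (fun x =>
      tau j (x j) * (half_grad a d j x * (s^-1 * df (W x) * grad a d j x)))).
    apply: eq_bigr => j _.
    have sV : 0 < s^-1 by rewrite invr_gt0.
    apply: (EX_stein hindep mtau btau ktau tX (A := half_grad a d j)
      (F := trace_poly a d (n := n)) (D := grad a d j)
      (Q := fun x => trace_poly_at a d x j)
      (f := fun y => f ((y - center n) / s))
      (df := fun y => s^-1 * df ((y - center n) / s)) (c := 1 + s^-1)).
    - exact: (good_half_grad mX).
    - exact: good_trace.
    - exact: good_grad.
    - by move=> x t; exact: half_grad_upd.
    - by move=> x t; exact: trace_poly_upd.
    - by move=> x t; exact: grad_upd.
    - move=> y.
      have h : is_derive y 1 (fun y : R => (y - center n) / s) s^-1.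
        under eq_fun do rewrite mulrC.
        by apply: is_derive_eq; rewrite subr0 /GRing.scale/= mulr1.
      have := @is_derive1_comp _ f (fun y : R => (y - center n) / s) y _ _ (Df _) h.
      by rewrite mulrC.
    - move=> y; apply: cvgM; first exact: cvg_cst.
      apply: (continuous_comp (f := fun y : R => (y - center n) / s)); last exact: cdf.
      by apply: cvgM; [apply: cvgB; [exact: cvg_id|exact: cvg_cst]|exact: cvg_cst].
    - by move=> y; apply: (le_trans (f1 _)); rewrite lerDl ltW.
    - move=> y; rewrite normrM gtr0_norm//.
      by apply: (le_trans (ler_wpM2l (ltW sV) (df1 _))); rewrite mulr1 lerDr.
  rewrite -EX_sum// -EXZ; last exact: goodM.
  apply: eq_EX => x; rewrite /stein_factor mulr_suml mulr_sumr; apply: eq_bigr => j _.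
  by ring.
have E3 : EX X (fun x => (spread n - stein_factor x) * df (W x)) =
    spread n * EX X (fun x => df (W x)) - EX X (fun x => stein_factor x * df (W x)).
  rewrite -EXZ// -EXB; [|exact: goodZ|exact: goodM].
  by apply: eq_EX => x; rewrite mulrBl.
rewrite E1 E2 E3 -ss.
have sn : s != 0 by rewrite gt_eqF.
have alg (t A B D : R) : t != 0 ->
    D - t^-1 * (t^-1 * A + B) = (t ^+ 2)^-1 * (t ^+ 2 * D - A) - t^-1 * B.
  by move=> t0; field.
exact: alg.
Qed.

Variable v : R.
Hypothesis v0 : 0 < v.
Hypothesis hv : forall n (j : 'I_n.+1), v <= EX X (fun x => x j ^+ 2).
Hypotheses (d1 : (1 < d)%N) (ad : a d != 0).

(** The variance of the trace differs from that of its multilinear part by O(r),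
    which is small before r^2. *)
Lemma spread_ge : exists c B : R, [/\ 0 < c, 0 <= B &
  forall n, B <= rt R n -> c * rt R n ^+ 2 <= spread n].
Proof.
have [c [C [c0 C0 hC]]] := EX_main_part_sqr_ge hindep hsym mX v0 hv d1 ad.
have [C' C'0 hC'] := spread_diff_le.
exists (c / 2), (2 * (C + C') / c); split=> [||n hr].
- by rewrite divr_gt0.
- by rewrite divr_ge0 ?(ltW c0)// mulr_ge0// addr_ge0.
have r0 := rt_gt0 R n.
have := hC n; have := hC' n; rewrite -/(main_spread n) ler_norml => /andP[h1 _] h2.
move: hr; rewrite ler_pdivrMr// => hr.
have := ler_wpM2r (ltW r0) hr => hr2.
by move: h1 h2 hr2; move: (spread n) (main_spread n) => s m; rewrite expr2; lra.
Qed.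

(** The errors in the factor are O(r) against a variance of order r^2, and the rest
    is O(1) against a standard deviation of order r. *)
Lemma stein_discrepancy_le : exists K B : R, [/\ 0 <= K, 0 <= B & forall n, B <= rt R n ->
  0 < spread n /\ forall f df, stein_test f df ->
  `|EX X (fun x => df (normalized (n := n) x)) -
    EX X (fun x => normalized (n := n) x * f (normalized x))| <= K / rt R n].
Proof.
have [c [B [c0 B0 hc]]] := spread_ge.
have [C1 C10 h1] := spread_diff_le; have [C2 C20 h2] := stein_factor_le.
have [C3 C30 h3] := EX_rest0_le.
have sc0 : 0 < Num.sqrt c by rewrite sqrtr_gt0.
exists ((C1 + C2) / c + Num.sqrt C3 / Num.sqrt c), B; split=> // [|n Bn].
  by rewrite addr_ge0// divr_ge0 ?sqrtr_ge0 ?(ltW c0)// addr_ge0.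
have r0 := rt_gt0 R n; have cn := hc n Bn.
have sp0 : 0 < spread n by apply: lt_le_trans cn; rewrite mulr_gt0// exprn_gt0.
split; first exact: sp0.
move=> f df fdf; set W := normalized (n := n); have [gdf gf ->] := stein_identity fdf sp0.
have [_ _ f1 df1] := fdf.
apply: (le_trans (ler_normB _ _)); rewrite [leRHS]mulrDl lerD//.
  rewrite normrM gtr0_norm ?invr_gt0//.
  have A : `|EX X (fun x => (spread n - stein_factor x) * df (W x))| <= (C1 + C2) * rt R n.
    have -> : EX X (fun x => (spread n - stein_factor x) * df (W x)) =
        (spread n - main_spread n) * EX X (fun x => df (W x)) +
        EX X (fun x => (main_spread n - stein_factor x) * df (W x)).
      rewrite -EXZ// -EXD; [|exact: goodZ|]; last first.
        by apply: goodM => //; apply: goodB; [exact: good_cst|exact: good_stein_factor].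
      by apply: eq_EX => x; ring.
    apply: (le_trans (ler_normD _ _)); rewrite [leRHS]mulrDl lerD//; last exact: h2.
    rewrite normrM -[leRHS]mulr1 ler_pM//; rewrite -[X in `|X|]mul1r.
    have := @EX_mul1_le n.+1 (fun=> 1) (fun x => df (W x)) 1 (good_cst _ _ _) gdf ler01.
    rewrite EX_cst mul1r => /(_ (fun x => df1 _)).
    rewrite expr1n lexx => /(_ isT).
    by under eq_EX do rewrite mul1r.
  apply: (le_trans (ler_wpM2l _ A)); first by rewrite invr_ge0 ltW.
  rewrite mulrC ler_pdivrMr//.
  have C12 : 0 <= C1 + C2 by rewrite addr_ge0.
  apply: (@le_trans _ _ ((C1 + C2) / c / rt R n * (c * rt R n ^+ 2))).
    rewrite le_eqVlt; apply/orP; left; apply/eqP.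
    have rn : rt R n != 0 by rewrite gt_eqF.
    have cn0 : c != 0 by rewrite gt_eqF.
    by field; rewrite rn cn0.
  by rewrite ler_wpM2l// !divr_ge0 ?(ltW c0) ?(ltW r0).
have s0 : 0 < Num.sqrt (spread n) by rewrite sqrtr_gt0.
rewrite normrM gtr0_norm ?invr_gt0//.
have A : `|EX X (fun x => rest0 x * f (W x))| <= Num.sqrt C3.
  apply: EX_mul1_le => //; rewrite ?sqrtr_ge0//; first exact: good_rest0.
  by rewrite sqr_sqrtr.
apply: (le_trans (ler_wpM2l _ A)); first by rewrite invr_ge0 ltW.
rewrite mulrC -mulrA ler_wpM2l ?sqrtr_ge0// -invfM lef_pV2 ?posrE ?mulr_gt0//.
have -> : rt R n = Num.sqrt (rt R n ^+ 2) by rewrite sqrtr_sqr gtr0_norm.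
by rewrite -sqrtrM ?(ltW c0)// ler_wsqrtr.
Qed.

End SteinDiscrepancy.

(** * Convergence in total variation *)

Section Standardization.
Context d0 (T : measurableType d0) (R : realType) (P : probability T R).

Lemma fine_expectation (Y : T -> R) : fine 'E_P[Y] = Ex P Y.
Proof. by rewrite expectation.unlock. Qed.

Lemma fine_variance (Y : T -> R) : fine 'V_P[Y] = Ex P (fun w => (Y w - Ex P Y) ^+ 2).
Proof.
rewrite /variance covariance.unlock fine_expectation; congr Ex.
by apply/funext => w; rewrite expr2 fine_expectation.
Qed.

Lemma second_moment_ge (Y : T -> R) (v : R) : tame P Y -> (v%:E <= 'V_P[Y])%E ->
  v <= Ex P (fun w => Y w ^+ 2).
Proof.
move=> tY hv; have t2 : tame P (fun w => (Y w - Ex P Y) ^+ 2).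
  by apply: tameX; apply: tameB => //; exact: tame_cst.
have vE : 'V_P[Y] = (Ex P (fun w => (Y w - Ex P Y) ^+ 2))%:E.
  rewrite -fine_variance fineK// /variance covariance.unlock expectation.unlock.
  apply: integrable_fin_num => //; apply: integrable_eqR (tame_integrable t2) => // w _ /=.
move: hv; rewrite vE lee_fin => hv; apply: (le_trans hv).
have tc := tame_cst P (Ex P Y ^+ 2); have tZ := tameZ (2 * Ex P Y) tY.
have -> : Ex P (fun w => (Y w - Ex P Y) ^+ 2) = Ex P (fun w => Y w ^+ 2) - Ex P Y ^+ 2.
  have -> : (fun w => (Y w - Ex P Y) ^+ 2) =
      (fun w => Y w ^+ 2 - (2 * Ex P Y * Y w - Ex P Y ^+ 2)).
    by apply/funext => w; ring.
  rewrite ExB; [|exact: tameX|exact: tameB].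
  by rewrite ExB// ExZ// Ex_cst; ring.
by rewrite lerBlDr lerDl sqr_ge0.
Qed.

End Standardization.

Lemma symmetric_rv_law d0 (T : measurableType d0) (R : realType) (P : probability T R)
  (Y : {RV P >-> R}) : symmetric_rv Y -> symmetric_law (distribution P Y).
Proof. by move=> h B mB; exact: h. Qed.

Lemma inv_rt_cvg (R : realType) (K : R) : K / rt R n @[n --> \oo] --> (0 : R).
Proof.
rewrite -[X in _ --> X](mulr0 K); apply: cvgM; first exact: cvg_cst.
have -> : (fun n => (rt R n)^-1) = Num.sqrt \o harmonic.
  by apply/funext => n; rewrite /= /rt sqrtrV.
rewrite -[X in _ --> X]sqrtr0.
exact: (cvg_comp _ _ (@cvg_harmonic R) (@sqrt_continuous R 0)).
Qed.

Theorem theorem4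
  (R : realType) (disp : measure_display) (T : measurableType disp)
  (P : probability T R) (X : nat -> {RV P >-> R})
  (d : nat) (a : nat -> R) (sigma c1 c2 v : R)
  (hd : (2 <= d)%N) (had : a d != 0)
  (hsigma : 0 < sigma) (hc1 : 0 < c1) (hc2 : 0 < c2)
  (hindep : mutually_independent X)
  (hsym : forall i, symmetric_rv (X i))
  (hsub : forall i, subgaussian sigma (X i))
  (hL : forall i, class_L c1 c2 (distribution P (X i)))
  (hv : 0 < v) (hvar : forall i, (v%:E <= 'V_P[X i])%E) :
  let Pd : {poly R} := \sum_(2 <= k < d.+1) a k *: 'X^k in
  (fun n : nat =>
     tv_distance
       (pushforward P
          (standardized P (circulant_trace (fun i => X i : T -> R) Pd n)))
       (normal_prob 0 1))
    @ \oo --> (0 : \bar R).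
Proof.
move=> Pd.
have mX i := subgaussian_mbd (hsub i).
have tX i := mbd_tame (mX i).
have /choice[tau htau] : forall i, exists tau : R -> R,
    [/\ measurable_fun setT tau, forall x, `|tau x| <= kernel_cst c1,
        forall x, tau (- x) = tau x & is_stein_kernel (distribution P (X i)) tau].
  move=> i; apply: class_L_stein_kernel (hL i) (symmetric_rv_law (hsym i)) _.
  have mi : measurable_fun setT (X i) by [].
  apply/(law_transfer_integrable (p := distribution P (X i)) mi) => //.
  exact: tame_integrable (tameX 2 (tX i)).
have mtau i : measurable_fun setT (tau i) by have [] := htau i.
have btau i : forall x, `|tau i x| <= kernel_cst c1 by have [] := htau i.
have etau i : forall x, tau i (- x) = tau i x by have [] := htau i.
have ktau i : is_stein_kernel (distribution P (X i)) (tau i) by have [] := htau i.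
have hv2 n (j : 'I_n.+1) : v <= EX X (fun x : 'I_n.+1 -> R => x j ^+ 2).
  exact: second_moment_ge (tX j) (hvar j).
have [K [B [K0 B0 hKB]]] :=
  stein_discrepancy_le hindep hsym mX mtau btau ktau etau hv hv2 hd had.
have stdE n : standardized P (circulant_trace (fun i => X i : T -> R) Pd n) =
    fun w => normalized X a d (coords X w : 'I_n.+1 -> R).
  have tE : circulant_trace (fun i => X i : T -> R) Pd n =
      fun w => trace_poly a d (coords X w : 'I_n.+1 -> R).
    by apply/funext => w; exact: circulant_trace_poly.
  apply/funext => w; rewrite /standardized /normalized tE.
  by rewrite fine_variance fine_expectation.
have tv_le n : B <= rt R n ->
  (tv_distance (pushforward P
     (standardized P (circulant_trace (fun i => X i : T -> R) Pd n))) (normal_prob 0 1) <=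
   (stein_cst * K / rt R n)%:E)%E.
  move=> /hKB[sp0 hst]; rewrite stdE.
  have gW : good X (normalized X a d (n := n)).
    rewrite /normalized; under eq_fun do rewrite mulrC.
    by apply: goodZ; apply: goodB; [exact: (good_trace mX)|exact: good_cst].
  have mW : measurable_fun setT (fun w => normalized X a d (coords X w : 'I_n.+1 -> R)).
    exact: tame_measurable gW.2.
  pose W : {RV P >-> R} := mfun_Sub (mem_set mW).
  rewrite -mulrA; apply: (@stein_tv _ _ _ P W).
    exact: (good_int gW).
  by move=> f df /hst.
apply: (@squeeze_cvge _ _ _ _ (fun=> 0%E) _ (fun n => (stein_cst * K / rt R n)%:E)).
- near=> n; apply/andP; split.
    apply: (le_trans (abse_ge0 (pushforward P (standardized P
      (circulant_trace (fun i => X i : T -> R) Pd n)) set0 - normal_prob 0 1 set0)%E)).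
    by apply: ereal_sup_ubound; exists set0; [exact: measurable0|].
  apply: tv_le; near: n; exists (Num.bound (B ^+ 2)) => // m /= hm.
  rewrite -[B]ger0_norm// -sqrtr_sqr /rt ler_wsqrtr//.
  apply: (le_trans (ltW (archi_boundP (sqr_ge0 B)))).
  by rewrite ler_nat (leq_trans hm).
- exact: cvg_cst.
- by apply: cvg_EFin; [near=> n|exact: inv_rt_cvg].
Unshelve. all: by end_near.
Qed.
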